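(* Assume that the coefficients $a_{j,\alpha}$ are analytic. Then the following four conditions are satisfied, where each ''$\lesssim\log(1+|\xi|)$'' means that there are constants $C>0$ and $R\ge1$ such that the left-hand side is at most $C\log(1+|\xi|)$ for all $\xi\in\mathbb{R}^n$ with $|\xi|\ge R$: $$\int_0^T \sum_{(j,k)\in\mathcal{S}_2}\frac{|\partial_t\lambda_j(t,\xi)-\partial_t\lambda_k(t,\xi)|}{|\lambda_j(t,\xi)-\lambda_k(t,\xi)|}\,dt\lesssim\log(1+|\xi|),$$ $$\int_0^T \sum_{(j,k)\in\mathcal{S}_2}\frac{|\partial_t^2\lambda_j(t,\xi)-\partial_t^2\lambda_k(t,\xi)|}{|\partial_t\lambda_j(t,\xi)-\partial_t\lambda_k(t,\xi)|+1}\,dt\lesssim\log(1+|\xi|),$$ $$\int_0^T \sum_{j=1}^3\frac{\bigl|\partial_t\bigl[\check{M}(t,\lambda_j(t,\xi),\xi)\bigr]\bigr|}{|\check{M}(t,\lambda_j(t,\xi),\xi)|+1}\,dt\lesssim\log(1+|\xi|),$$ $$\int_0^T \sum_{j=1}^2\frac{\bigl|\partial_t\bigl[\check{N}(t,\mu_j(t,\xi),\xi)\bigr]\bigr|}{|\check{N}(t,\mu_j(t,\xi),\xi)|+1}\,dt\lesssim\log(1+|\xi|).$$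
   Context: Let $T>0$, $n\ge1$, and let $a_{j,\alpha}$ ($0\le j\le2$, $\alpha\in\mathbb{N}^n$, $|\alpha|\le3-j$) be functions of $t$, the coefficients of the operator $\partial_t^3+\sum_{j=0}^2\sum_{|\alpha|\le3-j}a_{j,\alpha}(t)\partial_t^j\partial_x^\alpha$; ''analytic'' means analytic in a neighbourhood of $[0,T]$. Put $$L=\tau^3+\sum_{j+|\alpha|=3}a_{j,\alpha}(t)\tau^j\xi^\alpha,\quad M=\sum_{j+|\alpha|=2}a_{j,\alpha}(t)\tau^j\xi^\alpha,\quad N=\sum_{j+|\alpha|=1}a_{j,\alpha}(t)\tau^j\xi^\alpha .$$ For every $(t,\xi)\in[0,T]\times\mathbb{R}^n$ the polynomial $\tau\mapsto L(t,\tau,\xi)$ has only real roots (weak hyperbolicity). The lower order coefficients may be complex valued. Auxiliary polynomial: $\mathcal{L}(t,\tau,\xi)=L(t,\tau,\xi)-\partial_\tau^2L(t,\tau,\xi)$. For $\xi\neq0$ its roots in $\tau$ are real and distinct, denoted $\lambda_1<\lambda_2<\lambda_3$; $\mu_1<\mu_2$ denote the roots in $\tau$ of $\partial_\tau\mathcal{L}$. $\check{M}=M-\tfrac12\partial_t\partial_\tau L$ and $\check{N}=N-\tfrac12\partial_t\partial_\tau M+\tfrac1{12}\partial_t^2\partial_\tau^2L$. In $\partial_t[\check{M}(t,\lambda_j(t,\xi),\xi)]$ and $\partial_t[\check{N}(t,\mu_j(t,\xi),\xi)]$ the derivative is the total derivative in $t$ of the composed function. $\mathcal{S}_2=\{(1,2),(2,3),(3,1)\}$.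 *)

(* Defs.v *)
From HB Require Import structures.
From mathcomp Require Import all_boot all_order all_algebra.
From mathcomp Require Import all_classical all_reals all_analysis.
From mathcomp.real_closed Require Import complex.

Set Implicit Arguments.
Unset Strict Implicit.
Unset Printing Implicit Defensive.

Import Order.TTheory GRing.Theory Num.Theory.
Import numFieldNormedType.Exports.

Local Open Scope classical_set_scope.
Local Open Scope ring_scope.
Local Open Scope complex_scope.

Section Calculus.
Variable R : realType.

Definition analytic_at (f : R -> R) (t0 : R) : Prop :=
  exists c : nat -> R,
    \forall t \near t0, pseries c (t - t0) @ \oo --> f t.

(* A complex-valued function of a real variable is analytic iff its real and
   imaginary parts are. *)
Definition analytic_near (A : set R) (f : R -> R[i]) : Prop :=
  exists U : set R, [/\ open U, A `<=` U &
    forall t, U t -> analytic_at (fun s => complex.Re (f s)) t /\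
                     analytic_at (fun s => complex.Im (f s)) t].

(* Derivative of a complex-valued function of a real variable; at a point where
   the real or imaginary part is not derivable the value is irrelevant. *)
Definition derive1C (f : R -> R[i]) (t : R) : R[i] :=
  derive1 (fun s => complex.Re (f s)) t +i* derive1 (fun s => complex.Im (f s)) t.

(* [`|z|] has type [R[i]]; its imaginary part is 0. *)
Definition modC (z : R[i]) : R := complex.Re `|z|.

(* The library's norm on row vectors is the sup norm. *)
Definition euclid_norm n (x : 'rV[R]_n) : R := Num.sqrt (\sum_i x 0 i ^+ 2).

End Calculus.

Section Symbols.
Variables (R : realType) (n : nat).

(* Since |alpha| <= 3 for every coefficient, each entry of a multi-index is < 4,
   so the multi-indices can be taken in a finite type. *)
Definition multiindex := {ffun 'I_n -> 'I_4}.

Definition mdeg (alpha : multiindex) : nat := (\sum_i alpha i)%N.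

Definition monom (xi : 'rV[R]_n) (alpha : multiindex) : R :=
  \prod_i xi 0 i ^+ alpha i.

(* [a j alpha] is the coefficient of d_t^j d_x^alpha; only the values with
   j + |alpha| <= 3 are ever used. *)
Definition coefficients := 'I_3 -> multiindex -> R -> R[i].

Variable a : coefficients.

(* Symbols are polynomials in tau, for fixed (t, xi). *)
Definition symbol_part (d : nat) (t : R) (xi : 'rV[R]_n) : {poly R[i]} :=
  \sum_(j < 3) \sum_(alpha : multiindex | (j + mdeg alpha == d)%N)
    (a j alpha t * (monom xi alpha)%:C) *: 'X^j.

Definition symL (t : R) (xi : 'rV[R]_n) : {poly R[i]} :=
  'X^3 + symbol_part 3 t xi.
Definition symM := symbol_part 2.
Definition symN := symbol_part 1.

Definition calL (t : R) (xi : 'rV[R]_n) : {poly R[i]} :=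
  symL t xi - (symL t xi)^`(2).

Definition checkM (t : R) (tau : R[i]) (xi : 'rV[R]_n) : R[i] :=
  (symM t xi).[tau]
  - 2%:R^-1 * derive1C (fun s => (symL s xi)^`().[tau]) t.

Definition checkN (t : R) (tau : R[i]) (xi : 'rV[R]_n) : R[i] :=
  (symN t xi).[tau]
  - 2%:R^-1 * derive1C (fun s => (symM s xi)^`().[tau]) t
  + 12%:R^-1 * derive1C (derive1C (fun s => (symL s xi)^`(2).[tau])) t.

End Symbols.

(* The roots of [p] are exactly the reals r_0 < ... < r_(m-1). *)
Definition ordered_roots (R : realType) (m : nat) (p : {poly R[i]})
    (r : 'I_m -> R) : Prop :=
  (forall j k : 'I_m, (j < k)%N -> r j < r k) /\
  (forall z : R[i], root p z <-> exists j, z = (r j)%:C).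

(* {(1,2),(2,3),(3,1)}, with indices shifted to start from 0 *)
Definition S2 : seq ('I_3 * 'I_3) :=
  [:: (inord 0, inord 1); (inord 1, inord 2); (inord 2, inord 0)].

(* [F t xi] is integrated as a function of t with values in the extended reals,
   so for nonnegative [F] the bound includes finiteness of the integral. *)
Definition int_log_bound (R : realType) (n : nat) (T : R)
    (F : R -> 'rV[R]_n -> R) : Prop :=
  exists C R0 : R, [/\ 0 < C, 1 <= R0 &
    forall xi : 'rV[R]_n, R0 <= euclid_norm xi ->
      (\int[@lebesgue_measure R]_(t in `[0%R, T]) (F t xi)%:E
        <= (C * ln (1 + euclid_norm xi))%:E)%E].

(* Main.v *)
(** The zeros of a function are counted uniformly in xi, and each integral is
    then bounded by (number of monotonicity intervals) * (sup of a logarithm).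

    For finitely many functions analytic near [[0, T]], the number of
    sign-constancy intervals of a linear combination is bounded independently
    of the coefficients: near a point, divide by one of the functions and apply
    Rolle's theorem to the quotient, whose derivative has a numerator in the
    span of the Wronskians, one function fewer.  Hence the same bound holds,
    uniformly in xi, for sums of products (analytic in t) * (function of xi), for quotients of
    such sums, and for every t-continuous function integral over the ring of
    these quotients: on an interval where each coefficient of its integral
    equation vanishes identically or nowhere, the lowest nonvanishing
    coefficient keeps the nonzero values of the function away from 0.

    The roots of [calL] and of its derivative are integral over that ring, and
    so are all their t-derivatives, because the discriminants are at least 1
    (this is where [calL = L - L''] and the hyperbolicity of L enter) and
    [1 / (lam_j - lam_k)] is a polynomial in the roots over the discriminant.
    So the derivative of [ln (lam_k - lam_j)], respectively of [asinh u]
    with u one of the other denominators, has boundedly many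
    sign changes, while these primitives are O(log (1 + |xi|)) by polynomial
    growth in xi. *)

Require Import Defs.
From HB Require Import structures.
From mathcomp Require Import all_boot all_order all_algebra.
From mathcomp Require Import all_classical all_reals all_analysis.
From mathcomp.real_closed Require Import complex.
From mathcomp Require Import measurable_realfun.
From mathcomp Require Import ring lra.

Set Implicit Arguments.
Unset Strict Implicit.
Unset Printing Implicit Defensive.

Import Order.TTheory GRing.Theory Num.Theory.
Import numFieldNormedType.Exports.

Local Open Scope classical_set_scope.
Local Open Scope ring_scope.
Local Open Scope complex_scope.

(** * Real-analytic functions of one variable *)

Section Analytic.
Variable R : realType.
Implicit Types (f g : R -> R) (c d : nat -> R) (t x : R).

(** The counts must be uniform in [xi], and compactness in [xi] is not at hand: [calL] is not
    homogeneous in [(tau, xi)], so [xi] cannot be rescaled to the unit sphere. A finite-dimensional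
    span of functions of [t] replaces compactness, because [xi] enters only through the coefficients
    of a combination. The roots need not lie in any such span. Integrality over the quotients,
    however, survives sums and products, and differentiating a root introduces no new inverse except
    that of a discriminant, which is itself one of the quotients. The roots are prescribed for [t]
    in [[0, T]] only, so two-sided derivatives in [t] make sense only for [0 < t < T], and
    everything built from the roots is studied there. The counts stay finite up to the end points
    because the coefficients are analytic at [0] and [T] as well. Boundedness of the primitives then
    gives integral bounds on closed subintervals that do not depend on the subinterval, and the open
    interval follows by exhaustion. *)

Definition coef_bound c (C M : R) := forall k, `|c k| <= C * M ^+ k.

Lemma natr_le_expr2 n : n%:R <= 2 ^+ n :> R.
Proof. by rewrite -natrX ler_nat ltnW// ltn_expl. Qed.

Lemma coef_bound_cvg c (C M : R) x : 0 <= C -> 0 <= M ->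
  coef_bound c C M -> `|x| * M < 1 -> cvgn (pseries c x).
Proof.
move=> C0 M0 cC xM; apply: normed_cvg => /=.
apply: (@series_le_cvg _ _ (geometric C (`|x| * M))) => //=.
- by move=> n; rewrite !mulr_ge0// exprn_ge0// mulr_ge0.
- move=> n; rewrite normrM normrX exprMn mulrCA mulrC.
  rewrite mulrA mulrAC -mulrA; apply: ler_wpM2l; first exact: exprn_ge0.
  by rewrite (le_trans (cC n))// mulrC.
- by apply: is_cvg_geometric_series; rewrite ger0_norm// mulr_ge0.
Qed.

(** The factor [k + 1] is absorbed by [k + 1 <= 2 ^ k], at the price of doubling the ratio [M]. *)
Lemma coef_bound_diffs c (C M : R) : 0 <= C -> 0 <= M -> coef_bound c C M ->
  coef_bound (pseries_diffs c) (C * M) (2 * M).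
Proof.
move=> C0 M0 cC k; rewrite /pseries_diffs normrM ger0_norm//.
apply: (@le_trans _ _ (2 ^+ k * (C * M ^+ k.+1))).
  apply: ler_pM => //; rewrite -natrX ler_nat; exact: ltn_expl.
by rewrite exprMn exprS le_eqVlt; apply/orP; left; apply/eqP; ring.
Qed.

Lemma near0P (P : R -> Prop) t0 : (\forall t \near t0, P t) <->
  exists2 e : R, 0 < e & forall t, `|t - t0| < e -> P t.
Proof.
split.
  move=> /nbhs_ballP[e /= e0 eP]; exists e => // t te; apply: eP.
  by rewrite /ball/= distrC.
move=> [e e0 eP]; apply/nbhs_ballP; exists e => //= t; rewrite /ball/= distrC.
exact: eP.
Qed.

(** Convergence at the single point [t0 + e / 2] bounds the terms [c k * (e / 2) ^ k], hence a
    geometric bound of ratio [(e / 2)^-1]. Such explicit bounds pass easily to derivatives and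
    products. *)
Lemma analytic_coef_bound f t0 : analytic_at f t0 ->
  exists c, exists C, exists2 M, [/\ 0 <= C, 0 < M & coef_bound c C M] &
    \forall t \near t0, pseries c (t - t0) @ \oo --> f t.
Proof.
move=> [c cf]; have /near0P[e e0 ef] := cf.
have : cvgn (pseries c (e / 2)).
  apply/cvg_ex; exists (f (t0 + e / 2)); rewrite [X in pseries c X](_ : _ = t0 + e / 2 - t0).
    by apply: ef; rewrite addrAC subrr add0r gtr0_norm; lra.
  by rewrite addrAC subrr add0r.
move=> /cvg_series_bounded[K [_ Kc]].
have h0 : 0 < e / 2 by rewrite divr_gt0.
exists c, (`|K| + 1), (e / 2)^-1 => //; split.
- by rewrite addr_ge0.
- by rewrite invr_gt0.
move=> k; have := Kc (`|K| + 1) _ k I.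
rewrite /= normrM [X in _ * X]ger0_norm ?exprn_ge0//; last exact: ltW.
move=> H; rewrite exprVn ler_pdivlMr ?exprn_gt0// H//.
by rewrite (le_lt_trans (ler_norm _))// ltrDl.
Qed.

Lemma coef_bound_analytic f t0 c (C M : R) : 0 <= C -> 0 < M ->
  coef_bound c C M -> (\forall t \near t0, pseries c (t - t0) @ \oo --> f t) ->
  \forall t \near t0, is_derive t (1:R) f (limn (pseries (pseries_diffs c) (t - t0))) /\
    pseries (pseries_diffs c) (t - t0) @ \oo --> derive1 f t.
Proof.
move=> C0 M0 cC cf.
have M20 : 0 <= 2 * M by rewrite mulr_ge0// ltW.
have M40 : 0 <= 2 * (2 * M) by rewrite mulr_ge0//.
have CM0 : 0 <= C * M by rewrite mulr_ge0// ltW.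
have cC1 := coef_bound_diffs C0 (ltW M0) cC.
have cC2 := coef_bound_diffs CM0 M20 cC1.
(* The twice derived series has ratio [4 * M]; with [8 * M] all three series converge at [K]. *)
pose K := (8 * M)^-1.
have K0 : 0 < K by rewrite invr_gt0; lra.
have KM (m : R) : 0 <= m < 8 * M -> `|K| * m < 1.
  by move=> /andP[m0 m8]; rewrite gtr0_norm// mulrC ltr_pdivrMr ?mul1r//; lra.
have ck : cvgn (pseries c K) by apply: coef_bound_cvg cC _ => //; [lra|apply: KM; lra].
have ck1 : cvgn (pseries (pseries_diffs c) K).
  by apply: coef_bound_cvg cC1 _ => //; apply: KM; lra.
have ck2 : cvgn (pseries (pseries_diffs (pseries_diffs c)) K).
  apply: coef_bound_cvg cC2 _ => //; [exact: mulr_ge0|apply: KM; lra].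
have nK : \forall t \near t0, `|t - t0| < K by apply/near0P; exists K.
(* The derivative at [t] requires the series to represent [f] on a neighbourhood of [t], not only at
   [t]. *)
have cf2 := near_join cf.
near=> t.
have tK : `|t - t0| < `|K| by rewrite [ltRHS]gtr0_norm//; near: t.
have H := pseries_snd_diffs ck ck1 ck2 tK.
have D : is_derive t (1:R) f (limn (pseries (pseries_diffs c) (t - t0))).
  apply: (@near_eq_is_derive _ _ _ (fun s => limn (pseries c (s - t0)))).
    have : \forall s \near t, pseries c (s - t0) @ \oo --> f s by near: t.
    by apply: filterS => s /cvg_lim <-.
  have := @is_derive1_comp _ (fun x => limn (pseries c x)) (fun s => s - t0) t _ _ H.
  move=> /(_ 1); rewrite mulr1; apply.
  by have := @is_deriveB _ _ _ id (cst t0) t 1 1 0 _ _; rewrite subr0; apply.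
split=> //; rewrite derive1E; have -> := @derive_val _ _ _ _ _ _ _ D.
exact: (is_cvg_pseries_inside ck1 tK).
Unshelve. all: by end_near. Qed.

Lemma analytic_derive1 f t0 : analytic_at f t0 -> analytic_at (derive1 f) t0.
Proof.
move=> /analytic_coef_bound[c [C [M [C0 M0 cC] cf]]]; exists (pseries_diffs c).
by apply: filterS (coef_bound_analytic C0 M0 cC cf) => t [].
Qed.

Lemma analytic_derivable_near f t0 : analytic_at f t0 ->
  \forall t \near t0, derivable f t 1.
Proof.
move=> /analytic_coef_bound[c [C [M [C0 M0 cC] cf]]].
by apply: filterS (coef_bound_analytic C0 M0 cC cf) => t [D _]; exact: ex_derive.
Qed.

Lemma analytic_derivable f t0 : analytic_at f t0 -> derivable f t0 1.
Proof. by move=> /analytic_derivable_near; exact: nbhs_singleton. Qed.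

Lemma derivable_continuous f t : derivable f t 1 -> {for t, continuous f}.
Proof. by move=> /derivable1_diffP/differentiable_continuous. Qed.

Lemma analytic_cst (a : R) t0 : analytic_at (cst a) t0.
Proof.
exists (fun k => if k is 0 then a else 0); near=> t.
rewrite -cvg_shiftS; apply: cvg_near_cst; near=> n.
rewrite /pseries/series/= big_nat_recl// expr0 mulr1 big1 ?addr0// => i _; exact: mul0r.
Unshelve. all: by end_near. Qed.

Lemma analytic_add f g t0 : analytic_at f t0 -> analytic_at g t0 ->
  analytic_at (fun t => f t + g t) t0.
Proof.
move=> [c cf] [d dg]; exists (fun k => c k + d k); apply: filterS2 cf dg => t cf dg.
rewrite (_ : pseries _ _ = (fun n => pseries c (t - t0) n + pseries d (t - t0) n)).
  exact: cvgD.
by apply/funext => n; rewrite /pseries /series/= -big_split; apply: eq_bigr => i _; rewrite mulrDl.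
Qed.

(** The truncated sums are the values at 1 of polynomials [P] and [Q], and the Cauchy partial sum
    collects the coefficients of [P * Q] below [N]. What remains are the [N] coefficients from [N]
    to [2 * N - 1], each a sum of at most [2 * N] terms bounded by [C * D * q ^ N]. *)
Lemma cauchy_product_bound (a b : nat -> R) (C D q : R) (N : nat) :
  0 <= C -> 0 <= D -> 0 <= q -> q <= 1 ->
  (forall i, `|a i| <= C * q ^+ i) -> (forall i, `|b i| <= D * q ^+ i) ->
  `|(\sum_(0 <= n < N) a n) * (\sum_(0 <= n < N) b n)
    - \sum_(0 <= n < N) \sum_(i < n.+1) a i * b (n - i)%N|
  <= (2 * C * D) * ((N%:R * N%:R) * q ^+ N).
Proof.
move=> C0 D0 q0 q1 aC bD.
pose P := \poly_(i < N) a i; pose Q := \poly_(i < N) b i.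
have pE (u : nat -> R) : \sum_(0 <= n < N) u n = (\poly_(i < N) u i).[1].
  by rewrite horner_poly big_mkord; apply: eq_bigr => i _; rewrite expr1n mulr1.
have sPQ : (size (P * Q)%R <= N + N)%N.
  by rewrite (leq_trans (size_polyMleq _ _))// (leq_trans (leq_pred _))// leq_add// size_poly.
rewrite !pE -hornerM (horner_coef_wide _ sPQ).
under eq_bigr do rewrite expr1n mulr1.
rewrite -(big_mkord xpredT (fun i => (P * Q)`_i)) (big_cat_nat (n := N))//= ?leq_addr//.
rewrite -pE.
have -> : \sum_(0 <= i < N) (P * Q)`_i = \sum_(0 <= n < N) \sum_(i < n.+1) a i * b (n - i)%N.
  apply: eq_big_nat => n /andP[_ nN]; rewrite coefM; apply: eq_bigr => i _.
  rewrite !coef_poly (leq_ltn_trans _ nN) 1?(leq_ltn_trans _ nN)//.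
  - exact: leq_subr.
  - by rewrite -ltnS.
rewrite addrAC subrr add0r (le_trans (ler_norm_sum _ _ _))//.
have tB n : (N <= n < N + N)%N -> `|(P * Q)`_n| <= (2 * N%:R) * (C * D * q ^+ N).
  move=> /andP[Nn nNN]; rewrite coefM (le_trans (ler_norm_sum _ _ _))//.
  apply: (@le_trans _ _ (\sum_(i < n.+1) (C * D * q ^+ N))).
    apply: ler_sum => i _; rewrite normrM !coef_poly.
    apply: (@le_trans _ _ ((C * q ^+ i) * (D * q ^+ (n - i)))).
      apply: ler_pM => //; case: ifP => _ //; rewrite normr0 mulr_ge0//; exact: exprn_ge0.
    rewrite mulrACA -exprD subnKC; last by rewrite -ltnS.
    apply: ler_wpM2l; first exact: mulr_ge0.
    exact: ler_wiXn2l.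
  rewrite sumr_const card_ord -[leLHS]mulr_natl; apply: ler_wpM2r.
    by rewrite !mulr_ge0// exprn_ge0.
  by rewrite -natrM ler_nat mul2n -addnn.
apply: (@le_trans _ _ (\sum_(N <= i < N + N) (2 * N%:R) * (C * D * q ^+ N))).
  exact: ler_sum_nat.
rewrite sumr_const_nat addKn -mulr_natl le_eqVlt; apply/orP; left; apply/eqP; ring.
Qed.

Lemma analytic_mul f g t0 : analytic_at f t0 -> analytic_at g t0 ->
  analytic_at (fun t => f t * g t) t0.
Proof.
move=> /analytic_coef_bound[c [C [M [C0 M0 cC] cf]]].
move=> /analytic_coef_bound[d [D [M' [D0 M'0 dD] dg]]].
exists (fun n => \sum_(i < n.+1) c i * d (n - i)%N).
pose M1 := M + M'.
have nK : \forall t \near t0, `|t - t0| < (8 * M1)^-1.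
  by apply/near0P; exists (8 * M1)^-1; rewrite // invr_gt0 /M1; lra.
apply: filterS3 nK cf dg => t tK cA cB; set x := t - t0.
pose q := `|x| * M1.
have M10 : 0 < M1 by rewrite /M1; lra.
have q0 : 0 <= q by rewrite mulr_ge0// ltW.
(* A ratio of [1/8] beats the factor [N ^ 2 <= 2 ^ N * 2 ^ N] of the remainder and leaves
   [2 ^ (- N)]. *)
have q8 : q <= 8^-1.
  rewrite -ler_pdivlMr// -invfM ltW//.
have bnd (u : nat -> R) E m : 0 <= E -> 0 <= m <= M1 -> coef_bound u E m ->
    forall i, `|u i * x ^+ i| <= E * q ^+ i.
  move=> E0 /andP[m0 mM] uE i; rewrite normrM normrX /q exprMn mulrCA mulrC ler_wpM2l ?exprn_ge0//.
  rewrite (le_trans (uE i))// ler_wpM2l// lerXn2r// ?nnegrE// ltW//.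
have aC := bnd _ _ _ C0 _ cC; have bD := bnd _ _ _ D0 _ dD.
have {}aC : forall i, `|c i * x ^+ i| <= C * q ^+ i by apply: aC; rewrite /M1; lra.
have {}bD : forall i, `|d i * x ^+ i| <= D * q ^+ i by apply: bD; rewrite /M1; lra.
have q1 : q <= 1 by apply: (le_trans q8); rewrite invf_le1 ?ler1n.
have B N := cauchy_product_bound N C0 D0 q0 q1 aC bD.
pose r N := pseries c x N * pseries d x N -
  pseries (fun n => \sum_(i < n.+1) c i * d (n - i)%N) x N.
have rB N : `|r N| <= geometric (2 * C * D) (2^-1) N.
  rewrite /geometric/=; have := B N; rewrite /r /pseries/series/=.
  rewrite [X in _ -> `|_ - X| <= _](_ : _ = \sum_(0 <= n < N)
     \sum_(i < n.+1) c i * x ^+ i * (d (n - i)%N * x ^+ (n - i))); last first.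
    apply: eq_big_nat => n _; rewrite mulr_suml; apply: eq_bigr => i _.
    rewrite [RHS]mulrACA -exprD subnKC//; by rewrite -ltnS.
  move=> /le_trans; apply; apply: ler_wpM2l; first by rewrite !mulr_ge0.
  apply: (@le_trans _ _ ((2 ^+ N * 2 ^+ N) * (8^-1) ^+ N)).
    apply: ler_pM; [by rewrite mulr_ge0|exact: exprn_ge0| |].
      by apply: ler_pM => //; exact: natr_le_expr2.
    by rewrite lerXn2r// ?nnegrE ?invr_ge0.
  by rewrite -!exprMn lerXn2r ?nnegrE//; lra.
have r0 : r @ \oo --> 0.
  apply/norm_cvg0P; apply: (@squeeze_cvgr _ _ _ _ (cst 0) (geometric (2 * C * D) (2^-1))).
  - by near=> N; rewrite normr_ge0 rB.
  - exact: cvg_cst.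
  - by apply: cvg_geometric; rewrite ger0_norm; lra.
rewrite (_ : pseries _ _ = (fun N => pseries c x N * pseries d x N - r N)).
  rewrite -[f t * g t]subr0; apply: cvgB => //; exact: cvgM.
by apply/funext => N; rewrite /r opprB addrC subrK.
Unshelve. all: by end_near. Qed.

(** If [k] is the least index of a nonzero coefficient, then [f t = (t - t0) ^ k * h t], where [h]
    is continuous at [t0] and [h t0 = c k] is nonzero. Without such an index the series is zero. *)
Lemma analytic_dichotomy f t0 : analytic_at f t0 ->
  (\forall t \near t0, f t = 0) \/
  (\forall t \near t0, t != t0 -> f t != 0).
Proof.
move=> /analytic_coef_bound[c [C [M [C0 M0 cC] cf]]].
have [c0|/existsNP[k0 /eqP ck0]] := pselect (forall k, c k = 0).
  left; apply: filterS cf => t /cvg_lim <- //.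
  rewrite (_ : pseries _ _ = cst 0) ?lim_cst//.
  by apply/funext => n; rewrite /pseries/series/= big1// => i _; rewrite c0 mul0r.
right; have exk : exists k, c k != 0 by exists k0.
case: (ex_minnP exk) => k ck kmin.
have clt i : (i < k)%N -> c i = 0.
  move=> ik; apply/eqP; apply/negPn/negP => ci; have := kmin _ ci.
  by rewrite leqNgt ik.
pose d i := c (k + i)%N.
have dC : coef_bound d (C * M ^+ k) M.
  by move=> i; rewrite /d -mulrA -exprD; exact: cC.
pose h t := limn (pseries d (t - t0)).
have Ck0 : 0 <= C * M ^+ k by rewrite mulr_ge0// exprn_ge0// ltW.
have nM : \forall t \near t0, `|t - t0| < M^-1.
  by apply/near0P; exists M^-1; rewrite // invr_gt0.
have dh : \forall t \near t0, pseries d (t - t0) @ \oo --> h t.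
  near=> t; apply: (coef_bound_cvg Ck0 (ltW M0) dC).
  by rewrite -ltr_pdivlMr// mul1r; near: t.
have h_cont : {for t0, continuous h}.
  by apply: derivable_continuous; apply: analytic_derivable; exists d.
have h0 : h t0 = c k.
  rewrite /h subrr; apply: cvg_lim => //; rewrite -cvg_shiftS.
  apply: cvg_near_cst; near=> n; rewrite /pseries/series/= big_nat_recl// expr0 mulr1 /d addn0 big1 ?addr0//.
  by move=> i _; rewrite expr0n/= mulr0.
have hn : \forall t \near t0, h t != 0.
  have : \forall y \near h t0, y != 0.
    by apply: open_nbhs_nbhs; split; [exact: open_neq|rewrite h0].
  by move=> /h_cont.
near=> t => tt0.
have ht : pseries d (t - t0) @ \oo --> h t by near: t.
have -> : f t = (t - t0) ^+ k * h t.
  have cft : pseries c (t - t0) @ \oo --> f t by near: t.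
  have := cft; rewrite -(cvg_shiftn k) => /cvg_lim <- //; apply: cvg_lim => //.
  rewrite [X in X @ _ --> _](_ : _ = fun n => (t - t0) ^+ k * pseries d (t - t0) n).
    by apply: cvgM => //; exact: cvg_cst.
  apply/funext => n; rewrite /pseries/series/= (big_cat_nat (n := k)) ?leq_addl//=.
  rewrite big_nat_cond big1 ?add0r; last first.
    by move=> i /andP[/andP[_ ik] _]; rewrite clt// mul0r.
  rewrite -{1}[k]add0n big_addn addnK mulr_sumr; apply: eq_bigr => i _.
  by rewrite /d addnC exprD mulrCA.
rewrite mulf_neq0 ?expf_neq0 ?subr_eq0//; near: t; exact: hn.
Unshelve. all: by end_near. Qed.

Lemma derivable_is_derive1 f t : derivable f t 1 -> is_derive t (1 : R) f (derive1 f t).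
Proof. by move=> df; split=> //; rewrite derive1E. Qed.

Lemma is_derive_derive1 f t (a : R) : is_derive t (1 : R) f a -> derive1 f t = a.
Proof. by move=> D; rewrite derive1E; exact: derive_val. Qed.

Lemma continuous_near_eq f g t : (\forall r \near t, f r = g r) ->
  {for t, continuous f} -> {for t, continuous g}.
Proof.
move=> fg fc; rewrite /prop_for /continuous_at -(nbhs_singleton fg).
by apply: cvg_trans fc; apply: near_eq_cvg.
Qed.

End Analytic.

(** * Uniform bounds on the number of zeros in a finite-dimensional span *)

Section Pieces.
Variable R : realType.
Implicit Types (Q : R -> R -> Prop) (u v w f : R -> R) (l : seq (R -> R)).

(* [pieces Q n x y]: [x, y] can be cut into at most n intervals satisfying Q. *)
Inductive pieces Q : nat -> R -> R -> Prop :=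
| pieces_leaf n x y : Q x y -> pieces Q n.+1 x y
| pieces_node n m x z y : x <= z -> z <= y ->
    pieces Q n x z -> pieces Q m z y -> pieces Q (n + m) x y.

Definition hereditary Q := forall x y x' y' : R,
  x <= x' -> x' <= y' -> y' <= y -> Q x y -> Q x' y'.

Lemma pieces_leq Q n m x y : pieces Q n x y -> (n <= m)%N -> pieces Q m x y.
Proof.
move=> H; elim: H m => {n x y}.
  by move=> n x y Qxy [//|m] _; exact: pieces_leaf.
move=> n k x z y xz zy H1 _ H2 IH2 m nkm.
have nm : (n <= m)%N by rewrite (leq_trans _ nkm)// leq_addr.
rewrite -(subnKC nm); apply: (pieces_node xz zy H1); apply: IH2.
by rewrite leq_subRL.
Qed.

Lemma pieces_sub Q n x y x' y' : hereditary Q -> pieces Q n x y ->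
  x <= x' -> x' <= y' -> y' <= y -> pieces Q n x' y'.
Proof.
move=> hQ H; elim: H x' y' => {n x y}.
  by move=> n x y Qxy x' y' *; apply: pieces_leaf; exact: hQ Qxy.
move=> n m x z y xz zy H1 IH1 H2 IH2 x' y' xx' xy' yy'.
have [zx'|x'z] := leP z x'.
  by apply: (pieces_leq (IH2 _ _ zx' xy' yy')); rewrite leq_addl.
have [zy'|y'z] := leP z y'; last first.
  by apply: (pieces_leq (IH1 _ _ xx' xy' (ltW y'z))); rewrite leq_addr.
apply: (pieces_node (ltW x'z) zy').
  by apply: IH1 => //; exact: ltW.
exact: IH2.
Qed.

Lemma pieces_bind Q Q' n m x y : pieces Q n x y -> x <= y ->
  (forall x' y', x <= x' -> x' <= y' -> y' <= y -> Q x' y' -> pieces Q' m x' y') ->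
  pieces Q' (n * m) x y.
Proof.
elim=> {n x y}.
  move=> n x y Qxy xy H; apply: pieces_leq (H _ _ _ _ _ Qxy) _ => //.
  by rewrite mulSn leq_addr.
move=> n k x z y xz zy H1 IH1 H2 IH2 xy H; rewrite mulnDl.
apply: (pieces_node xz zy).
  by apply: IH1 => // x' y' *; apply: H => //; exact: le_trans zy.
by apply: IH2 => // x' y' *; apply: H => //; exact: le_trans xz _.
Qed.

Lemma pieces_impl Q Q' n x y : pieces Q n x y -> x <= y ->
  (forall x' y', x <= x' -> x' <= y' -> y' <= y -> Q x' y' -> Q' x' y') ->
  pieces Q' n x y.
Proof.
move=> H xy HQ; rewrite -[n]muln1; apply: (pieces_bind H xy) => x' y' *.
by apply: pieces_leaf; exact: HQ.
Qed.

Lemma pieces_and Q Q' n m x y : hereditary Q -> hereditary Q' -> x <= y ->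
  pieces Q n x y -> pieces Q' m x y ->
  pieces (fun a b => Q a b /\ Q' a b) (n * m) x y.
Proof.
move=> hQ hQ' xy H H'; apply: (pieces_bind H xy) => x' y' xx' xy' yy' Qx.
have H2 := pieces_sub hQ' H' xx' xy' yy'.
apply: (pieces_impl H2 xy') => a b *; split => //; exact: hQ Qx.
Qed.

(** The interval is open so that isolated zeros can be placed at cut points. *)
Definition zero_or_free u (x y : R) :=
  (forall t, x < t < y -> u t = 0) \/ (forall t, x < t < y -> u t != 0).

Lemma zero_or_free_hereditary u : hereditary (zero_or_free u).
Proof.
move=> x y x' y' xx' _ yy' [H|H]; [left|right] => t /andP[x't ty'];
by apply: H; rewrite (le_lt_trans xx')//= (lt_le_trans ty').
Qed.

Fixpoint lspan l u : Prop :=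
  match l with
  | [::] => forall t, u t = 0
  | f :: l' => exists c v, lspan l' v /\ forall t, u t = c * f t + v t
  end.

Lemma mvt_oo (g dg : R -> R) (x y s t : R) :
  (forall r, x < r < y -> is_derive r (1 : R) g (dg r)) ->
  x < s -> s < t -> t < y ->
  exists2 c, s < c < t & g t - g s = dg c * (t - s).
Proof.
move=> D xs st ty.
have [||c] := @MVT R g dg s t st.
- by move=> r; rewrite in_itv/= => /andP[sr rt]; apply: D; rewrite (lt_trans xs)//= (lt_trans rt).
- apply: derivable_within_continuous => r; rewrite in_itv/= => /andP[sr rt].
  by apply: ex_derive; apply: D; rewrite (lt_le_trans xs)//= (le_lt_trans rt).
by rewrite in_itv/= => cst E; exists c.
Qed.

(** The numerator of the derivative of [h / f]. *)
Definition wronsk f (h : R -> R) (t : R) := derive1 h t * f t - h t * derive1 f t.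

(** The Wronskian with [f] is linear in its other argument, so it maps the span of [l] into the span
    of the Wronskians. The identity is claimed only on [P], where all derivatives exist; elsewhere
    [w] is still the same linear combination. *)
Lemma lspan_wronsk (P : R -> Prop) f l v : lspan l v ->
  List.Forall (fun h => forall t, P t -> derivable h t 1) l ->
  exists2 w, lspan (map (wronsk f) l) w &
    forall t, P t -> derivable v t 1 /\ w t = wronsk f v t.
Proof.
elim: l v => [|h l IH] v /=.
  move=> v0 _; exists (cst 0) => // t _.
  have -> : v = cst 0 by apply/funext.
  by split=> //; rewrite /wronsk derive1_cst !mul0r subrr.
move=> [c [v' [sv' vE]]] HF.
have Hh := List.Forall_inv HF; have Hl := List.Forall_inv_tail HF.
have [w sw wE] := IH _ sv' Hl.
exists (fun t => c * wronsk f h t + w t); first by exists c, w.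
have -> : v = (c *: h) \+ v' by apply/funext => t; rewrite vE.
move=> t Pt; have [dv' ->] := wE t Pt; have dh := Hh t Pt.
have D := is_deriveD (is_deriveZ c (derivable_is_derive1 dh)) (derivable_is_derive1 dv').
split; first exact: ex_derive.
rewrite /wronsk (is_derive_derive1 D).
change ((c *: h \+ v') t) with (c * h t + v' t).
by rewrite /GRing.scale/=; ring.
Qed.

(** Zeros of [c * f + v] are the points where [g = v / f] takes the value [- c], and
    [g' = w / f ^ 2]. Where [w] vanishes, [g] is constant and the combination is zero everywhere or
    nowhere; where [w] has no zero, [g] takes the value [- c] at most once, and one cut there
    suffices. This explains the factor 2. *)
Lemma wronsk_pieces f v w c (p q : R) n : p <= q ->
  (forall t, p < t < q -> f t != 0 /\ derivable f t 1) ->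
  (forall t, p < t < q -> derivable v t 1 /\ w t = wronsk f v t) ->
  pieces (zero_or_free w) n p q ->
  pieces (zero_or_free (fun t => c * f t + v t)) (n * 2) p q.
Proof.
move=> pq fP vP H; apply: (pieces_bind H pq) => x y px xy yq wxy.
pose g t := v t / f t; set u := fun t => _.
have inpq t : x < t < y -> p < t < q.
  by move=> /andP[xt ty]; rewrite (le_lt_trans px)//= (lt_le_trans ty).
have gD t : x < t < y -> is_derive t (1 : R) g (w t / f t ^+ 2).
  move=> /inpq tpq; have [f0 df] := fP t tpq; have [dv ->] := vP t tpq.
  have Df : is_derive t 1 f (derive1 f t) by exact: derivable_is_derive1.
  have Dv : is_derive t 1 v (derive1 v t) by exact: derivable_is_derive1.
  have Dfi := is_deriveV f0 Df.
  have := is_deriveM Dv Dfi; rewrite /g /wronsk => DD.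
  apply: (@is_derive_eq _ _ _ _ _ _ _ _ DD).
  by rewrite /GRing.scale/= -exprVn; field.
have uE t : x < t < y -> (u t == 0) = (g t == - c).
  move=> /inpq tpq; have [f0 _] := fP t tpq.
  rewrite /u /g -[in RHS]subr_eq0 opprK; have -> : v t / f t + c = (c * f t + v t) / f t by field.
  by rewrite mulf_eq0 invr_eq0 (negbTE f0) orbF.
case: wxy => [w0|wn0].
  apply: pieces_leaf; have [[z zxy uz]|nz] := pselect (exists2 z, x < z < y & u z = 0).
    left => t txy; apply/eqP; rewrite uE//; have : u z == 0 by apply/eqP.
    rewrite uE// => /eqP <-; have [zt|tz|->//] := ltgtP z t; apply/eqP.
      have [r /andP[zr rt]] := mvt_oo gD (proj1 (andP zxy)) zt (proj2 (andP txy)).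
      rewrite w0 ?mul0r ?mul0r => [/eqP|]; first by rewrite subr_eq0 => /eqP.
      by rewrite (lt_trans _ zr) ?(lt_trans rt)//; [case/andP: txy|case/andP: zxy].
    have [r /andP[zr rt]] := mvt_oo gD (proj1 (andP txy)) tz (proj2 (andP zxy)).
    rewrite w0 ?mul0r ?mul0r => [/eqP|]; first by rewrite subr_eq0 => /eqP.
    by rewrite (lt_trans _ zr) ?(lt_trans rt)//; [case/andP: zxy|case/andP: txy].
  by right => t txy; apply/eqP => ut; apply: nz; exists t.
have one s t : x < s -> s < t -> t < y -> u s = 0 -> u t = 0 -> False.
  move=> xs st ty us ut.
  have sxy : x < s < y by rewrite xs (lt_trans st).
  have txy : x < t < y by rewrite ty (lt_trans xs).
  have /eqP gs : g s == - c by rewrite -uE// us.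
  have /eqP gt : g t == - c by rewrite -uE// ut.
  have [r /andP[sr rt]] := mvt_oo gD xs st ty.
  have rxy : x < r < y by rewrite (lt_trans xs)//= (lt_trans rt).
  rewrite gs gt subrr => /esym/eqP; rewrite !mulf_eq0 invr_eq0 expf_eq0/=.
  rewrite (negbTE (wn0 _ rxy)) (negbTE (proj1 (fP _ (inpq _ rxy)))) subr_eq0/=.
  by rewrite gt_eqF.
have [[z zxy uz]|nz] := pselect (exists2 z, x < z < y & u z = 0); last first.
  by apply: pieces_leaf; right => t txy; apply/eqP => ut; apply: nz; exists t.
have [xz zy] := andP zxy.
apply: (@pieces_node _ 1 1 x z y (ltW xz) (ltW zy)); apply: pieces_leaf; right => t /andP[t1 t2];
  apply/eqP => ut.
- exact: (one t z).
- exact: (one z t).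
Qed.

(** Induction on the length of [l]. A head that vanishes near [t0] is dropped; otherwise it has no
    zero near [t0] except possibly [t0] itself, and division by it is legitimate on each side. Hence
    the two one-sided intervals in the conclusion. *)
Lemma lspan_pieces_near l (t0 : R) : List.Forall (fun f => analytic_at f t0) l ->
  exists2 e, 0 < e & exists N, forall u, lspan l u ->
    pieces (zero_or_free u) N (t0 - e) t0 /\ pieces (zero_or_free u) N t0 (t0 + e).
Proof.
have [k] := ubnP (size l); elim: k l => // k IH [_ _|f l /= sl Hl].
  exists 1; first exact: ltr01.
  by exists 1%N => u u0; split; apply: pieces_leaf; left => t _; exact: u0.
have Hl1 := Hl; have anf := List.Forall_inv Hl; have {}Hl := List.Forall_inv_tail Hl.
have [f0|fn0] := analytic_dichotomy anf.
  have [e1 e10 e1P] := (near0P _ _).1 f0.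
  have [e2 e20 [N NP]] := IH l sl Hl.
  exists (Num.min e1 e2); first by rewrite lt_min e10.
  exists N => u [c [v [/NP[P1 P2] uE]]].
  have m0 : 0 < Num.min e1 e2 by rewrite lt_min e10.
  have m1 : Num.min e1 e2 <= e1 by rewrite ge_min lexx.
  have m2 : Num.min e1 e2 <= e2 by rewrite ge_min lexx orbT.
  have uv t : `|t - t0| < Num.min e1 e2 -> u t = v t.
    by move=> /lt_le_trans/(_ m1)/e1P; rewrite uE => ->; rewrite mulr0 add0r.
  have loc a b : t0 - Num.min e1 e2 <= a -> b <= t0 + Num.min e1 e2 ->
      zero_or_free v a b -> zero_or_free u a b.
    move=> a1 b1 [H|H]; [left|right] => t tab; rewrite uv ?H//; case/andP: tab => *;
    rewrite ltr_distl; apply/andP; split; lra.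
  split.
    have P : pieces (zero_or_free v) N (t0 - Num.min e1 e2) t0.
      by apply: (pieces_sub (@zero_or_free_hereditary v) P1); lra.
    by apply: (pieces_impl P); [lra|move=> *; apply: loc => //; lra].
  have P : pieces (zero_or_free v) N t0 (t0 + Num.min e1 e2).
    by apply: (pieces_sub (@zero_or_free_hereditary v) P2); lra.
  by apply: (pieces_impl P); [lra|move=> *; apply: loc => //; lra].
have nD : \forall t \near t0, List.Forall (fun h : R -> R => derivable h t 1) (f :: l).
  elim: {IH sl} (f :: l) Hl1 => [_|h l' IH' Hl'].
    by near=> t.
  have a := List.Forall_inv Hl'; have b := List.Forall_inv_tail Hl'.
  by apply: filterS2 (analytic_derivable_near a) (IH' b) => t A B; constructor.
have Hl' : List.Forall (fun f => analytic_at f t0) (map (wronsk f) l).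
  elim: l Hl {IH sl nD Hl1} => [|h l IH' Hl] /=; first by constructor.
  have a := List.Forall_inv Hl; have b := List.Forall_inv_tail Hl.
  constructor; last exact: IH'.
  have -> : wronsk f h = fun t => derive1 h t * f t + (-1) * (h t * derive1 f t).
    by apply/funext => t; rewrite /wronsk mulN1r.
  apply: analytic_add; first by apply: analytic_mul => //; exact: analytic_derive1.
  apply: analytic_mul; first exact: analytic_cst.
  by apply: analytic_mul => //; exact: analytic_derive1.
have [e1 e10 e1P] : exists2 e, 0 < e & forall t, `|t - t0| < e -> (t != t0 -> f t != 0) /\
    List.Forall (fun h : R -> R => derivable h t 1) (f :: l).
  by apply/near0P; apply: filterS2 fn0 nD.
have [|e2 e20 [N NP]] := IH _ _ Hl'; first by rewrite size_map.
exists (Num.min e1 e2); first by rewrite lt_min e10.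
exists (N * 2)%N => u [c [v [sv uE]]].
have m0 : 0 < Num.min e1 e2 by rewrite lt_min e10.
have m1 : Num.min e1 e2 <= e1 by rewrite ge_min lexx.
have m2 : Num.min e1 e2 <= e2 by rewrite ge_min lexx orbT.
have HF : List.Forall (fun h => forall t, `|t - t0| < e1 -> derivable h t 1) l.
  apply/List.Forall_forall => h hl t /e1P[_ D].
  by have /List.Forall_forall := List.Forall_inv_tail D; apply.
have [w sw wE] := lspan_wronsk f sv HF.
have [P1 P2] := NP _ sw.
have uE' : u = fun t => c * f t + v t by apply/funext.
have loc p q : t0 - Num.min e1 e2 <= p -> q <= t0 + Num.min e1 e2 -> p <= q ->
    (q <= t0 \/ t0 <= p) -> pieces (zero_or_free w) N p q ->
    pieces (zero_or_free u) (N * 2) p q.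
  move=> hp hq pq side H; rewrite uE'.
  have bd t : p < t < q -> `|t - t0| < e1.
    by move=> /andP[pt tq]; rewrite ltr_distl; apply/andP; split; lra.
  have nt t : p < t < q -> t != t0.
    by move=> /andP[pt tq]; case: side => ?; [rewrite lt_eqF|rewrite gt_eqF]; lra.
  apply: (wronsk_pieces c pq _ _ H) => t tpq; last exact: wE (bd _ tpq).
  have [a b] := e1P _ (bd _ tpq); split; first exact: a (nt _ tpq).
  exact: List.Forall_inv b.
split.
  apply: loc; [exact: lexx|lra|lra|by left|].
  by apply: (pieces_sub (@zero_or_free_hereditary w) P1); lra.
apply: loc; [lra|exact: lexx|lra|by right|].
by apply: (pieces_sub (@zero_or_free_hereditary w) P2); lra.
Unshelve. all: by end_near. Qed.

(** Compactness of [[0, T]] in the form of a supremum: [S] collects the [y] for which a uniform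
    count on [[0, y]] exists. The local count around [c = sup S] carries [S] to [min (c + e) T],
    which cannot exceed [c], so it equals [T]. *)
Lemma lspan_pieces l (T : R) : 0 <= T ->
  (forall t0, 0 <= t0 <= T -> List.Forall (fun f => analytic_at f t0) l) ->
  exists N, forall u, lspan l u -> pieces (zero_or_free u) N 0 T.
Proof.
move=> T0 Hl.
pose S := [set y | 0 <= y <= T /\
  exists N, forall u, lspan l u -> pieces (zero_or_free u) N 0 y].
have S0 : S 0.
  split; first by rewrite lexx.
  exists 1%N => u _; apply: pieces_leaf; left => t /andP[t1 t2].
  by have := lt_trans t1 t2; rewrite ltxx.
have supS : has_sup S by split; [exists 0|exists T => y [/andP[]]].
pose c := sup S.
have c0 : 0 <= c by apply: ub_le_sup => //; case: supS.
have cT : c <= T by apply: ge_sup; [exists 0|move=> y [/andP[]]].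
have [|e e0 [N1 NP]] := @lspan_pieces_near l c; first by apply: Hl; rewrite c0.
have [y Sy cy] := sup_adherent e0 supS.
have yc : y <= c by apply: ub_le_sup => //; case: supS.
have [/andP[y0 yT] [N HN]] := Sy.
pose d := Num.min (c + e) T.
have cd : c <= d by rewrite le_min cT; lra.
have dc : d <= c + e by rewrite ge_min lexx.
have Sd : S d.
  split; first by rewrite (le_trans c0 cd)/= ge_min lexx orbT.
  exists (N + (N1 + N1))%N => u su; have [P1 P2] := NP _ su.
  apply: (@pieces_node _ N (N1 + N1) 0 y d) => //; first exact: le_trans cd.
    exact: HN.
  apply: (@pieces_node _ N1 N1 y c d) => //.
    by apply: (pieces_sub (@zero_or_free_hereditary u) P1) => //; apply/ltW; rewrite /c; lra.
  exact: (pieces_sub (@zero_or_free_hereditary u) P2).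
have dlec : d <= c by apply: ub_le_sup => //; case: supS.
have dT : d = T.
  move: dlec; rewrite /d minEle; case: ifP => // _; lra.
by rewrite -dT; case: Sd.
Qed.

End Pieces.

Lemma map_poly_cubic (A B : comNzRingType) (f : {rmorphism A -> B}) (a b c : A) :
  map_poly f ('X^3 + (a%:P * 'X^2 + b%:P * 'X + c%:P)) =
  'X^3 + ((f a)%:P * 'X^2 + (f b)%:P * 'X + (f c)%:P).
Proof.
rewrite rmorphD/= map_polyXn rmorphD/= rmorphD/= map_polyC.
rewrite [map_poly f (_ * 'X^2)]rmorphM/= map_polyXn map_polyC.
by rewrite [map_poly f (_ * 'X)]rmorphM/= map_polyX map_polyC.
Qed.

(** * Functions integral over analytic coefficients *)

Section Algebraic.
Variables (R : realType) (n : nat) (T : R).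
Implicit Types (xi : 'rV[R]_n) (f u v : R -> R) (l : seq (R -> R)).

Local Notation K := ((R * 'rV[R]_n)%type -> R).
Implicit Types (g h b s : K) (p : R * 'rV[R]_n).

(** The end points in [t] are left out because the roots are unspecified beyond them. The bound on
    [xi] keeps it nonzero and makes [ln (1 + euclid_norm xi) >= ln 2], so additive constants can be
    absorbed. *)
Definition dom p := 0 < p.1 < T /\ 1 <= euclid_norm p.2.

Definition analytic_on f := forall t, 0 <= t <= T -> analytic_at f t.

Lemma lspan_cat l l' u v : lspan l u -> lspan l' v ->
  lspan (l ++ l') (fun t => u t + v t).
Proof.
elim: l u => [|f l IH] u /=.
  move=> u0 sv; suff -> : (fun t => u t + v t) = v by [].
  by apply/funext => t; rewrite u0 add0r.
move=> [c [w [sw uE]]] sv; exists c, (fun t => w t + v t); split; first exact: IH.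
by move=> t; rewrite uE addrA.
Qed.

Lemma lspan_map_mul f l v : lspan l v ->
  lspan (map (fun (h : R -> R) t => f t * h t) l) (fun t => f t * v t).
Proof.
elim: l v => [|h l IH] v /=; first by move=> v0 t; rewrite v0 mulr0.
move=> [c [w [sw vE]]]; exists c, (fun t => f t * w t); split; first exact: IH.
by move=> t; rewrite vE mulrDr mulrCA.
Qed.

Lemma lspan_cst l v (c : R) : lspan l v -> lspan l (fun t => c * v t).
Proof.
elim: l v => [|h l IH] v /=; first by move=> v0 t; rewrite v0 mulr0.
move=> [d [w [sw vE]]]; exists (c * d), (fun t => c * w t); split; first exact: IH.
by move=> t; rewrite vE mulrDr mulrA.
Qed.

Fixpoint lspan_prod l l' : seq (R -> R) :=
  if l is f :: l1 then map (fun (h : R -> R) t => f t * h t) l' ++ lspan_prod l1 l' else [::].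

Lemma lspan_mul l l' u v : lspan l u -> lspan l' v ->
  lspan (lspan_prod l l') (fun t => u t * v t).
Proof.
elim: l u => [|f l IH] u /=; first by move=> u0 _ t; rewrite u0 mul0r.
move=> [c [w [sw uE]]] sv.
have -> : (fun t => u t * v t) = fun t => c * (f t * v t) + w t * v t.
  by apply/funext => t; rewrite uE mulrDl mulrA.
apply: lspan_cat; last exact: IH.
by apply: lspan_cst; exact: lspan_map_mul.
Qed.

Lemma lspan_prod_analytic l l' : List.Forall analytic_on l ->
  List.Forall analytic_on l' -> List.Forall analytic_on (lspan_prod l l').
Proof.
elim: l => [|f l IH] Hl Hl' /=; first by constructor.
apply/List.Forall_app; split; last exact: IH (List.Forall_inv_tail Hl) Hl'.
have Hf := List.Forall_inv Hl; elim: l' Hl' {IH} => [|h l' IH] Hl'; first by constructor.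
constructor; last exact: IH (List.Forall_inv_tail Hl').
by move=> t t0T; apply: analytic_mul; [exact: Hf|exact: (List.Forall_inv Hl')].
Qed.

Lemma lspan_continuous l u t : List.Forall analytic_on l -> 0 <= t <= T ->
  lspan l u -> {for t, continuous u}.
Proof.
move=> Hl t0T; elim: l u Hl => [|f l IH] u Hl /=.
  move=> u0; have -> : u = cst 0 by apply/funext.
  exact: cst_continuous.
move=> [c [v [sv uE]]].
have -> : u = (fun t => c * f t + v t) by apply/funext.
apply: (@continuousD _ R^o _ (fun t => c * f t)); last exact: IH (List.Forall_inv_tail Hl) sv.
apply: (@continuousM _ _ (cst c) f); first exact: cst_continuous.
by apply: derivable_continuous; apply: analytic_derivable; exact: (List.Forall_inv Hl).
Qed.

(* Sums of products (analytic in t) * (function of xi); all that matters is that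
   the analytic factors do not depend on xi. *)
Definition tensor g := exists l, List.Forall analytic_on l /\
  forall xi, 1 <= euclid_norm xi -> exists u, lspan l u /\
    forall t, 0 < t < T -> g (t, xi) = u t.

Lemma tensor_prod f (m : 'rV[R]_n -> R) : analytic_on f ->
  tensor (fun p => f p.1 * m p.2).
Proof.
move=> Hf; exists [:: f]; split; first by repeat constructor.
move=> xi _; exists (fun t => m xi * f t + 0); split; last by move=> t _; rewrite addr0 mulrC.
by exists (m xi), (cst 0).
Qed.

Lemma tensor_cst (c : R) : tensor (cst c).
Proof.
have := @tensor_prod (cst c) (cst 1) (fun t _ => @analytic_cst _ _ _).
by congr tensor; apply/funext => p /=; rewrite mulr1.
Qed.

Lemma tensorD g h : tensor g -> tensor h -> tensor (fun p => g p + h p).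
Proof.
move=> [l [Hl gl]] [l' [Hl' hl]]; exists (l ++ l'); split.
  by apply/List.Forall_app; split.
move=> xi x1; have [u [su gu]] := gl _ x1; have [v [sv hv]] := hl _ x1.
exists (fun t => u t + v t); split; first exact: lspan_cat.
by move=> t tT; rewrite gu// hv.
Qed.

Lemma tensorM g h : tensor g -> tensor h -> tensor (fun p => g p * h p).
Proof.
move=> [l [Hl gl]] [l' [Hl' hl]]; exists (lspan_prod l l'); split.
  exact: lspan_prod_analytic.
move=> xi x1; have [u [su gu]] := gl _ x1; have [v [sv hv]] := hl _ x1.
exists (fun t => u t * v t); split; first exact: lspan_mul.
by move=> t tT; rewrite gu// hv.
Qed.

Definition tcontinuous g := forall t xi, 0 < t < T -> 1 <= euclid_norm xi ->
  {for t, continuous (fun r => g (r, xi))}.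

Lemma near_itv (t : R) : 0 < t < T -> \forall r \near t, 0 < r < T.
Proof.
move=> tT; have : nbhs t [set` `]0, T[] by apply: near_in_itvoo; rewrite in_itv.
by apply: filterS => r; rewrite /= in_itv.
Qed.

Lemma tcontinuous_ext g h : (forall p, dom p -> g p = h p) ->
  tcontinuous g -> tcontinuous h.
Proof.
move=> gh gc t xi tT x1; apply: continuous_near_eq (gc t xi tT x1).
by apply: filterS (near_itv tT) => r rT; rewrite gh.
Qed.

Lemma tcontinuousD g h : tcontinuous g -> tcontinuous h -> tcontinuous (fun p => g p + h p).
Proof. by move=> gc hc t xi tT x1; apply: (@continuousD _ R^o); [exact: gc|exact: hc]. Qed.

Lemma tcontinuousM g h : tcontinuous g -> tcontinuous h -> tcontinuous (fun p => g p * h p).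
Proof. by move=> gc hc t xi tT x1; apply: continuousM; [exact: gc|exact: hc]. Qed.

Lemma tcontinuous_cst (c : R) : tcontinuous (cst c).
Proof. by move=> t xi _ _; exact: cst_continuous. Qed.

Lemma tcontinuousV g : (forall p, dom p -> g p != 0) -> tcontinuous g ->
  tcontinuous (fun p => (g p)^-1).
Proof. by move=> g0 gc t xi tT x1; apply: continuousV; [exact: g0|exact: gc]. Qed.

Lemma tcontinuous_exp g k : tcontinuous g -> tcontinuous (fun p => g p ^+ k).
Proof.
move=> gc; elim: k => [|k IH].
  by apply: (tcontinuous_ext (g := cst 1)) => [p _|]; [rewrite expr0|exact: tcontinuous_cst].
apply: (tcontinuous_ext (g := fun p => g p * g p ^+ k)) => [p _|].
  by rewrite exprS.
exact: tcontinuousM.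
Qed.

Lemma tcontinuous_sum (F : nat -> K) k : (forall i, (i < k)%N -> tcontinuous (F i)) ->
  tcontinuous (fun p => \sum_(i < k) F i p).
Proof.
elim: k => [|k IH] H.
  by apply: (tcontinuous_ext (g := cst 0)) => [p _|]; [rewrite big_ord0|exact: tcontinuous_cst].
apply: (tcontinuous_ext (g := fun p => \sum_(i < k) F i p + F k p)) => [p _|].
  by rewrite big_ord_recr.
by apply: tcontinuousD; [apply: IH => i ik; apply: H; exact: ltnW|exact: H].
Qed.

Lemma tensor_continuous g : tensor g -> tcontinuous g.
Proof.
move=> [l [Hl gl]] t xi tT x1; have [u [su gu]] := gl _ x1.
have t0T : 0 <= t <= T by case/andP: tT => *; rewrite !ltW.
apply: continuous_near_eq (lspan_continuous Hl t0T su).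
by apply: filterS (near_itv tT) => r rT; rewrite gu.
Qed.

Definition tfrac g := exists b s, [/\ tensor b, tensor s &
  forall p, dom p -> s p != 0 /\ g p = b p / s p].

Lemma tfrac_ext g h : (forall p, dom p -> g p = h p) -> tfrac g -> tfrac h.
Proof.
move=> gh [b [s [tb ts gE]]]; exists b, s; split=> // p dp.
by have [s0 <-] := gE p dp; rewrite gh.
Qed.

Lemma tensor_frac g : tensor g -> tfrac g.
Proof.
move=> tg; exists g, (cst 1); split=> //; first exact: tensor_cst.
by move=> p _; rewrite oner_neq0 divr1.
Qed.

Lemma tfrac_cst (c : R) : tfrac (cst c).
Proof. by apply: tensor_frac; exact: tensor_cst. Qed.

Lemma tfracD g h : tfrac g -> tfrac h -> tfrac (fun p => g p + h p).
Proof.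
move=> [b [s [tb ts gE]]] [b' [s' [tb' ts' hE]]].
exists (fun p => b p * s' p + b' p * s p), (fun p => s p * s' p); split.
- by apply: tensorD; apply: tensorM.
- exact: tensorM.
- move=> p dp; have [s0 ->] := gE p dp; have [s'0 ->] := hE p dp.
  by split; [exact: mulf_neq0|field; rewrite ?s0 ?s'0].
Qed.

Lemma tfracM g h : tfrac g -> tfrac h -> tfrac (fun p => g p * h p).
Proof.
move=> [b [s [tb ts gE]]] [b' [s' [tb' ts' hE]]].
exists (fun p => b p * b' p), (fun p => s p * s' p); split; try exact: tensorM.
move=> p dp; have [s0 ->] := gE p dp; have [s'0 ->] := hE p dp.
by split; [exact: mulf_neq0|field; rewrite ?s0 ?s'0].
Qed.

Lemma tfracV g : (forall p, dom p -> g p != 0) -> tfrac g -> tfrac (fun p => (g p)^-1).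
Proof.
move=> g0 [b [s [tb ts gE]]]; exists s, b; split=> // p dp.
have := g0 p dp; have [s0 ->] := gE p dp.
by rewrite mulf_eq0 negb_or => /andP[b0 _]; split=> //; rewrite invf_div.
Qed.

Lemma tfrac_continuous g : tfrac g -> tcontinuous g.
Proof.
move=> [b [s [tb ts gE]]].
apply: (tcontinuous_ext (g := fun p => b p * (s p)^-1)) => [p /gE[] //|].
apply: tcontinuousM; first exact: tensor_continuous.
by apply: tcontinuousV; [move=> p /gE[]|exact: tensor_continuous].
Qed.

Definition tzof g xi := zero_or_free (fun t => g (t, xi)).

Lemma tfrac_pieces g : 0 <= T -> tfrac g ->
  exists N, forall xi, 1 <= euclid_norm xi -> pieces (tzof g xi) N 0 T.
Proof.
move=> T0 [b [s [[l [Hl bl]] ts gE]]].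
have [|N NP] := @lspan_pieces R l T T0.
  by move=> t tT; apply: List.Forall_impl Hl => f; exact.
exists N => xi x1; have [u [su bu]] := bl _ x1.
apply: (pieces_impl (NP _ su)) => // x y x0 xy yT.
have E t : x < t < y -> (g (t, xi) == 0) = (u t == 0).
  move=> /andP[xt ty].
  have tT : 0 < t < T by rewrite (le_lt_trans x0)//= (lt_le_trans ty).
  have [|s0 ->] := gE (t, xi); first by split.
  by rewrite mulf_eq0 invr_eq0 (negbTE s0) orbF bu.
by move=> [H|H]; [left|right] => t txy; [apply/eqP|]; rewrite E// H.
Qed.

(** The quotients are packaged as a subring of the ring of all functions, so that [integralOver]
    applies and sums and products of integral elements are integral. *)
Definition tfrac_pred : {pred K} := fun g => `[< tfrac g >].

Lemma tfrac_subring : subring_closed tfrac_pred.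
Proof.
split=> [|g h /asboolP fg /asboolP fh|g h /asboolP fg /asboolP fh]; apply/asboolP.
- by apply: tfrac_ext (tfrac_cst 1).
- apply: (tfrac_ext (g := fun p => g p + cst (-1) p * h p)).
    by move=> p _; rewrite mulN1r.
  by apply: tfracD => //; apply: tfracM => //; exact: tfrac_cst.
- exact: (tfracM fg fh).
Qed.

HB.instance Definition _ := GRing.isSubringClosed.Build K tfrac_pred tfrac_subring.

Definition tfrac_ring := {g : K | g \in tfrac_pred}.
HB.instance Definition _ := SubChoice.on tfrac_ring.
HB.instance Definition _ := [SubChoice_isSubComNzRing of tfrac_ring by <:].

Definition tfrac_val : {rmorphism tfrac_ring -> K} := val.

(** Integrality is an identity in the ring of all functions, whereas the equations for the roots
    hold only on [dom]; hence the freedom to change [g] outside [dom]. *)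
Definition alg g := exists2 g0, forall p, dom p -> g p = g0 p &
  integralOver tfrac_val g0.

Lemma alg_ext g h : (forall p, dom p -> g p = h p) -> alg g -> alg h.
Proof. by move=> gh [g0 gg0 ig]; exists g0 => // p dp; rewrite -gh// gg0. Qed.

Lemma algD g h : alg g -> alg h -> alg (fun p => g p + h p).
Proof.
move=> [g0 gE ig] [h0 hE ih]; exists (g0 + h0); last exact: integral_add.
by move=> p dp; rewrite gE// hE.
Qed.

Lemma algM g h : alg g -> alg h -> alg (fun p => g p * h p).
Proof.
move=> [g0 gE ig] [h0 hE ih]; exists (g0 * h0); last exact: integral_mul.
by move=> p dp; rewrite gE// hE.
Qed.

Lemma tfrac_alg g : tfrac g -> alg g.
Proof.
move=> fg; have gP : g \in tfrac_pred by apply/asboolP.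
exists g => //; exact: (integral_id tfrac_val (Sub g gP : tfrac_ring)).
Qed.

Lemma alg_cubic g c2 c1 c0 : tfrac c2 -> tfrac c1 -> tfrac c0 ->
  (forall p, dom p -> g p ^+ 3 + c2 p * g p ^+ 2 + c1 p * g p + c0 p = 0) -> alg g.
Proof.
move=> f2 f1 f0 E.
(* Values outside [dom] are unconstrained: setting them to 0 makes the equation
   hold in the whole ring K. *)
pose cut (c : K) : K := fun p => if `[< dom p >] then c p else 0.
have cutE c p : dom p -> cut c p = c p by rewrite /cut; case: asboolP.
have fcut c : tfrac c -> cut c \in tfrac_pred.
  by move=> fc; apply/asboolP; apply: tfrac_ext fc => p dp; rewrite cutE.
exists (cut g) => [p dp|]; first by rewrite cutE.
pose C c (fc : tfrac c) : tfrac_ring := Sub (cut c) (fcut c fc).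
exists ('X^3 + ((C _ f2)%:P * 'X^2 + (C _ f1)%:P * 'X + (C _ f0)%:P)).
  rewrite monicE lead_coefDl ?lead_coefXn// size_polyXn.
  apply: (leq_ltn_trans (size_polyD _ _)); rewrite gtn_max; apply/andP; split.
    apply: (leq_ltn_trans (size_polyD _ _)); rewrite gtn_max; apply/andP; split.
      apply: (leq_ltn_trans (size_polyMleq _ _)); rewrite size_polyXn.
      by case: (size _) (size_polyC_leq1 (C _ f2)) => [|[|]].
    apply: (leq_ltn_trans (size_polyMleq _ _)); rewrite size_polyX.
    by case: (size _) (size_polyC_leq1 (C _ f1)) => [|[|]].
  by rewrite (leq_ltn_trans (size_polyC_leq1 _)).
rewrite (map_poly_cubic tfrac_val).
rewrite /root !(hornerD, hornerM, hornerXn, hornerX, hornerC); apply/eqP/funext => p.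
change (cut g p ^+ 3 + (cut c2 p * cut g p ^+ 2 + cut c1 p * cut g p + cut c0 p) = 0).
have := E p; rewrite /cut; case: asboolP => [dp /(_ dp) <-|_ _].
  by rewrite !addrA.
by rewrite !expr0n/= !mul0r !addr0.
Qed.

(** The zero sets of [g] and [q] are complementary, so [h = |g| - |q|] is negative where [g]
    vanishes, positive elsewhere, and never zero. By the intermediate value theorem it cannot take
    both signs. *)
Lemma zero_or_free_connected (g q : R -> R) (x y : R) :
  (forall t, x < t < y -> {for t, continuous g} /\ {for t, continuous q}) ->
  (forall t, x < t < y -> g t = 0 -> q t != 0) ->
  (forall t, x < t < y -> g t != 0 -> q t = 0) -> zero_or_free g x y.
Proof.
move=> ct gq qg.
have [[s sxy gs]|nz] := pselect (exists2 s, x < s < y & g s = 0); last first.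
  by right => t txy; apply/eqP => gt0; apply: nz; exists t.
left => t txy; apply/eqP; apply/negPn/negP => gt0.
pose h r := `|g r| - `|q r|.
have hn0 r : x < r < y -> h r != 0.
  move=> rxy; rewrite /h; have [g0|g0] := eqVneq (g r) 0.
    by rewrite g0 normr0 sub0r oppr_eq0 normr_eq0 gq.
  by rewrite (qg r)// normr0 subr0 normr_eq0.
have hs : h s < 0 by rewrite /h gs normr0 sub0r oppr_lt0 normr_gt0 gq.
have ht : 0 < h t by rewrite /h (qg t)// normr0 subr0 normr_gt0.
have hc r : x < r < y -> {for r, continuous h}.
  move=> rxy; have [cg cq] := ct r rxy.
  apply: (@continuousB _ R^o); apply: continuous_comp => //; exact: norm_continuous.
have key (a b : R) : x < a < y -> x < b < y -> a <= b -> Num.min (h a) (h b) <= 0 <= Num.max (h a) (h b) -> False.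
  move=> /andP[xa ay] /andP[xb yb] ab H.
  have [|c] := @IVT R h a b 0 ab _ H.
    apply: continuous_in_subspaceT => r; rewrite inE/= in_itv/= => /andP[ar rb].
    by apply: hc; rewrite (lt_le_trans xa)//= (le_lt_trans rb).
  rewrite in_itv/= => /andP[ac cb] hc0.
  have := hn0 c; rewrite hc0 eqxx (lt_le_trans xa)//= (le_lt_trans cb)// => /(_ isT).
  by [].
have [st|ts] := leP s t.
  by apply: (key s t) => //; rewrite minEle maxEle (ltW (lt_trans hs ht)) !ltW.
apply: (key t s) => //; first exact: ltW.
have /negbTE hts : ~~ (h t <= h s) by rewrite -ltNge (lt_trans hs ht).
by rewrite minEle maxEle hts (ltW hs) (ltW ht).
Qed.

Lemma alg_pieces g : 0 <= T -> alg g -> tcontinuous g ->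
  exists N, forall xi, 1 <= euclid_norm xi -> pieces (tzof g xi) N 0 T.
Proof.
move=> T0 [g0 gg0 [P Pm Pg]] gc.
pose c i : K := val P`_i.
have fc i : tfrac (c i) by apply/asboolP; exact: (valP P`_i).
have E p : dom p -> \sum_(i < size P) c i p * g p ^+ i = 0.
  move=> dp; move: Pg; rewrite /root horner_coef size_map_poly_id0; last first.
    by rewrite (monicP Pm) rmorph1 oner_neq0.
  move=> /eqP H.
  transitivity ((\sum_(i < size P) (map_poly tfrac_val P)`_i * g0 ^+ i) p); last by rewrite H.
  rewrite fct_sumE; apply: eq_bigr => i _; rewrite coef_map gg0//.
  change (c i p * g0 p ^+ i = c i p * (g0 ^+ i) p); by rewrite exprfctE.
have [d sP] : exists d, size P = d.+1.
  by exists (size P).-1; rewrite prednK// size_poly_gt0 monic_neq0.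
have cd p : c d p = 1.
  have := monicP Pm; rewrite lead_coefE sP/= /c => ->; by [].
have [N NP] : exists N, forall xi, 1 <= euclid_norm xi ->
    pieces (fun x y => forall i, (i < size P)%N -> tzof (c i) xi x y) N 0 T.
  elim: (size P) => [|k [N1 H1]].
    by exists 1%N => xi _; apply: pieces_leaf.
  have [N2 H2] := tfrac_pieces T0 (fc k).
  exists (N1 * N2)%N => xi x1.
  have H12 := pieces_and _ (@zero_or_free_hereditary _ _) T0 (H1 _ x1) (H2 _ x1).
  apply: (pieces_impl (H12 _)) => //.
    move=> x y x' y' xx' xy' yy' H i ik.
    exact: (zero_or_free_hereditary xx' xy' yy' (H i ik)).
  move=> x y _ _ _ [A B] i; rewrite ltnS leq_eqVlt => /predU1P[->//|]; exact: A.
exists N => xi x1; apply: (pieces_impl (NP _ x1)) => // x y x0 xy yT H.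
have inT t : x < t < y -> 0 < t < T.
  by move=> /andP[xt ty]; rewrite (le_lt_trans x0)//= (lt_le_trans ty).
pose free k := `[< (k < size P)%N /\ forall t, x < t < y -> c k (t, xi) != 0 >].
have exf : exists k, free k.
  by exists d; apply/asboolP; rewrite sP; split=> // t _; rewrite cd oner_neq0.
case: (ex_minnP exf) => k /asboolP[kP ck] kmin.
have cz i t : (i < k)%N -> x < t < y -> c i (t, xi) = 0.
  move=> ik txy; have [H0|H0] := H i (ltn_trans ik kP); first exact: H0.
  have fi : free i by apply/asboolP; split=> //; exact: ltn_trans kP.
  by have := kmin i fi; rewrite leqNgt ik.
(* The coefficients below [k] vanish on this interval, so the equation reads [g ^ k * q = 0]. Where
   [g] is nonzero, [q] vanishes; where [g] is zero, [q] equals the coefficient [c k], which has no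
   zero here. *)
pose q p := \sum_(j < size P - k) c (k + j)%N p * g p ^+ j.
have gq t : x < t < y -> g (t, xi) ^+ k * q (t, xi) = 0.
  move=> txy; rewrite -(E (t, xi)); last by split=> //=; exact: inT.
  rewrite -[in RHS](big_mkord xpredT (fun i => c i (t, xi) * g (t, xi) ^+ i)).
  have kP' := ltnW kP; rewrite (big_cat_nat (n := k))//=.
  rewrite big_nat_cond big1 ?add0r; last first.
    by move=> i /andP[/andP[_ ik] _]; rewrite cz// mul0r.
  rewrite -[in RHS](add0n k) big_addn big_mkord mulr_sumr; apply: eq_bigr => i _.
  by rewrite addnC exprD; ring.
have sk : (size P - k)%N = (size P - k).-1.+1 by rewrite prednK// subn_gt0.
have qg0 t : x < t < y -> g (t, xi) = 0 -> q (t, xi) = c k (t, xi).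
  move=> txy gt0; rewrite /q sk big_ord_recl/= addn0 expr0 mulr1 big1 ?addr0// => i _.
  by rewrite gt0 expr0n/= mulr0.
apply: (@zero_or_free_connected _ (fun t => q (t, xi))).
- move=> t txy; split; first by apply: gc => //; exact: inT.
  have : tcontinuous q.
    apply: (@tcontinuous_sum (fun j p => c (k + j)%N p * g p ^+ j)) => i _.
    apply: tcontinuousM; first exact: tfrac_continuous.
    exact: tcontinuous_exp.
  by apply=> //; exact: inT.
- by move=> t txy gt0; rewrite qg0// ck.
- move=> t txy gt0; have /eqP := gq t txy; rewrite mulf_eq0 expf_eq0 (negbTE gt0) andbF/=.
  by move=> /eqP.
Qed.

End Algebraic.

(** * Classes closed under differentiation in t *)

Section SmoothClass.
Variables (R : realType) (n : nat) (T : R).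
Hypothesis T_gt0 : 0 < T.

Local Notation K := ((R * 'rV[R]_n)%type -> R).
Implicit Types (g h : K) (p : R * 'rV[R]_n) (f : R -> R).
Local Notation dom := (@dom R n T).

Definition polygrowth g := exists C k, forall p, dom p ->
  `|g p| <= C * (1 + euclid_norm p.2) ^+ k.

Lemma polygrowth_le g h : (forall p, dom p -> `|g p| <= `|h p|) ->
  polygrowth h -> polygrowth g.
Proof. by move=> gh [C [k H]]; exists C, k => p dp; rewrite (le_trans (gh p dp))// H. Qed.

Lemma polygrowth_ext g h : (forall p, dom p -> g p = h p) -> polygrowth g -> polygrowth h.
Proof. by move=> gh; apply: polygrowth_le => p dp; rewrite gh. Qed.

Lemma polygrowth_cst (c : R) : polygrowth (cst c).
Proof. by exists `|c|, 0%N => p _; rewrite expr0 mulr1. Qed.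

Lemma weight_ge1 p : dom p -> 1 <= 1 + euclid_norm p.2.
Proof. by move=> [_ x1]; rewrite lerDl (le_trans _ x1). Qed.

Lemma polygrowth_nneg g : polygrowth g -> exists2 C, 0 <= C & exists k, forall p, dom p ->
  `|g p| <= C * (1 + euclid_norm p.2) ^+ k.
Proof.
move=> [C [k H]]; exists `|C|; first exact: normr_ge0.
exists k => p dp; rewrite (le_trans (H p dp))// ler_wpM2r ?ler_norm//.
by rewrite exprn_ge0// (le_trans _ (weight_ge1 dp)).
Qed.

Lemma polygrowthD g h : polygrowth g -> polygrowth h -> polygrowth (fun p => g p + h p).
Proof.
move=> /polygrowth_nneg[C C0 [k H]] /polygrowth_nneg[D D0 [m H']].
exists (C + D), (k + m)%N => p dp; have w1 := weight_ge1 dp.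
rewrite (le_trans (ler_normD _ _))// mulrDl lerD//.
  by rewrite (le_trans (H p dp))// ler_wpM2l// ler_weXn2l// leq_addr.
by rewrite (le_trans (H' p dp))// ler_wpM2l// ler_weXn2l// leq_addl.
Qed.

Lemma polygrowthM g h : polygrowth g -> polygrowth h -> polygrowth (fun p => g p * h p).
Proof.
move=> [C [k H]] [D [m H']]; exists (C * D), (k + m)%N => p dp.
by rewrite normrM exprD mulrACA ler_pM// ?H ?H'.
Qed.

Definition dt g p := derive1 (fun t => g (t, p.2)) p.1.

Definition basic g := [/\ alg T g, polygrowth g & tcontinuous T g].

(** Each derivative up to order [k] must itself lie in [basic], since zeros are counted for
    derivatives too. The order is finite so that the regularity of roots can be obtained one
    derivative at a time. *)
Fixpoint smooth k g := basic g /\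
  if k is k'.+1 then
    (forall p, dom p -> derivable (fun t => g (t, p.2)) p.1 1) /\ smooth k' (dt g)
  else True.

Lemma basic_ext g h : (forall p, dom p -> g p = h p) -> basic g -> basic h.
Proof.
move=> gh [a b c]; split; [exact: alg_ext a|exact: polygrowth_ext b|].
exact: tcontinuous_ext c.
Qed.

Lemma dom_near p g h : (forall q, dom q -> g q = h q) -> dom p ->
  \forall t \near p.1, g (t, p.2) = h (t, p.2).
Proof.
by move=> gh [tT x1]; apply: filterS (near_itv tT) => t t0T; apply: gh; split.
Qed.

Lemma dt_ext g h : (forall p, dom p -> g p = h p) -> forall p, dom p -> dt g p = dt h p.
Proof.
by move=> gh p dp; rewrite /dt !derive1E; apply: near_eq_derive; exact: dom_near.
Qed.

Lemma smooth_ext k g h : (forall p, dom p -> g p = h p) -> smooth k g -> smooth k h.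
Proof.
elim: k g h => [|k IH] g h gh [bg sg]; split=> //; first exact: basic_ext bg.
  exact: basic_ext bg.
case: sg => dg sg; split; last exact: IH (dt_ext gh) sg.
by move=> p dp; apply: near_eq_derivable (dg p dp); exact: dom_near.
Qed.

Lemma smoothS k g g' : basic g -> smooth k g' ->
  (forall p, dom p -> is_derive p.1 (1 : R) (fun t => g (t, p.2)) (g' p)) -> smooth k.+1 g.
Proof.
move=> bg sg' D; split=> //; split=> [p dp|]; first by have := D p dp.
apply: smooth_ext sg' => p dp; rewrite /dt; apply/esym.
exact: is_derive_derive1 (D p dp).
Qed.

Lemma smooth_is_derive k g p : smooth k.+1 g -> dom p ->
  is_derive p.1 (1 : R) (fun t => g (t, p.2)) (dt g p).
Proof. by move=> [_ [H _]] dp; apply: derivable_is_derive1; exact: H. Qed.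

Lemma smooth_basic k g : smooth k g -> basic g.
Proof. by case: k => [|k] []. Qed.

Lemma smooth_pred k g : smooth k.+1 g -> smooth k g.
Proof.
elim: k g => [|k IH] g; first by move=> [].
by move=> [bg [dg sg]]; split=> //; split=> //; exact: IH.
Qed.

Lemma basicD g h : basic g -> basic h -> basic (fun p => g p + h p).
Proof.
move=> [a b c] [a' b' c']; split; [exact: algD|exact: polygrowthD|exact: tcontinuousD].
Qed.

Lemma basicM g h : basic g -> basic h -> basic (fun p => g p * h p).
Proof.
move=> [a b c] [a' b' c']; split; [exact: algM|exact: polygrowthM|exact: tcontinuousM].
Qed.

Lemma smoothD k g h : smooth k g -> smooth k h -> smooth k (fun p => g p + h p).
Proof.
elim: k g h => [|k IH] g h sg sh.
  by split=> //; apply: basicD; apply: smooth_basic; [exact: sg|exact: sh].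
apply: (@smoothS k _ (fun p => dt g p + dt h p)).
- exact: basicD (smooth_basic sg) (smooth_basic sh).
- by apply: IH; [case: sg => _ []|case: sh => _ []].
- move=> p dp; exact: is_deriveD (smooth_is_derive sg dp) (smooth_is_derive sh dp).
Qed.

Lemma smoothM k g h : smooth k g -> smooth k h -> smooth k (fun p => g p * h p).
Proof.
elim: k g h => [|k IH] g h sg sh.
  by split=> //; apply: basicM; apply: smooth_basic; [exact: sg|exact: sh].
apply: (@smoothS k _ (fun p => g p * dt h p + h p * dt g p)).
- exact: basicM (smooth_basic sg) (smooth_basic sh).
- have [_ [_ sg']] := sg; have [_ [_ sh']] := sh.
  by apply: smoothD; apply: IH => //; exact: smooth_pred.
- move=> p dp; have := is_deriveM (smooth_is_derive sg dp) (smooth_is_derive sh dp).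
  by rewrite /= -surjective_pairing.
Qed.

Lemma basic_cst (c : R) : basic (cst c).
Proof.
split; [by apply: tfrac_alg; exact: tfrac_cst|exact: polygrowth_cst|exact: tcontinuous_cst].
Qed.

Lemma smooth_cst k (c : R) : smooth k (cst c).
Proof.
elim: k c => [|k IH] c; first by split=> //; exact: basic_cst.
apply: (@smoothS k _ (cst 0)); [exact: basic_cst|exact: IH|].
by move=> p _; exact: is_derive_cst.
Qed.

Lemma smooth_sum k (I : Type) (s : seq I) (P : pred I) (F : I -> K) :
  (forall i, P i -> smooth k (F i)) -> smooth k (fun p => \sum_(i <- s | P i) F i p).
Proof.
move=> H; elim: s => [|i s IH].
  by apply: (smooth_ext (g := cst 0)) (smooth_cst _ _) => p _; rewrite big_nil.
have [Pi|Pi] := boolP (P i); last first.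
  by apply: smooth_ext IH => p _; rewrite big_cons (negbTE Pi).
apply: (smooth_ext (g := fun p => F i p + \sum_(i <- s | P i) F i p)) => [p _|].
  by rewrite big_cons Pi.
by apply: smoothD => //; exact: H.
Qed.

Lemma smoothX k g m : smooth k g -> smooth k (fun p => g p ^+ m).
Proof.
move=> sg; elim: m => [|m IH].
  by apply: (smooth_ext (g := cst 1)) (smooth_cst _ _) => p _; rewrite expr0.
apply: (smooth_ext (g := fun p => g p * g p ^+ m)) => [p _|]; first by rewrite exprS.
exact: smoothM.
Qed.

(** The inverse of an integral element need not be integral, so [g] is taken among the quotients.
    Growth of the inverse is a lower bound on [g], which has to be supplied separately. *)
Lemma smoothV g : tfrac T g -> (forall p, dom p -> g p != 0) ->
  polygrowth (fun p => (g p)^-1) -> (forall k, smooth k g) ->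
  forall k, smooth k (fun p => (g p)^-1).
Proof.
move=> fg g0 pg sg.
have B : basic (fun p => (g p)^-1).
  split=> //; first by apply: tfrac_alg; exact: tfracV.
  by apply: tcontinuousV => //; have [] := smooth_basic (sg 0%N).
elim=> [|k IH]; first by split.
apply: (@smoothS k _ (fun p => cst (-1) p * ((g p)^-1 * (g p)^-1 * dt g p))) => //.
  apply: smoothM; first exact: smooth_cst.
  by apply: smoothM; [exact: smoothM|case: (sg k.+1) => _ []].
move=> p dp; have g0p : g (p.1, p.2) != 0 by rewrite -surjective_pairing; exact: g0.
have := is_deriveV g0p (smooth_is_derive (sg 1%N) dp).
by rewrite /= -surjective_pairing -exprVn expr2 /GRing.scale/= mulN1r mulNr.
Qed.

Lemma analytic_bounded f : analytic_on T f ->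
  exists C, forall t, 0 <= t <= T -> `|f t| <= C.
Proof.
move=> Hf; have [|c] := @EVT_max R (fun t => `|f t|) 0 T (ltW T_gt0).
  apply: continuous_in_subspaceT => t; rewrite inE/= in_itv/= => tT.
  apply: continuous_comp; last exact: norm_continuous.
  by apply: derivable_continuous; apply: analytic_derivable; exact: Hf.
by move=> _ H; exists `|f c| => t tT; apply: H; rewrite in_itv.
Qed.

Lemma smooth_analytic_mul f (m : 'rV[R]_n -> R) : analytic_on T f ->
  polygrowth (fun p => m p.2) -> forall k, smooth k (fun p => f p.1 * m p.2).
Proof.
move=> Hf pm.
have B f' : analytic_on T f' -> basic (fun p => f' p.1 * m p.2).
  move=> Hf'; have tf := tensor_prod m Hf'; split.
  - by apply: tfrac_alg; exact: tensor_frac.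
  - apply: polygrowthM => //; have [C HC] := analytic_bounded Hf'.
    exists C, 0%N => p [/andP[t0 tT] _]; rewrite expr0 mulr1 HC// !ltW//.
  - exact: tensor_continuous.
move=> k; elim: k f Hf => [|k IH] f Hf; first by split; [exact: B|].
apply: (@smoothS k _ (fun p => derive1 f p.1 * m p.2)); first exact: B.
  by apply: IH => t tT; apply: analytic_derive1; exact: Hf.
move=> p [/andP[t0 tT] _].
have Df : is_derive p.1 (1 : R) f (derive1 f p.1).
  by apply: derivable_is_derive1; apply: analytic_derivable; apply: Hf; rewrite !ltW.
apply: (is_derive_eq (is_deriveM Df (is_derive_cst (m p.2) p.1 1))).
by rewrite scaler0 add0r /GRing.scale/= mulrC.
Qed.

End SmoothClass.

(** * Regularity of simple real roots *)

Section RootsOneVariable.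
Variable R : realType.
Implicit Types (t x : R).

Lemma root_derive (F r Q : R -> R) t0 (a : R) :
  (\forall t \near t0, F t = (r t0 - r t) * Q t) ->
  {for t0, continuous Q} -> Q t0 != 0 -> is_derive t0 (1 : R) F a ->
  is_derive t0 (1 : R) r (- a / Q t0).
Proof.
move=> FE Qc Q0 DF.
have sh : (h *: (1 : R) + t0) @[h --> (0 : R)^'] --> t0.
  apply: cvg_within_filter.
  have : (h *: (1 : R) + t0) @[h --> (0 : R)] --> (0 : R) *: (1 : R) + t0.
    by apply: cvgD; [apply: cvgZr_tmp; exact: cvg_id|exact: cvg_cst].
  by rewrite scale0r add0r.
have Fl : h^-1 *: ((F \o shift t0) (h *: (1 : R)) - F t0) @[h --> (0 : R)^'] --> a.
  by have [+ <-] := DF; exact.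
have Ql : Q (h *: (1 : R) + t0) @[h --> (0 : R)^'] --> Q t0 by apply: cvg_comp sh Qc.
have Qn : \forall t \near t0, Q t != 0.
  have : \forall y \near Q t0, y != 0.
    by apply: open_nbhs_nbhs; split; [exact: open_neq|].
  by move=> /Qc.
have F0 : F t0 = 0 by rewrite (nbhs_singleton FE) subrr mul0r.
have H : h^-1 *: ((r \o shift t0) (h *: (1 : R)) - r t0) @[h --> (0 : R)^'] --> - a / Q t0.
  have : - (h^-1 *: ((F \o shift t0) (h *: (1 : R)) - F t0)) / Q (h *: (1 : R) + t0)
      @[h --> (0 : R)^'] --> - a / Q t0.
    by apply: cvgM; [exact: cvgN|exact: cvgV].
  apply: cvg_trans; apply: near_eq_cvg.
  have FQ : \forall t \near t0, F t = (r t0 - r t) * Q t /\ Q t != 0.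
    by apply: filterS2 FE Qn.
  have FQh : \forall h \near (0 : R)^', F (h *: (1 : R) + t0) =
      (r t0 - r (h *: (1 : R) + t0)) * Q (h *: (1 : R) + t0) /\ Q (h *: (1 : R) + t0) != 0.
    exact: (sh _ FQ).
  apply: filterS FQh => h [/= E Qh]; rewrite F0 subr0 E /GRing.scale/= mulrA -mulNr mulfK//.
  by rewrite -mulrN opprB.
split; first by apply/cvg_ex; exists (- a / Q t0).
exact: cvg_lim H.
Qed.

Lemma continuous_near_lt0 (f : R -> R) t0 : {for t0, continuous f} -> f t0 < 0 ->
  \forall t \near t0, f t < 0.
Proof.
move=> fc f0; have : nbhs (f t0) [set y | y < 0].
  by apply: open_nbhs_nbhs; split; [exact: open_lt|].
by move=> /fc.
Qed.

Lemma continuous_near_gt0 (f : R -> R) t0 : {for t0, continuous f} -> 0 < f t0 ->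
  \forall t \near t0, 0 < f t.
Proof.
move=> fc f0; have : nbhs (f t0) [set y | 0 < y].
  by apply: open_nbhs_nbhs; split; [exact: open_gt|].
by move=> /fc.
Qed.

Lemma cubic_neg (a b c x : R) : a < b -> b < c ->
  (x - a) * (x - b) * (x - c) < 0 -> x < a \/ (b < x /\ x < c).
Proof.
move=> ab bc; have [xa|ax] := ltP x a; first by left.
move=> H; right; split; rewrite ltNge; apply/negP => h; move: H; rewrite ltNge => /negP; apply.
  by rewrite mulr_le0 ?mulr_ge0_le0 ?subr_ge0 ?subr_le0// ltW// (le_lt_trans h).
by rewrite !mulr_ge0 ?subr_ge0// (le_trans (ltW bc)).
Qed.

Lemma cubic_pos (a b c x : R) : a < b -> b < c ->
  0 < (x - a) * (x - b) * (x - c) -> (a < x /\ x < b) \/ c < x.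
Proof.
move=> ab bc H; have := @cubic_neg (- c) (- b) (- a) (- x).
rewrite !ltrN2 => /(_ bc ab) [||[]]; [|by right|by move=> *; left].
by have -> : (- x - - c) * (- x - - b) * (- x - - a) = - ((x - a) * (x - b) * (x - c));
  [ring|rewrite oppr_lt0].
Qed.

(** The signs of the polynomial at the four separating points are strict at [t0], hence persist
    nearby, and the alternating pattern leaves only one position for each of the three ordered
    roots. *)
Lemma cubic_roots_near (P : R -> R -> R) (a b c : R -> R) t0 (x0 x1 x2 x3 : R) :
  (\forall t \near t0, [/\ a t < b t, b t < c t &
     forall x, P t x = (x - a t) * (x - b t) * (x - c t)]) ->
  (forall x, {for t0, continuous (P ^~ x)}) ->
  x0 < a t0 -> a t0 < x1 -> x1 < b t0 -> b t0 < x2 -> x2 < c t0 -> c t0 < x3 ->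
  \forall t \near t0, [/\ x0 < a t, a t < x1 & x1 < b t] /\
                      [/\ b t < x2, x2 < c t & c t < x3].
Proof.
move=> H Pc h0 h1 h2 h3 h4 h5.
have [ab bc PE] := nbhs_singleton H.
have neg x := continuous_near_lt0 (Pc x); have pos x := continuous_near_gt0 (Pc x).
have n0 : P t0 x0 < 0.
  rewrite PE nmulr_llt0 ?subr_lt0; last by lra.
  by rewrite nmulr_rgt0 ?subr_lt0//; lra.
have n1 : 0 < P t0 x1.
  rewrite PE nmulr_lgt0 ?subr_lt0; last by lra.
  by rewrite pmulr_rlt0 ?subr_gt0 ?subr_lt0//; lra.
have n2 : P t0 x2 < 0.
  rewrite PE nmulr_llt0 ?subr_lt0; last by lra.
  by rewrite mulr_gt0 ?subr_gt0//; lra.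
have n3 : 0 < P t0 x3 by rewrite PE !mulr_gt0 ?subr_gt0//; lra.
have {n0}n0 := neg _ n0; have {n1}n1 := pos _ n1.
have {n2}n2 := neg _ n2; have {n3}n3 := pos _ n3.
near=> t.
have [ab' bc' PE'] : [/\ a t < b t, b t < c t &
     forall x, P t x = (x - a t) * (x - b t) * (x - c t)] by near: t.
have m0 : P t x0 < 0 by near: t.
have m1 : 0 < P t x1 by near: t.
have m2 : P t x2 < 0 by near: t.
have m3 : 0 < P t x3 by near: t.
move: m0 m1 m2 m3; rewrite !PE' => /(cubic_neg ab' bc') m0 /(cubic_pos ab' bc') m1.
move=> /(cubic_neg ab' bc') m2 /(cubic_pos ab' bc') m3.
by split; split; lra.
Unshelve. all: by end_near. Qed.

Lemma quad_roots_near (P : R -> R -> R) (a b : R -> R) t0 (x0 x1 x2 : R) :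
  (\forall t \near t0, a t < b t /\ forall x, P t x = (x - a t) * (x - b t)) ->
  (forall x, {for t0, continuous (P ^~ x)}) ->
  x0 < a t0 -> a t0 < x1 -> x1 < b t0 -> b t0 < x2 ->
  \forall t \near t0, [/\ x0 < a t, a t < x1, x1 < b t & b t < x2].
Proof.
move=> H Pc h0 h1 h2 h3.
have [ab PE] := nbhs_singleton H.
have n0 : 0 < P t0 x0 by rewrite PE nmulr_lgt0 ?subr_lt0//; lra.
have n1 : P t0 x1 < 0 by rewrite PE pmulr_rlt0 ?subr_gt0 ?subr_lt0//; lra.
have n2 : 0 < P t0 x2 by rewrite PE mulr_gt0 ?subr_gt0//; lra.
have {n0}n0 := continuous_near_gt0 (Pc x0) n0.
have {n1}n1 := continuous_near_lt0 (Pc x1) n1.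
have {n2}n2 := continuous_near_gt0 (Pc x2) n2.
near=> t.
have [ab' PE'] : a t < b t /\ forall x, P t x = (x - a t) * (x - b t) by near: t.
have m0 : 0 < P t x0 by near: t.
have m1 : P t x1 < 0 by near: t.
have m2 : 0 < P t x2 by near: t.
move: m0 m1 m2; rewrite !PE' => m0 m1 m2.
have ax1 : a t < x1.
  rewrite ltNge; apply/negP => h; move: m1; rewrite ltNge => /negP; apply.
  by rewrite mulr_le0 ?subr_le0// ltW// (le_lt_trans h).
have x1b : x1 < b t.
  rewrite ltNge; apply/negP => h; move: m1; rewrite ltNge => /negP; apply.
  by rewrite mulr_ge0 ?subr_ge0// ltW.
split=> //.
  by move: m0; rewrite nmulr_lgt0 ?subr_lt0// (lt_trans (lt_trans h0 h1)).
by move: m2; rewrite pmulr_rgt0 ?subr_gt0// (lt_trans ax1)// (lt_trans h2).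
Unshelve. all: by end_near. Qed.

Lemma continuous_of_near (f : R -> R) t0 :
  (forall e, 0 < e -> \forall t \near t0, f t0 - e < f t < f t0 + e) ->
  {for t0, continuous f}.
Proof.
move=> H; apply/cvgrPdist_lt => e e0; apply: filterS (H e e0) => t.
by rewrite distrC ltr_distl.
Qed.

(** The sign test is run twice: with separators just above [a] and [b], then just below [b] and [c].
    Together they enclose each root from both sides. The margins [d1] and [d2] are at most half a
    gap, so that the separators stay between the roots. *)
Lemma cubic_roots_continuous (P : R -> R -> R) (a b c : R -> R) t0 :
  (\forall t \near t0, [/\ a t < b t, b t < c t &
     forall x, P t x = (x - a t) * (x - b t) * (x - c t)]) ->
  (forall x, {for t0, continuous (P ^~ x)}) ->
  [/\ {for t0, continuous a}, {for t0, continuous b} & {for t0, continuous c}].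
Proof.
move=> H Pc; have [ab bc _] := nbhs_singleton H.
have K (e : R) : 0 < e -> \forall t \near t0,
  [/\ a t0 - e < a t < a t0 + e, b t0 - e < b t < b t0 + e & c t0 - e < c t < c t0 + e].
  move=> e0.
  have samp (d : R) : 0 < d -> exists2 d', 0 < d' <= e & 2 * d' <= d.
    move=> d0; exists (Num.min e (d / 2)); first by rewrite lt_min e0 ge_min lexx/=; lra.
    have : Num.min e (d / 2) <= d / 2 by rewrite ge_min lexx orbT.
    lra.
  have [|d1 /andP[d10 d1e] d1h] := samp (b t0 - a t0); first by lra.
  have [|d2 /andP[d20 d2e] d2h] := samp (c t0 - b t0); first by lra.
  have U (y d z : R) : z < y + d -> d <= e -> z < y + e by move=> *; lra.
  have L (y d z : R) : y - d < z -> d <= e -> y - e < z by move=> *; lra.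
  near=> t.
  have N1 : [/\ a t0 - e < a t, a t < a t0 + d1 & a t0 + d1 < b t] /\
     [/\ b t < b t0 + d2, b t0 + d2 < c t & c t < c t0 + e].
    by near: t; apply: (cubic_roots_near H Pc); lra.
  have N2 : [/\ a t0 - e < a t, a t < b t0 - d1 & b t0 - d1 < b t] /\
     [/\ b t < c t0 - d2, c t0 - d2 < c t & c t < c t0 + e].
    by near: t; apply: (cubic_roots_near H Pc); lra.
  case: N1 => -[A1 A2 A3] [A4 A5 A6]; case: N2 => -[B1 B2 B3] [B4 B5 B6].
  split; apply/andP; split=> //; [exact: U A2 d1e|exact: L B3 d1e|exact: U A4 d2e|exact: L B5 d2e].
by split; apply: continuous_of_near => e /K; apply: filterS => t [].
Unshelve. all: by end_near. Qed.

Lemma quad_roots_continuous (P : R -> R -> R) (a b : R -> R) t0 :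
  (\forall t \near t0, a t < b t /\ forall x, P t x = (x - a t) * (x - b t)) ->
  (forall x, {for t0, continuous (P ^~ x)}) ->
  {for t0, continuous a} /\ {for t0, continuous b}.
Proof.
move=> H Pc; have [ab _] := nbhs_singleton H.
have K (e : R) : 0 < e -> \forall t \near t0,
  a t0 - e < a t < a t0 + e /\ b t0 - e < b t < b t0 + e.
  move=> e0; pose d := Num.min e ((b t0 - a t0) / 2).
  have d0 : 0 < d by rewrite lt_min e0/=; lra.
  have de : d <= e by rewrite ge_min lexx.
  have dh : d <= (b t0 - a t0) / 2 by rewrite ge_min lexx orbT.
  have U (y z : R) : z < y + d -> z < y + e by move=> *; lra.
  have L (y z : R) : y - d < z -> y - e < z by move=> *; lra.
  have N1 : \forall t \near t0,
      [/\ a t0 - e < a t, a t < a t0 + d, a t0 + d < b t & b t < b t0 + e].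
    by apply: (quad_roots_near H Pc); move: dh d0 e0; clearbody d; lra.
  have N2 : \forall t \near t0,
      [/\ a t0 - e < a t, a t < b t0 - d, b t0 - d < b t & b t < b t0 + e].
    by apply: (quad_roots_near H Pc); move: dh d0 e0; clearbody d; lra.
  apply: filterS2 N1 N2 => t [A1 A2 A3 A4] [B1 B2 B3 B4].
  by split; apply/andP; split=> //; [exact: U|exact: L].
by split; apply: continuous_of_near => e /K; apply: filterS => t [].
Qed.

End RootsOneVariable.

(** * Derivatives of simple roots stay integral and of polynomial growth *)

Section SmoothRoots.
Variables (R : realType) (n : nat) (T : R).

Local Notation K := ((R * 'rV[R]_n)%type -> R).
Implicit Types (p : R * 'rV[R]_n).
Local Notation dom := (@dom R n T).
Local Notation smooth := (smooth T).

(** When [|l| > 1], the equation can be divided by [l ^ 2]. The bound gives the roots polynomial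
    growth. *)
Lemma cubic_root_bound (c2 c1 c0 l : R) : l ^+ 3 + c2 * l ^+ 2 + c1 * l + c0 = 0 ->
  `|l| <= 1 + `|c2| + `|c1| + `|c0|.
Proof.
move=> E; have [l1|l1] := leP `|l| 1.
  by rewrite -!addrA (le_trans l1)// lerDl !addr_ge0.
have l0 : 0 < `|l| ^+ 2 by rewrite exprn_gt0// (lt_trans _ l1).
have : `|l| * `|l| ^+ 2 <= (`|c2| + `|c1| + `|c0|) * `|l| ^+ 2.
  rewrite -exprS -normrX.
  have -> : l ^+ 3 = - (c2 * l ^+ 2 + c1 * l + c0) by apply/eqP; rewrite -subr_eq0; apply/eqP; rewrite -[RHS]E; ring.
  rewrite normrN (le_trans (ler_normD _ _))// !mulrDl lerD//.
    rewrite (le_trans (ler_normD _ _))// lerD//; first by rewrite normrM normrX.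
    by rewrite normrM ler_wpM2l// expr2 ler_peMr// ltW.
  by rewrite ler_peMr// exprn_ege1// ltW.
rewrite ler_pM2r// => /le_trans; apply; rewrite -!addrA; lra.
Qed.

Lemma polygrowth_norm (g : K) : polygrowth T g -> polygrowth T (fun p => `|g p|).
Proof. by apply: polygrowth_le => p _; rewrite normr_id. Qed.

Section Cubic.
Variables (c2 c1 c0 l0 l1 l2 : K).
Hypotheses (f2 : tfrac T c2) (f1 : tfrac T c1) (f0 : tfrac T c0).
Hypotheses (s2 : forall k, smooth k c2) (s1 : forall k, smooth k c1)
  (s0 : forall k, smooth k c0).
Let P p (x : R) := x ^+ 3 + c2 p * x ^+ 2 + c1 p * x + c0 p.
Hypothesis roots : forall p, dom p -> [/\ l0 p < l1 p, l1 p < l2 p &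
  forall x, P p x = (x - l0 p) * (x - l1 p) * (x - l2 p)].
(** The discriminant of the monic cubic [P]. *)
Let D p := c2 p ^+ 2 * c1 p ^+ 2 - 4 * c1 p ^+ 3 - 4 * c2 p ^+ 3 * c0 p
  + 18 * c2 p * c1 p * c0 p - 27 * c0 p ^+ 2.
Hypothesis D_ge1 : forall p, dom p -> 1 <= D p.

Lemma cubic_continuous p x : dom p -> {for p.1, continuous (fun t => P (t, p.2) x)}.
Proof.
move=> [tT x1].
have c g : (forall k, smooth k g) -> tcontinuous T g by move=> /(_ 0%N) [[]].
have : tcontinuous T (fun p => cst (x ^+ 3) p + c2 p * cst (x ^+ 2) p + c1 p * cst x p + c0 p).
  apply: tcontinuousD; last exact: c.
  apply: tcontinuousD; last by apply: tcontinuousM; [exact: c|exact: tcontinuous_cst].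
  apply: tcontinuousD; first exact: tcontinuous_cst.
  by apply: tcontinuousM; [exact: c|exact: tcontinuous_cst].
by apply.
Qed.

Lemma cubic_root_basic : [/\ basic T l0, basic T l1 & basic T l2].
Proof.
have B (l : K) : (forall p, dom p -> P p (l p) = 0) -> tcontinuous T l -> basic T l.
  move=> Pl lc; split=> //; first exact: alg_cubic f2 f1 f0 Pl.
  apply: (polygrowth_le (h := fun p => cst 1 p + `|c2 p| + `|c1 p| + `|c0 p|)).
    move=> p dp; rewrite (le_trans (cubic_root_bound (Pl p dp)))//; exact: ler_norm.
  have pg g : (forall k, smooth k g) -> polygrowth T (fun p => `|g p|).
    by move=> /(_ 0%N) [[_ h _] _]; exact: polygrowth_norm.
  by do 3 (apply: polygrowthD; last exact: pg); exact: polygrowth_cst.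
have C p : dom p -> [/\ {for p.1, continuous (fun t => l0 (t, p.2))},
    {for p.1, continuous (fun t => l1 (t, p.2))} & {for p.1, continuous (fun t => l2 (t, p.2))}].
  move=> dp; apply: (@cubic_roots_continuous R (fun t x => P (t, p.2) x)).
    have [tT x1] := dp; apply: filterS (near_itv tT) => t t0T.
    by apply: roots; split.
  by move=> x; exact: cubic_continuous.
have dP t xi : 0 < t < T -> 1 <= euclid_norm xi -> dom (t, xi) by split.
split; apply: B.
- by move=> p /roots[_ _ ->]; rewrite subrr !mul0r.
- by move=> t xi tT x1; have [] := C _ (dP _ _ tT x1).
- by move=> p /roots[_ _ ->]; rewrite subrr mulr0 mul0r.
- by move=> t xi tT x1; have [] := C _ (dP _ _ tT x1).
- by move=> p /roots[_ _ ->]; rewrite subrr mulr0.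
- by move=> t xi tT x1; have [] := C _ (dP _ _ tT x1).
Qed.

Lemma cubic_coefs (A B C a b c : R) :
  (forall x, x ^+ 3 + A * x ^+ 2 + B * x + C = (x - a) * (x - b) * (x - c)) ->
  [/\ A = - (a + b + c), B = a * b + b * c + c * a & C = - (a * b * c)].
Proof. by move=> E; have E0 := E 0; have E1 := E 1; have E2 := E (-1); split; lra. Qed.

Lemma disc_roots (a b c : K) p :
  (forall x, P p x = (x - a p) * (x - b p) * (x - c p)) ->
  D p = ((a p - b p) * (a p - c p) * (b p - c p)) ^+ 2.
Proof. by move=> /cubic_coefs[A B C]; rewrite /D A B C; ring. Qed.

Lemma tfrac_exp (g : K) m : tfrac T g -> tfrac T (fun p => g p ^+ m).
Proof.
move=> fg; elim: m => [|m IH].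
  by apply: tfrac_ext (tfrac_cst n T 1) => p _; rewrite expr0.
by apply: tfrac_ext (tfracM fg IH) => p _; rewrite exprS.
Qed.

Lemma disc_tfrac : tfrac T D.
Proof.
apply: (tfrac_ext (g := fun p => c2 p ^+ 2 * c1 p ^+ 2 + cst (-4) p * c1 p ^+ 3
  + cst (-4) p * (c2 p ^+ 3 * c0 p) + cst 18 p * (c2 p * (c1 p * c0 p))
  + cst (-27) p * c0 p ^+ 2)) => [p _|]; first by rewrite /D /=; ring.
apply: tfracD; last by apply: tfracM; [exact: tfrac_cst|exact: tfrac_exp].
apply: tfracD; last by apply: tfracM; [exact: tfrac_cst|apply: tfracM => //; exact: tfracM].
apply: tfracD; last by apply: tfracM; [exact: tfrac_cst|apply: tfracM => //; exact: tfrac_exp].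
apply: tfracD; last by apply: tfracM; [exact: tfrac_cst|exact: tfrac_exp].
by apply: tfracM; exact: tfrac_exp.
Qed.

Lemma disc_smooth k : smooth k D.
Proof.
apply: (smooth_ext (g := fun p => c2 p ^+ 2 * c1 p ^+ 2 + cst (-4) p * c1 p ^+ 3
  + cst (-4) p * (c2 p ^+ 3 * c0 p) + cst 18 p * (c2 p * (c1 p * c0 p))
  + cst (-27) p * c0 p ^+ 2)) => [p _|]; first by rewrite /D /=; ring.
apply: smoothD; last by apply: smoothM; [exact: smooth_cst|exact: smoothX].
apply: smoothD; last by apply: smoothM; [exact: smooth_cst|apply: smoothM => //; exact: smoothM].
apply: smoothD; last by apply: smoothM; [exact: smooth_cst|apply: smoothM => //; exact: smoothX].
apply: smoothD; last by apply: smoothM; [exact: smooth_cst|exact: smoothX].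
by apply: smoothM; exact: smoothX.
Qed.

Lemma disc_inv_smooth k : smooth k (fun p => (D p)^-1).
Proof.
apply: smoothV; [exact: disc_tfrac| | |exact: disc_smooth].
  by move=> p /D_ge1 d1; rewrite gt_eqF// (lt_le_trans _ d1).
apply: polygrowth_le (polygrowth_cst n T 1) => p /D_ge1 d1.
by rewrite normr1 ger0_norm ?invr_ge0 ?(le_trans _ d1)// invf_le1// (lt_le_trans _ d1).
Qed.

Lemma smooth_dt k (g : K) : (forall k, smooth k g) -> smooth k (dt g).
Proof. by move=> /(_ k.+1) [_ []]. Qed.

Lemma cubic_root_step k (a b c : K) : basic T a -> smooth k a -> smooth k b -> smooth k c ->
  (forall p, dom p -> [/\ a p != b p, a p != c p, b p != c p &
     forall x, P p x = (x - a p) * (x - b p) * (x - c p)]) ->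
  smooth k.+1 a.
Proof.
move=> ba sa sb sc H.
apply: (@smoothS _ _ _ k _ (fun p => cst (-1) p *
   ((dt c2 p * a p ^+ 2 + dt c1 p * a p + dt c0 p) *
   ((a p + cst (-1) p * b p) * (a p + cst (-1) p * c p) * (b p + cst (-1) p * c p) ^+ 2)
   * (D p)^-1))) => //.
  have sB (g h : K) : smooth k g -> smooth k h -> smooth k (fun p => g p + cst (-1) p * h p).
    by move=> sg sh; apply: smoothD => //; apply: smoothM => //; exact: smooth_cst.
  apply: smoothM; first exact: smooth_cst.
  apply: smoothM; last exact: disc_inv_smooth.
  apply: smoothM; last first.
    by apply: smoothM; [apply: smoothM; exact: sB|apply: smoothX; exact: sB].
  apply: smoothD; last exact: smooth_dt.
  by apply: smoothD; apply: smoothM; do ?exact: smooth_dt; do ?exact: smoothX.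
move=> p dp; have [ab ac bc E] := H p dp.
pose u := a p.
pose F t := (u ^+ 3 + c2 (t, p.2) * u ^+ 2 + c1 (t, p.2) * u) + c0 (t, p.2).
pose Q t := (u - b (t, p.2)) * (u - c (t, p.2)).
have DF : is_derive p.1 (1 : R) F (dt c2 p * u ^+ 2 + dt c1 p * u + dt c0 p).
  have D2 := smooth_is_derive (s2 1%N) dp; have D1 := smooth_is_derive (s1 1%N) dp.
  have D0 := smooth_is_derive (s0 1%N) dp.
  have := is_deriveD (is_deriveD (is_deriveD (is_derive_cst (u ^+ 3) p.1 1)
    (is_deriveM D2 (is_derive_cst (u ^+ 2) p.1 1)))
    (is_deriveM D1 (is_derive_cst u p.1 1))) D0.
  move=> /is_derive_eq; apply.
  by rewrite !scaler0 !add0r /GRing.scale/= ![u * _]mulrC ![u ^+ 2 * _]mulrC.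
have Qc : {for p.1, continuous Q}.
  have [tT x1] := dp; have [_ _ cb] := smooth_basic sb; have [_ _ cc] := smooth_basic sc.
  have : tcontinuous T (fun p => (cst u p + cst (-1) p * b p) * (cst u p + cst (-1) p * c p)).
    apply: tcontinuousM; (apply: tcontinuousD; first exact: tcontinuous_cst);
    by apply: tcontinuousM; [exact: tcontinuous_cst|].
  move=> /(_ _ _ tT x1); apply: continuous_near_eq; near=> t.
  by rewrite /Q /= !mulN1r.
have pE : (p.1, p.2) = p by rewrite -surjective_pairing.
have Q0 : Q p.1 != 0 by rewrite /Q pE mulf_neq0// subr_eq0.
have FE : \forall t \near p.1, F t = (a (p.1, p.2) - a (t, p.2)) * Q t.
  have [tT x1] := dp; apply: filterS (near_itv tT) => t tT'.
  have [|_ _ _ Et] := H (t, p.2); first by split.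
  by rewrite /F pE -/u /Q mulrA -Et.
have := root_derive (r := fun t => a (t, p.2)) FE Qc Q0 DF.
move=> /is_derive_eq; apply; rewrite (disc_roots E) /Q pE -/u /=.
by field; rewrite !subr_eq0 ab ac bc.
Unshelve. all: by end_near. Qed.

Lemma cubic_roots_smooth k : [/\ smooth k l0, smooth k l1 & smooth k l2].
Proof.
have [b0 b1 b2] := cubic_root_basic.
elim: k => [|k [IH0 IH1 IH2]]; first by split; split.
split.
- apply: (@cubic_root_step k l0 l1 l2) => // p /roots[A B E].
  by split=> //; rewrite lt_eqF// (lt_trans A).
- apply: (@cubic_root_step k l1 l0 l2) => // p /roots[A B E].
  split; rewrite ?(lt_eqF B) ?(gt_eqF A) ?(lt_eqF (lt_trans A B))//.
  by move=> x; rewrite E; ring.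
- apply: (@cubic_root_step k l2 l0 l1) => // p /roots[A B E].
  split; rewrite ?(gt_eqF B) ?(lt_eqF A) ?(gt_eqF (lt_trans A B))//.
  by move=> x; rewrite E; ring.
Qed.

(** [1 / (a - b) = (a - b) * (a - c) ^ 2 * (b - c) ^ 2 / D]: a lower bound on the discriminant and
    an upper bound on the roots keep each gap from being smaller than an inverse power of
    [1 + |xi|]. *)
Lemma cubic_gap_inv_polygrowth :
  [/\ polygrowth T (fun p => (l0 p - l1 p)^-1), polygrowth T (fun p => (l1 p - l2 p)^-1)
    & polygrowth T (fun p => (l2 p - l0 p)^-1)].
Proof.
have [S0 S1 S2] := cubic_roots_smooth 0.
have [_ pD _] := smooth_basic (disc_inv_smooth 0).
have [_ p0 _] := smooth_basic S0; have [_ p1 _] := smooth_basic S1.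
have [_ p2 _] := smooth_basic S2.
have pB (g h : K) : polygrowth T g -> polygrowth T h -> polygrowth T (fun p => g p - h p).
  move=> pg ph; apply: (polygrowth_ext (g := fun p => g p + cst (-1) p * h p)).
    by move=> p _; rewrite mulN1r.
  by apply: polygrowthD => //; apply: polygrowthM => //; exact: polygrowth_cst.
have key (a b c : K) : polygrowth T a -> polygrowth T b -> polygrowth T c ->
    (forall p, dom p -> [/\ a p != b p, a p != c p, b p != c p &
      forall x, P p x = (x - a p) * (x - b p) * (x - c p)]) ->
    polygrowth T (fun p => (a p - b p)^-1).
  move=> pa pb pc H; apply: (polygrowth_ext (g := fun p =>
     (a p - b p) * ((a p - c p) * (a p - c p)) * ((b p - c p) * (b p - c p)) * (D p)^-1)).
    move=> p /H[ab ac bc E]; rewrite (disc_roots E).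
    by field; rewrite !subr_eq0 ab ac bc.
  by apply: polygrowthM => //; do !apply: polygrowthM; exact: pB.
split.
- apply: (key l0 l1 l2) => // p /roots[A B E].
  by split=> //; rewrite lt_eqF// (lt_trans A).
- apply: (key l1 l2 l0) => // p /roots[A B E].
  split; rewrite ?(lt_eqF B) ?(gt_eqF A) ?(gt_eqF (lt_trans A B))//.
  by move=> x; rewrite E; ring.
- apply: (key l2 l0 l1) => // p /roots[A B E].
  split; rewrite ?(gt_eqF B) ?(lt_eqF A) ?(gt_eqF (lt_trans A B))//.
  by move=> x; rewrite E; ring.
Qed.

End Cubic.

Section Quadratic.
Variables (d1 d0 m0 m1 : K).
Hypotheses (f1 : tfrac T d1) (f0 : tfrac T d0).
Hypotheses (s1 : forall k, smooth k d1) (s0 : forall k, smooth k d0).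
Let P p (x : R) := x ^+ 2 + d1 p * x + d0 p.
Hypothesis roots : forall p, dom p -> m0 p < m1 p /\
  forall x, P p x = (x - m0 p) * (x - m1 p).
Let D p := d1 p ^+ 2 - 4 * d0 p.
Hypothesis D_ge1 : forall p, dom p -> 1 <= D p.

Lemma quad_root_basic : basic T m0 /\ basic T m1.
Proof.
have B (l : K) : (forall p, dom p -> P p (l p) = 0) -> tcontinuous T l -> basic T l.
  move=> Pl lc.
  (* Multiplying the quadratic equation by [l] gives a cubic with constant term 0, to which
     [alg_cubic] and [cubic_root_bound] apply. *)
  have E p : dom p -> l p ^+ 3 + d1 p * l p ^+ 2 + d0 p * l p + cst 0 p = 0.
    move=> /Pl H; have -> : l p ^+ 3 + d1 p * l p ^+ 2 + d0 p * l p + cst 0 p = l p * P p (l p).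
      by rewrite /P /cst; ring.
    by rewrite H mulr0.
  split=> //; first exact: alg_cubic f1 f0 (tfrac_cst n T 0) E.
  apply: (polygrowth_le (h := fun p => cst 1 p + `|d1 p| + `|d0 p| + `|cst 0 p|)).
    move=> p dp; rewrite (le_trans (cubic_root_bound (E p dp)))//; exact: ler_norm.
  have pg g : (forall k, smooth k g) -> polygrowth T (fun p => `|g p|).
    by move=> /(_ 0%N) [[_ h _] _]; exact: polygrowth_norm.
  apply: polygrowthD; last exact: polygrowth_norm (polygrowth_cst _ _ _).
  by do 2 (apply: polygrowthD; last exact: pg); exact: polygrowth_cst.
have C p : dom p -> {for p.1, continuous (fun t => m0 (t, p.2))} /\
    {for p.1, continuous (fun t => m1 (t, p.2))}.
  move=> dp; have [tT x1] := dp.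
  apply: (@quad_roots_continuous R (fun t x => P (t, p.2) x)).
    by apply: filterS (near_itv tT) => t t0T; apply: roots; split.
  move=> x; have : tcontinuous T (fun p => cst (x ^+ 2) p + d1 p * cst x p + d0 p).
    apply: tcontinuousD; last by have [] := smooth_basic (s0 0%N).
    apply: tcontinuousD; first exact: tcontinuous_cst.
    by apply: tcontinuousM; [have [] := smooth_basic (s1 0%N)|exact: tcontinuous_cst].
  by move=> /(_ _ _ tT x1).
have dP t xi : 0 < t < T -> 1 <= euclid_norm xi -> dom (t, xi) by split.
split; apply: B.
- by move=> p /roots[_ ->]; rewrite subrr !mul0r.
- by move=> t xi tT x1; have [] := C _ (dP _ _ tT x1).
- by move=> p /roots[_ ->]; rewrite subrr mulr0.
- by move=> t xi tT x1; have [] := C _ (dP _ _ tT x1).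
Qed.

Lemma quad_coefs (A B a b : R) :
  (forall x, x ^+ 2 + A * x + B = (x - a) * (x - b)) -> A = - (a + b) /\ B = a * b.
Proof. by move=> E; have E0 := E 0; have E1 := E 1; split; lra. Qed.

Lemma quad_disc_inv_smooth k : smooth k (fun p => (D p)^-1).
Proof.
apply: smoothV.
- apply: (tfrac_ext (g := fun p => d1 p * d1 p + cst (-4) p * d0 p)) => [p _|].
    by rewrite /D /=; ring.
  by apply: tfracD; apply: tfracM => //; exact: tfrac_cst.
- by move=> p /D_ge1 h1; rewrite gt_eqF// (lt_le_trans _ h1).
- apply: polygrowth_le (polygrowth_cst n T 1) => p /D_ge1 h1.
  by rewrite normr1 ger0_norm ?invr_ge0 ?(le_trans _ h1)// invf_le1// (lt_le_trans _ h1).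
- move=> j; apply: (smooth_ext (g := fun p => d1 p * d1 p + cst (-4) p * d0 p)) => [p _|].
    by rewrite /D /=; ring.
  by apply: smoothD; apply: smoothM => //; exact: smooth_cst.
Qed.

Lemma quad_root_step k (a b : K) : basic T a -> smooth k a -> smooth k b ->
  (forall p, dom p -> a p != b p /\ forall x, P p x = (x - a p) * (x - b p)) ->
  smooth k.+1 a.
Proof.
move=> ba sa sb H.
apply: (@smoothS _ _ _ k _ (fun p => cst (-1) p *
   ((dt d1 p * a p + dt d0 p) * (a p + cst (-1) p * b p) * (D p)^-1))) => //.
  apply: smoothM; first exact: smooth_cst.
  apply: smoothM; last exact: quad_disc_inv_smooth.
  apply: smoothM; last by apply: smoothD => //; apply: smoothM => //; exact: smooth_cst.
  by apply: smoothD; do ?apply: smoothM => //; exact: smooth_dt.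
move=> p dp; have [ab E] := H p dp.
pose u := a p.
pose F t := (u ^+ 2 + d1 (t, p.2) * u) + d0 (t, p.2).
pose Q t := u - b (t, p.2).
have DF : is_derive p.1 (1 : R) F (dt d1 p * u + dt d0 p).
  have D1 := smooth_is_derive (s1 1%N) dp; have D0 := smooth_is_derive (s0 1%N) dp.
  have := is_deriveD (is_deriveD (is_derive_cst (u ^+ 2) p.1 1)
    (is_deriveM D1 (is_derive_cst u p.1 1))) D0.
  move=> /is_derive_eq; apply.
  by rewrite !scaler0 !add0r /GRing.scale/= ![u * _]mulrC.
have Qc : {for p.1, continuous Q}.
  have [tT x1] := dp; have [_ _ cb] := smooth_basic sb.
  have : tcontinuous T (fun p => cst u p + cst (-1) p * b p).
    apply: tcontinuousD; first exact: tcontinuous_cst.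
    by apply: tcontinuousM; [exact: tcontinuous_cst|].
  move=> /(_ _ _ tT x1); apply: continuous_near_eq; near=> t.
  by rewrite /Q /= !mulN1r.
have pE : (p.1, p.2) = p by rewrite -surjective_pairing.
have Q0 : Q p.1 != 0 by rewrite /Q pE subr_eq0.
have FE : \forall t \near p.1, F t = (a (p.1, p.2) - a (t, p.2)) * Q t.
  have [tT x1] := dp; apply: filterS (near_itv tT) => t tT'.
  have [|_ Et] := H (t, p.2); first by split.
  by rewrite /F pE -/u /Q -Et.
have := root_derive (r := fun t => a (t, p.2)) FE Qc Q0 DF.
move=> /is_derive_eq; apply; rewrite /Q pE -/u /=.
have [A B] := quad_coefs E.
have -> : D p = (a p - b p) ^+ 2 by rewrite /D A B; ring.
by rewrite /u /cst; field; rewrite subr_eq0 ab.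
Unshelve. all: by end_near. Qed.

Lemma quad_roots_smooth k : smooth k m0 /\ smooth k m1.
Proof.
have [b0 b1] := quad_root_basic.
elim: k => [|k [IH0 IH1]]; first by split; split.
split.
- apply: (@quad_root_step k m0 m1) => // p /roots[A E].
  by split=> //; rewrite lt_eqF.
- apply: (@quad_root_step k m1 m0) => // p /roots[A E].
  by split; [rewrite gt_eqF|move=> x; rewrite E mulrC].
Qed.

End Quadratic.
End SmoothRoots.

(** * Lower bounds for the discriminants of [L - L''] and of its derivative *)

Section Discriminants.
Variable R : realFieldType.

(** Centring [tau] at the mean of the roots turns [L] into [y ^ 3 - q * y + r], with [L'' = 6 * y],
    so subtracting [L''] only replaces [q] by [q + 6]. The discriminant [4 * q ^ 3 - 27 * r ^ 2]
    therefore gains [4 * (q + 6) ^ 3 - 4 * q ^ 3 = 72 * q ^ 2 + 432 * q + 864]. Real roots make both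
    [q] and the discriminant of [L] nonnegative. *)
Lemma disc_sub_deriv2 (a b c p2 p1 p0 : R) :
  p2 = - (a + b + c) -> p1 = a * b + b * c + c * a -> p0 = - (a * b * c) ->
  1 <= p2 ^+ 2 * (p1 - 6) ^+ 2 - 4 * (p1 - 6) ^+ 3 - 4 * p2 ^+ 3 * (p0 - 2 * p2)
    + 18 * p2 * (p1 - 6) * (p0 - 2 * p2) - 27 * (p0 - 2 * p2) ^+ 2.
Proof.
move=> -> -> ->.
pose q := ((a - b) ^+ 2 + (b - c) ^+ 2 + (c - a) ^+ 2) / 6.
have q0 : 0 <= q by rewrite divr_ge0// !addr_ge0// sqr_ge0.
set X := (X in _ <= X).
have -> : X = ((a - b) * (b - c) * (c - a)) ^+ 2 + 72 * q ^+ 2 + 432 * q + 864.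
  by rewrite /X /q; field.
have := sqr_ge0 ((a - b) * (b - c) * (c - a)); have := sqr_ge0 q.
move: (_ ^+ 2) (_ ^+ 2) => s r; lra.
Qed.

(** In the same notation, the monic quadratic is a third of the derivative of
    [y ^ 3 - (q + 6) * y + r], and its discriminant is [4 * (q + 6) / 3]. *)
Lemma disc_deriv (a b c p2 p1 : R) :
  p2 = - (a + b + c) -> p1 = a * b + b * c + c * a ->
  1 <= (2 / 3 * p2) ^+ 2 - 4 * ((p1 - 6) / 3).
Proof.
move=> -> ->; set X := (X in _ <= X).
have -> : X = 2 / 9 * ((a - b) ^+ 2 + (b - c) ^+ 2 + (c - a) ^+ 2) + 8.
  by rewrite /X; field.
have := sqr_ge0 (a - b); have := sqr_ge0 (b - c); have := sqr_ge0 (c - a).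
move: (_ ^+ 2) (_ ^+ 2) (_ ^+ 2) => r s u; lra.
Qed.

End Discriminants.

(** * Total variation and logarithmic integrals *)

Section TotalVariation.
Variable R : realType.
Implicit Types (G g : R -> R) (T : R).
Local Notation mu := (@lebesgue_measure R).

Lemma itv_continuous_measurable g (a b : R) :
  (forall t, a < t < b -> {for t, continuous g}) ->
  measurable_fun `]a, b[ (EFin \o g).
Proof.
move=> gc; apply/measurable_EFinP; apply: open_continuous_measurable_fun => //.
by move=> t; rewrite inE/= in_itv/=; exact: gc.
Qed.

Lemma continuous_norm g (t : R) : {for t, continuous g} ->
  {for t, continuous (fun s => `|g s|)}.
Proof. by move=> gc; apply: continuous_comp => //; exact: norm_continuous. Qed.

Lemma free_sign g (x y : R) : (forall t, x < t < y -> {for t, continuous g}) ->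
  zero_or_free g x y ->
  (forall t, x < t < y -> `|g t| = g t) \/ (forall t, x < t < y -> `|g t| = - g t).
Proof.
move=> gc [g0|gn0]; first by left => t txy; rewrite g0// normr0.
have [[s sxy gs]|H] := pselect (exists2 s, x < s < y & g s < 0); last first.
  left => t txy; rewrite ger0_norm// leNgt; apply/negP => gt; apply: H; by exists t.
right => t txy; apply: ler0_norm; rewrite leNgt; apply/negP => gt.
have key (a b : R) : x < a < y -> x < b < y -> a <= b ->
    Num.min (g a) (g b) <= 0 <= Num.max (g a) (g b) -> False.
  move=> /andP[xa ay] /andP[xb yb] ab H.
  have [|c] := @IVT R g a b 0 ab _ H.
    apply: continuous_in_subspaceT => r; rewrite inE/= in_itv/= => /andP[ar rb].
    by apply: gc; rewrite (lt_le_trans xa)//= (le_lt_trans rb).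
  rewrite in_itv/= => /andP[ac cb] hc0.
  have := gn0 c; rewrite hc0 eqxx (lt_le_trans xa)//= (le_lt_trans cb)// => /(_ isT).
  by [].
have [st|ts] := leP s t.
  by apply: (key s t) => //; rewrite minEle maxEle (ltW (lt_trans gs gt)) (ltW gs) (ltW gt).
apply: (key t s) => //; first exact: ltW.
have /negbTE h : ~~ (g t <= g s) by rewrite -ltNge (lt_trans gs gt).
by rewrite minEle maxEle h (ltW gs) (ltW gt).
Qed.

(** On such a piece [|g| = s * g] with a constant sign [s], so the integral is [s * (G y - G x)]. *)
Lemma integral_norm_derive_free G g (a b x y M : R) : 0 <= M ->
  (forall t, a < t < b -> is_derive t (1 : R) G (g t)) ->
  (forall t, a < t < b -> {for t, continuous g}) ->
  (forall t, a < t < b -> `|G t| <= M) ->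
  a < x -> x <= y -> y < b -> zero_or_free g x y ->
  (\int[mu]_(t in `[x, y]) (`|g t|)%:E <= (2 * M)%:E)%E.
Proof.
move=> M0 D gc GM ax + yb gxy; rewrite le_eqVlt => /predU1P[<-|xy].
  by rewrite set_itv1 integral_set1 lee_fin mulr_ge0.
have inab t : x <= t -> t <= y -> a < t < b.
  by move=> xt ty; rewrite (lt_le_trans ax)//= (le_lt_trans ty).
have Gc t : a < t < b -> {for t, continuous G}.
  by move=> tab; apply: derivable_continuous; have := D t tab.
have [s s1 gs] : exists2 s : R, `|s| = 1 & forall t, x < t < y -> `|g t| = s * g t.
  have [|H|H] := @free_sign g x y _ gxy.
  - by move=> t /andP[xt ty]; apply: gc; apply: inab; exact: ltW.
  - by exists 1; [rewrite normr1|move=> t txy; rewrite mul1r H].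
  - by exists (-1); [rewrite normrN1|move=> t txy; rewrite mulN1r H].
have -> : (\int[mu]_(t in `[x, y]) (`|g t|)%:E = (s * G y)%:E - (s * G x)%:E)%E.
  apply: (@continuous_FTC2 R (fun t => `|g t|) (fun t => s * G t)) => //.
  - apply: continuous_in_subspaceT => t; rewrite inE/= in_itv/= => /andP[xt ty].
    by apply: continuous_norm; apply: gc; exact: inab.
  - have sGc t : a < t < b -> {for t, continuous (fun t => s * G t)}.
      by move=> tab; apply: (@continuousM _ _ (cst s) G); [exact: cst_continuous|exact: Gc].
    split.
    + move=> t; rewrite in_itv/= => /andP[xt ty].
      have DG := D t (inab t (ltW xt) (ltW ty)).
      by have := is_deriveZ s DG => -[].
    + by apply: cvg_at_right_filter; apply: sGc; apply: inab => //; exact: ltW.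
    + by apply: cvg_at_left_filter; apply: sGc; apply: inab => //; exact: ltW.
  - move=> t; rewrite in_itv/= => txy; have [xt ty] := andP txy.
    rewrite gs//; have DG := D t (inab t (ltW xt) (ltW ty)).
    exact: is_derive_derive1 (is_deriveZ s DG).
rewrite -EFinB lee_fin (le_trans (ler_norm _))// (le_trans (ler_normB _ _))//.
rewrite !normrM s1 !mul1r mulr2n mulrDl mul1r lerD// GM// inab// ltW//.
Qed.

Lemma integral_norm_derive_cc G g (a b x y M : R) n : 0 <= M ->
  (forall t, a < t < b -> is_derive t (1 : R) G (g t)) ->
  (forall t, a < t < b -> {for t, continuous g}) ->
  (forall t, a < t < b -> `|G t| <= M) ->
  a < x -> x <= y -> y < b -> pieces (zero_or_free g) n x y ->
  (\int[mu]_(t in `[x, y]) (`|g t|)%:E <= (n%:R * (2 * M))%:E)%E.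
Proof.
move=> M0 D gc GM ax xy yb H; elim: H ax xy yb => {n x y}.
  move=> n x y gxy ax xy yb.
  apply: (le_trans (integral_norm_derive_free M0 D gc GM ax xy yb gxy)).
  by rewrite lee_fin ler_peMl ?mulr_ge0// ler1n.
move=> n m x z y xz zy H1 IH1 H2 IH2 ax xy yb.
have mg (A : set R) : A `<=` `]a, b[ -> measurable A ->
    measurable_fun A (EFin \o (fun t => `|g t|)).
  move=> Aab mA; apply: (measurable_funS _ Aab) => //.
  by apply: itv_continuous_measurable => t tab; apply: continuous_norm; exact: gc.
have sub (l r : bool) (u v : R) : a < u -> v < b ->
    [set` Interval (BSide l u) (BSide r v)] `<=` `]a, b[.
  by move=> au vb; apply: subset_itv; [case: l|case: r]; rewrite bnd_simp// ltW.
rewrite (@itv_bndbnd_setU _ _ (BLeft x) (BRight z) (BRight y)) ?bnd_simp//.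
rewrite ge0_integral_setU//=; last 2 first.
- by rewrite -itv_bndbnd_setU ?bnd_simp//; apply: mg => //; exact: sub.
- rewrite disj_set2E; apply/eqP; rewrite -subset0 => t [/=].
  by rewrite !in_itv/= => /andP[_ tz] /andP[zt _]; have := lt_le_trans zt tz; rewrite ltxx.
rewrite natrD mulrDl EFinD; apply: leeD; first exact: IH1 ax xz (le_lt_trans zy yb).
apply: le_trans (IH2 (lt_le_trans ax xz) zy yb).
apply: ge0_subset_integral => //.
- by apply: mg => //; apply: sub => //; exact: lt_le_trans ax xz.
- by apply: subset_itv_oc_cc.
Qed.

(* The total variation of G is at most 2M on each piece where g = G' keeps its sign. *)
Lemma integral_norm_derive G g T M n : 0 < T -> 0 <= M ->
  (forall t, 0 < t < T -> is_derive t (1 : R) G (g t)) ->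
  (forall t, 0 < t < T -> {for t, continuous g}) ->
  (forall t, 0 < t < T -> `|G t| <= M) ->
  pieces (zero_or_free g) n 0 T ->
  (\int[mu]_(t in `]0%R, T[) (`|g t|)%:E <= (n%:R * (2 * M))%:E)%E.
Proof.
move=> T0 M0 D gc GM H.
(* [G] and [g] are controlled only inside the open interval, which is exhausted by the closed
   intervals [[e i, T - e i]]. The bound on these does not depend on [i], and [e i <= T / 2] keeps
   them nonempty. *)
pose e (i : nat) := T / 2 / i.+1%:R.
have e0 i : 0 < e i by rewrite !divr_gt0.
have e2 i : e i <= T / 2.
  by rewrite ler_pdivrMr// ler_peMr ?ler1n// divr_ge0// ltW.
pose F i := [set` `[e i, T - e i]].
have FT i : F i `<=` `]0, T[.
  by apply: subset_itv; rewrite bnd_simp// gtrBl.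
have FU : \bigcup_i F i = `]0, T[%classic.
  apply/seteqP; split=> [t [i _ /FT]//|t]; rewrite /= in_itv/= => /andP[t0 tT].
  pose d := Num.min t (T - t).
  have d0 : 0 < d by rewrite lt_min t0 subr_gt0.
  have dt : d <= t by rewrite ge_min lexx.
  have dT : d <= T - t by rewrite ge_min lexx orbT.
  have [i ei] : exists i, e i <= d.
    exists (Num.truncn (T / 2 / d)); rewrite /e ler_pdivrMr// [leRHS]mulrC -ler_pdivrMr//.
    by rewrite ltW// truncnS_gt.
  by exists i => //; rewrite /F/= in_itv/=; apply/andP; split; lra.
have cg : (\int[mu]_(t in F i) (`|g t|)%:E @[i --> \oo] -->
    \int[mu]_(t in \bigcup_i F i) (`|g t|)%:E)%E.
  apply: ge0_nondecreasing_set_cvg_integral => //.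
  - apply/nondecreasing_seqP => i; rewrite subsetEset; apply: subset_itv; rewrite bnd_simp//.
      by rewrite ler_pM2l ?divr_gt0// lef_pV2 ?posrE// ler_nat.
    by rewrite lerD2l lerN2 ler_pM2l ?divr_gt0// lef_pV2 ?posrE// ler_nat.
  - by move=> i; exact: measurable_itv.
  - move=> i; apply: (measurable_funS _ (FT i)) => //.
    by apply: itv_continuous_measurable => t tT; apply: continuous_norm; exact: gc.
rewrite -FU; apply: cvge_to_le cg _; near=> i.
have ei := e0 i; have ei2 := e2 i.
apply: (integral_norm_derive_cc M0 D gc GM) => //.
- by move: ei ei2; move: (e i) => z *; lra.
- by move: ei ei2; move: (e i) => z *; lra.
- apply: (pieces_sub (@zero_or_free_hereditary _ _) H).
  + exact: ltW.
  + by move: ei ei2; move: (e i) => z *; lra.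
  + by move: ei ei2; move: (e i) => z *; lra.
Unshelve. all: by end_near. Qed.

(** The inverse hyperbolic sine, a primitive of [1 / sqrt (1 + u ^ 2)]. This integrand dominates
    [1 / (1 + |u|)], while the primitive grows only logarithmically. *)
Definition asinh (u : R) := ln (u + Num.sqrt (1 + u ^+ 2)).

Lemma sqrt1D_gt0 (u : R) : 0 < Num.sqrt (1 + u ^+ 2).
Proof. by rewrite sqrtr_gt0 ltr_pwDl// sqr_ge0. Qed.

Lemma sqr_sqrt1D (u : R) : Num.sqrt (1 + u ^+ 2) ^+ 2 = 1 + u ^+ 2.
Proof. by rewrite sqr_sqrtr// addr_ge0// sqr_ge0. Qed.

Lemma sqrt1D_gt (u : R) : `|u| < Num.sqrt (1 + u ^+ 2).
Proof.
rewrite -(@ltr_pXn2r _ 2)// ?nnegrE// ?(ltW (sqrt1D_gt0 _))//.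
by rewrite sqr_sqrt1D real_normK ?num_real// ltrDr.
Qed.

Lemma sqrt1D_le (u : R) : Num.sqrt (1 + u ^+ 2) <= 1 + `|u|.
Proof.
rewrite -(@ler_pXn2r _ 2)// ?nnegrE// ?(ltW (sqrt1D_gt0 _))//.
rewrite sqr_sqrt1D sqrrD expr1n mul1r real_normK ?num_real//.
by rewrite lerD2r lerDl mulrn_wge0.
Qed.

Lemma asinh_arg_gt0 (u : R) : 0 < u + Num.sqrt (1 + u ^+ 2).
Proof. by have := sqrt1D_gt u; rewrite ltr_norml => /andP[h _]; rewrite -ltrBlDr sub0r. Qed.

Lemma is_derive_asinh (u : R) : is_derive u (1 : R) asinh (Num.sqrt (1 + u ^+ 2))^-1.
Proof.
have s0 := sqrt1D_gt0 u; have a0 := asinh_arg_gt0 u.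
have s1 : 0 < 1 + u ^+ 2 by rewrite ltr_pwDl// sqr_ge0.
have D1 : is_derive u (1 : R) (fun v : R => 1 + v ^+ 2) (2 * u).
  have := is_deriveD (is_derive_cst (1 : R) u (1 : R)) (is_deriveX 2 (is_derive_id u (1 : R))).
  move=> /is_derive_eq; apply.
  by rewrite add0r /GRing.scale/= expr1 mulr1.
have D2 : is_derive u (1 : R) (fun v : R => Num.sqrt (1 + v ^+ 2)) (u / Num.sqrt (1 + u ^+ 2)).
  have := @is_derive1_comp _ Num.sqrt (fun v : R => 1 + v ^+ 2) u _ _ (is_derive1_sqrt s1) D1.
  move=> /is_derive_eq; apply; field; exact: lt0r_neq0.
have D3 := is_deriveD (is_derive_id u (1 : R)) D2.
have := @is_derive1_comp _ (@ln R) _ u _ _ (is_derive1_ln a0) D3.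
move=> /is_derive_eq; apply; field; apply/andP; split; exact: lt0r_neq0.
Qed.

(** The lower bound follows from the upper one by conjugation: the inverse of [u + sqrt (1 + u ^ 2)]
    is [sqrt (1 + u ^ 2) - u]. *)
Lemma asinh_le (u : R) : `|asinh u| <= ln (1 + 2 * `|u|).
Proof.
have s0 := sqrt1D_gt0 u; have a0 := asinh_arg_gt0 u; have sl := sqrt1D_le u.
have un := ler_norm u; have un' : - u <= `|u| by rewrite -normrN ler_norm.
have nu := normr_ge0 u.
have p1 : 0 < 1 + 2 * `|u| by lra.
rewrite ler_norml; apply/andP; split.
  rewrite -lnV ?posrE// ler_ln ?posrE ?invr_gt0//.
  rewrite invf_ple ?posrE//.
  have -> : (u + Num.sqrt (1 + u ^+ 2))^-1 = Num.sqrt (1 + u ^+ 2) - u.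
    apply: (mulfI (lt0r_neq0 a0)); rewrite mulfV ?lt0r_neq0//.
    have := sqr_sqrt1D u; move: (Num.sqrt _) => s E.
    have -> : (u + s) * (s - u) = s ^+ 2 - u ^+ 2 by ring.
    by rewrite E; ring.
  by move: s0 sl un un' nu; move: (Num.sqrt _) `|u| => s v *; lra.
by rewrite ler_ln ?posrE//; move: s0 sl un un' nu; move: (Num.sqrt _) `|u| => s v *; lra.
Qed.

End TotalVariation.

(** * Integrals bounded by a logarithm of the frequency *)

Section LogIntegrals.
Variables (R : realType) (n : nat) (T : R).
Hypothesis T_gt0 : 0 < T.

Local Notation K := ((R * 'rV[R]_n)%type -> R).
Implicit Types (g h H : K) (p : R * 'rV[R]_n) (xi : 'rV[R]_n).
Local Notation dom := (@dom R n T).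
Local Notation mu := (@lebesgue_measure R).

Definition log_integrable H := exists2 C, 0 < C & forall xi, 1 <= euclid_norm xi ->
  (\int[mu]_(t in `]0%R, T[) (H (t, xi))%:E <= (C * ln (1 + euclid_norm xi))%:E)%E.

Lemma tcontinuous_measurable H xi : tcontinuous T H -> 1 <= euclid_norm xi ->
  measurable_fun `]0%R, T[ (EFin \o (fun t => H (t, xi))).
Proof. by move=> cH x1; apply: itv_continuous_measurable => t tT; exact: cH. Qed.

Lemma log_integrableD g h : tcontinuous T g -> tcontinuous T h ->
  (forall p, dom p -> 0 <= g p) -> (forall p, dom p -> 0 <= h p) ->
  log_integrable g -> log_integrable h -> log_integrable (fun p => g p + h p).
Proof.
move=> cg ch g0 h0 [C C0 HC] [D D0 HD]; exists (C + D); first exact: addr_gt0.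
move=> xi x1; under eq_integral do rewrite EFinD.
rewrite ge0_integralD//; first by rewrite mulrDl EFinD leeD ?HC ?HD.
- by move=> t; rewrite /= in_itv/= => tT; rewrite lee_fin g0.
- exact: tcontinuous_measurable.
- by move=> t; rewrite /= in_itv/= => tT; rewrite lee_fin h0.
- exact: tcontinuous_measurable.
Qed.

Lemma log_integrable_le g h : tcontinuous T g -> tcontinuous T h ->
  (forall p, dom p -> 0 <= g p <= h p) -> log_integrable h -> log_integrable g.
Proof.
move=> cg ch gh [C C0 HC]; exists C => // xi x1; apply: le_trans (HC xi x1).
apply: ge0_le_integral => //.
- by move=> t; rewrite /= in_itv/= => tT; rewrite lee_fin; have [|] := andP (gh (t, xi) _).
- exact: tcontinuous_measurable.
- exact: tcontinuous_measurable.
- by move=> t; rewrite /= in_itv/= => tT; rewrite lee_fin; have [|] := andP (gh (t, xi) _).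
Qed.

(** The closed interval differs from the open one by a null set, and [F] agrees with [H] only
    inside, where the derivatives it contains are meaningful. *)
Lemma log_integrable_bound H (F : R -> 'rV[R]_n -> R) : tcontinuous T H ->
  (forall p, dom p -> F p.1 p.2 = H p) -> log_integrable H -> int_log_bound T F.
Proof.
move=> cH FH [C C0 HC]; exists C, 1; split=> // xi x1.
have E : {in `]0%R, T[%classic, forall t, (F t xi)%:E = (H (t, xi))%:E}.
  by move=> t; rewrite inE/= in_itv/= => tT; rewrite -(FH (t, xi)).
rewrite integral_itv_bndoo; last first.
  by apply: eq_measurable_fun (tcontinuous_measurable cH x1) => t /E.
apply: le_trans (HC xi x1); rewrite le_eqVlt; apply/orP; left; apply/eqP.
by apply: eq_integral => t tT; exact: E.
Qed.

Lemma log_integrable_derive g G : tcontinuous T g ->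
  (forall p, dom p -> is_derive p.1 (1 : R) (fun t => G (t, p.2)) (g p)) ->
  (exists2 C, 0 <= C & forall p, dom p -> `|G p| <= C * ln (1 + euclid_norm p.2)) ->
  (exists N, forall xi, 1 <= euclid_norm xi -> pieces (tzof g xi) N 0 T) ->
  log_integrable (fun p => `|g p|).
Proof.
(* The summand 1 makes the constant positive even when [N] or [C] is 0. *)
move=> cg D [C C0 GC] [N HN]; exists (N%:R * (2 * C) + 1).
  by rewrite ltr_wpDl// !mulr_ge0.
move=> xi x1; have l0 : 0 <= ln (1 + euclid_norm xi).
  by rewrite ln_ge0// lerDl (le_trans _ x1).
apply: (@le_trans _ _ (N%:R * (2 * (C * ln (1 + euclid_norm xi))))%:E).
  apply: (@integral_norm_derive R (fun t => G (t, xi)) (fun t => g (t, xi))) => //.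
  - exact: mulr_ge0.
  - by move=> t tT; apply: (D (t, xi)); split.
  - by move=> t tT; exact: cg.
  - by move=> t tT; apply: (GC (t, xi)); split.
  - exact: HN.
rewrite lee_fin; move: l0; move: (ln _) => z l0.
have -> : (N%:R * (2 * C) + 1) * z = N%:R * (2 * (C * z)) + z by ring.
by rewrite lerDl.
Qed.

Lemma ln_polygrowth g : polygrowth T g ->
  exists2 C, 0 <= C & forall p, dom p -> ln (1 + 2 * `|g p|) <= C * ln (1 + euclid_norm p.2).
Proof.
move=> /polygrowth_nneg[C C0 [k HC]].
have l2 : 0 < ln (2 : R) by rewrite ln_gt0// ltr1n.
have lC : 0 <= ln (1 + 2 * C) by rewrite ln_ge0// lerDl mulr_ge0.
(* From [1 + 2 * |g| <= (1 + 2 * C) * w ^ k] with [w >= 2]: the constant [ln (1 + 2 * C)] is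
   converted into a multiple of [ln w]. *)
exists (ln (1 + 2 * C) / ln 2 + k%:R); first by rewrite addr_ge0// divr_ge0// ltW.
move=> p dp; have w1 := weight_ge1 dp.
have w2 : 2 <= 1 + euclid_norm p.2 by rewrite -[2]/(1 + 1) lerD2l; case: dp.
set w := 1 + euclid_norm p.2 in w1 w2 *.
have w0 : 0 < w by rewrite (lt_le_trans _ w1).
have wk : 1 <= w ^+ k by rewrite exprn_ege1.
apply: (@le_trans _ _ (ln ((1 + 2 * C) * w ^+ k))).
  rewrite ler_ln ?posrE.
  - have h : 2 * `|g p| <= 2 * C * w ^+ k by rewrite -mulrA ler_wpM2l//; exact: HC.
    by rewrite [leRHS]mulrDl mul1r lerD.
  - by rewrite ltr_pwDl// mulr_ge0.
  - by rewrite mulr_gt0 ?exprn_gt0// ltr_pwDl// mulr_ge0.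
rewrite lnM ?posrE ?exprn_gt0//; last by rewrite ltr_pwDl// mulr_ge0.
rewrite lnXn// [leRHS]mulrDl lerD//; last by rewrite mulr_natl.
rewrite mulrAC ler_pdivlMr// ler_wpM2l// ler_ln ?posrE//.
Qed.

Lemma tcontinuous_norm g : tcontinuous T g -> tcontinuous T (fun p => `|g p|).
Proof. by move=> cg t xi tT x1; apply: continuous_norm; exact: cg. Qed.

(** The integrands are [dt g] times a factor such as [1 / sqrt (1 + g ^ 2)]. A factor without zeros
    leaves the zero pattern unchanged, so integrality is asked of [dt g] alone. *)
Lemma pieces_mul_free g s : (forall p, dom p -> s p != 0) ->
  (exists N, forall xi, 1 <= euclid_norm xi -> pieces (tzof g xi) N 0 T) ->
  exists N, forall xi, 1 <= euclid_norm xi -> pieces (tzof (fun p => g p * s p) xi) N 0 T.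
Proof.
move=> s0 [N HN]; exists N => xi x1; apply: (pieces_impl (HN xi x1) (ltW T_gt0)).
move=> x y x0 xy yT [H|H]; [left|right] => t txy; rewrite ?mulf_neq0 ?H ?mul0r//.
have [xt ty] := andP txy.
by apply: s0; split=> //=; rewrite (le_lt_trans x0)//= (lt_le_trans ty).
Qed.

Lemma smooth1_dt g : smooth T 1 g -> [/\ basic T (dt g), tcontinuous T g & polygrowth T g].
Proof. by move=> [[_ pg cg] [_ [bdt _]]]. Qed.

(** The integrand is dominated by the absolute derivative of [asinh] of [g], since
    [sqrt (1 + g ^ 2) <= 1 + |g|]; its sign changes are those of [dt g]. *)
Lemma log_integrable_quot g : smooth T 1 g ->
  log_integrable (fun p => `|dt g p| / (`|g p| + 1)).
Proof.
move=> sg; have [[adt _ cdt] cg pg] := smooth1_dt sg.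
pose s p := (Num.sqrt (1 + g p ^+ 2))^-1.
have s0 p : 0 < s p by rewrite invr_gt0 sqrt1D_gt0.
have cs : tcontinuous T s.
  apply: tcontinuousV; first by move=> p _; rewrite gt_eqF// sqrt1D_gt0.
  move=> t xi tT x1; apply: continuous_comp; last exact: sqrt_continuous.
  have : tcontinuous T (fun p => cst 1 p + g p ^+ 2).
    by apply: tcontinuousD; [exact: tcontinuous_cst|exact: tcontinuous_exp].
  by apply.
have c1 : tcontinuous T (fun p => `|dt g p| / (`|g p| + 1)).
  apply: tcontinuousM; first exact: tcontinuous_norm.
  apply: tcontinuousV; first by move=> p _; rewrite gt_eqF// ltr_wpDl.
  by apply: tcontinuousD; [exact: tcontinuous_norm|exact: tcontinuous_cst].
apply: (log_integrable_le (h := fun p => `|dt g p * s p|)) => //.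
- by apply: tcontinuous_norm; exact: tcontinuousM.
- move=> p dp; rewrite divr_ge0 ?addr_ge0//= normrM ler_wpM2l//.
  rewrite (gtr0_norm (s0 p)) /s lef_pV2 ?posrE ?sqrt1D_gt0 ?ltr_wpDl//.
  by rewrite [leRHS]addrC sqrt1D_le.
apply: (@log_integrable_derive (fun p => dt g p * s p) (fun p => asinh (g p))).
- exact: tcontinuousM.
- move=> p dp; have D := smooth_is_derive sg dp.
  have := @is_derive1_comp _ (@asinh R) (fun t => g (t, p.2)) p.1 _ _ (is_derive_asinh _) D.
  by rewrite -surjective_pairing mulrC; apply.
- have [C C0 HC] := ln_polygrowth pg; exists C => // p dp.
  exact: le_trans (asinh_le _) (HC p dp).
- apply: pieces_mul_free; first by move=> p _; rewrite gt_eqF.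
  by apply: alg_pieces => //; exact: ltW.
Qed.

(** No [+ 1] protects the denominator: the growth of [1 / g] is what bounds the primitive [ln g]
    from below. *)
Lemma log_integrable_logderiv g : smooth T 1 g -> (forall p, dom p -> 0 < g p) ->
  polygrowth T (fun p => (g p)^-1) ->
  log_integrable (fun p => `|dt g p| / `|g p|).
Proof.
move=> sg g0 pV; have [[adt _ cdt] cg pg] := smooth1_dt sg.
have cV : tcontinuous T (fun p => (g p)^-1).
  by apply: tcontinuousV => // p /g0; rewrite lt0r => /andP[].
have gn p : dom p -> g p != 0 by move=> /g0; rewrite lt0r => /andP[].
apply: (log_integrable_le (h := fun p => `|dt g p * (g p)^-1|)).
- apply: tcontinuousM; first exact: tcontinuous_norm.
  apply: tcontinuousV; last exact: tcontinuous_norm.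
  by move=> p /gn; rewrite normr_eq0.
- by apply: tcontinuous_norm; exact: tcontinuousM.
- by move=> p dp; rewrite normrM normfV lexx andbT divr_ge0.
apply: (@log_integrable_derive (fun p => dt g p * (g p)^-1) (fun p => ln (g p))).
- exact: tcontinuousM.
- move=> p dp; have D := smooth_is_derive sg dp.
  have gp : 0 < g (p.1, p.2) by rewrite -surjective_pairing; exact: g0.
  have := @is_derive1_comp _ (@ln R) (fun t => g (t, p.2)) p.1 _ _ (is_derive1_ln gp) D.
  by rewrite -surjective_pairing mulrC; apply.
- have [C C0 HC] := ln_polygrowth pg; have [D D0 HD] := ln_polygrowth pV.
  exists (C + D); first exact: addr_ge0.
  move=> p dp; have gp := g0 p dp; have gpV : 0 < (g p)^-1 by rewrite invr_gt0.
  have w0 : 0 <= ln (1 + euclid_norm p.2) by rewrite ln_ge0// (weight_ge1 dp).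
  have up (u : R) : 0 < u -> ln u <= ln (1 + 2 * `|u|).
    by move=> u0; rewrite gtr0_norm// ler_ln ?posrE//; lra.
  rewrite mulrDl ler_norml; apply/andP; split.
    rewrite lerNl -lnV ?posrE// (le_trans (up _ gpV))// (le_trans (HD p dp))//.
    by rewrite lerDr mulr_ge0.
  by rewrite (le_trans (up _ gp))// (le_trans (HC p dp))// lerDl mulr_ge0.
- apply: pieces_mul_free; first by move=> p /gn; rewrite invr_eq0.
  by apply: alg_pieces => //; exact: ltW.
Qed.

End LogIntegrals.

(** * The symbols *)

Section DerivedClasses.
Variables (R : realType) (n : nat) (T : R).
Hypothesis T_gt0 : 0 < T.

Local Notation K := ((R * 'rV[R]_n)%type -> R).
Implicit Types (g h H : K) (p : R * 'rV[R]_n) (xi : 'rV[R]_n).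
Local Notation dom := (@dom R n T).
Local Notation mu := (@lebesgue_measure R).
Local Notation smooth := (smooth T).

(** Continuity (for measurability) and nonnegativity accompany the bound because additivity of the
    integral uses both. *)
Definition log_controlled H := [/\ tcontinuous T H, forall p, dom p -> 0 <= H p &
  log_integrable T H].

Lemma log_controlled_sum (I : eqType) (s : seq I) (F : I -> K) :
  (forall i, i \in s -> log_controlled (F i)) ->
  log_controlled (fun p => \sum_(i <- s) F i p).
Proof.
elim: s => [_|i s IH HF].
  have -> : (fun p => \sum_(i <- [::]) F i p) = cst 0 by apply/funext => p; rewrite big_nil.
  split=> //; first exact: tcontinuous_cst.
  exists 1 => // xi x1; rewrite (eq_integral (cst 0%E)) ?integral0// lee_fin mul1r ln_ge0//.
  by rewrite lerDl (le_trans _ x1).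
have -> : (fun p => \sum_(i <- i :: s) F i p) = fun p => F i p + \sum_(i <- s) F i p.
  by apply/funext => p; rewrite big_cons.
have [cs ps ls] : log_controlled (fun p => \sum_(i <- s) F i p).
  by apply: IH => j js; apply: HF; rewrite inE js orbT.
have [ci pi li] := HF i (mem_head i s); split.
- exact: tcontinuousD.
- by move=> p dp; rewrite addr_ge0 ?pi ?ps.
- exact: log_integrableD.
Qed.

Lemma log_controlled_int H (F : R -> 'rV[R]_n -> R) : log_controlled H ->
  (forall p, dom p -> F p.1 p.2 = H p) -> int_log_bound T F.
Proof. by move=> [cH _ lH] FH; exact: log_integrable_bound cH FH lH. Qed.

Lemma dt_affine (c e e' : R) g g' p : smooth 1 g -> smooth 1 g' -> dom p ->
  dt (fun p => c + e * g p + e' * g' p) p = e * dt g p + e' * dt g' p.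
Proof.
move=> sg sg' dp; rewrite /dt; apply: is_derive_derive1.
have := is_deriveD (is_deriveD (is_derive_cst c p.1 (1 : R))
  (is_deriveZ e (smooth_is_derive sg dp))) (is_deriveZ e' (smooth_is_derive sg' dp)).
by rewrite add0r; apply.
Qed.

Lemma smoothZ k (c : R) g : smooth k g -> smooth k (fun p => c * g p).
Proof. by move=> sg; exact: smoothM (smooth_cst n T k c) sg. Qed.

Lemma dt_sub g h p : smooth 1 g -> smooth 1 h -> dom p ->
  dt (fun p => g p - h p) p = dt g p - dt h p.
Proof.
move=> sg sh dp; have := dt_affine 0 1 (-1) sg sh dp.
rewrite mul1r mulN1r => <-; congr (dt _ p); apply/funext => q.
by rewrite add0r mul1r mulN1r.
Qed.

Lemma smoothB k g h : smooth k g -> smooth k h -> smooth k (fun p => g p - h p).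
Proof.
move=> sg sh; apply: (smooth_ext (g := fun p => g p + (-1) * h p)).
  by move=> p _; rewrite mulN1r.
by apply: smoothD => //; exact: smoothZ.
Qed.

Lemma smooth_tcontinuous k g : smooth k g -> tcontinuous T g.
Proof. by move=> /smooth_basic[]. Qed.

Lemma log_controlled_gap_ratio g h : (forall k, smooth k g) -> (forall k, smooth k h) ->
  (forall p, dom p -> g p < h p) -> polygrowth T (fun p => (g p - h p)^-1) ->
  log_controlled (fun p => `|dt g p - dt h p| / `|g p - h p|).
Proof.
move=> sg sh gh pgh.
have gn p : dom p -> g p - h p != 0 by move=> /gh ?; rewrite subr_eq0 lt_eqF.
have cH : tcontinuous T (fun p => `|dt g p - dt h p| / `|g p - h p|).
  apply: tcontinuousM.
    apply: tcontinuous_norm; apply: (@smooth_tcontinuous 0).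
    by apply: smoothB; exact: smooth_dt.
  apply: tcontinuousV; first by move=> p /gn; rewrite normr_eq0.
  by apply: tcontinuous_norm; apply: (@smooth_tcontinuous 0); exact: smoothB.
split; [exact: cH|by move=> p _; rewrite divr_ge0|].
have := @log_integrable_logderiv R n T T_gt0 (fun p => h p - g p) (smoothB (sh 1%N) (sg 1%N)).
have pos p : dom p -> 0 < h p - g p by move=> /gh; rewrite subr_gt0.
have pV : polygrowth T (fun p => (h p - g p)^-1).
  by apply: polygrowth_le pgh => p _; rewrite -opprB invrN normrN.
move=> /(_ pos pV); apply: log_integrable_le => //.
  apply: tcontinuousM.
    apply: tcontinuous_norm; apply: (@smooth_tcontinuous 0).
    by apply: smooth_dt => k; exact: smoothB.
  apply: tcontinuousV; first by move=> p /gn; rewrite normr_eq0 -opprB oppr_eq0.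
  by apply: tcontinuous_norm; apply: (@smooth_tcontinuous 0); exact: smoothB.
move=> p dp; rewrite divr_ge0//= dt_sub//.
by rewrite [in leRHS](distrC (dt h p)) [in leRHS](distrC (h p)).
Qed.

Lemma log_controlled_quot g : (forall k, smooth k g) ->
  log_controlled (fun p => `|dt g p| / (`|g p| + 1)).
Proof.
move=> sg; split; last exact: log_integrable_quot.
- apply: tcontinuousM; first by apply: tcontinuous_norm; apply: (@smooth_tcontinuous 0); exact: smooth_dt.
  apply: tcontinuousV; first by move=> p _; rewrite gt_eqF// ltr_wpDl.
  apply: tcontinuousD; last exact: tcontinuous_cst.
  by apply: tcontinuous_norm; exact: smooth_tcontinuous (sg 0%N).
- by move=> p _; rewrite divr_ge0// addr_ge0.
Qed.

Lemma hypot_le (x y : R) : Num.sqrt (x ^+ 2 + y ^+ 2) <= `|x| + `|y|.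
Proof.
rewrite -[leRHS]ger0_norm ?addr_ge0// -sqrtr_sqr ler_sqrt ?sqr_ge0//.
rewrite -(real_normK (num_real x)) -(real_normK (num_real y)) sqrrD.
by rewrite lerD2r lerDl mulrn_wge0// mulr_ge0.
Qed.

Lemma hypot_gel (x y : R) : `|x| <= Num.sqrt (x ^+ 2 + y ^+ 2).
Proof. by rewrite -sqrtr_sqr ler_sqrt ?addr_ge0 ?sqr_ge0// lerDl sqr_ge0. Qed.

Lemma hypot_ger (x y : R) : `|y| <= Num.sqrt (x ^+ 2 + y ^+ 2).
Proof. by rewrite addrC hypot_gel. Qed.

Lemma tcontinuous_hypot g h : tcontinuous T g -> tcontinuous T h ->
  tcontinuous T (fun p => Num.sqrt (g p ^+ 2 + h p ^+ 2)).
Proof.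
move=> cg ch t xi tT x1; apply: continuous_comp; last exact: sqrt_continuous.
have : tcontinuous T (fun p => g p ^+ 2 + h p ^+ 2).
  by apply: tcontinuousD; exact: tcontinuous_exp.
by apply.
Qed.

(** The modulus of the derivative is at most the sum of the moduli of its two parts, and the modulus
    in the denominator is at least that of either part, so the quotient splits into two real
    ones. *)
Lemma log_controlled_complex g h : (forall k, smooth k g) -> (forall k, smooth k h) ->
  log_controlled (fun p => Num.sqrt (dt g p ^+ 2 + dt h p ^+ 2)
    / (Num.sqrt (g p ^+ 2 + h p ^+ 2) + 1)).
Proof.
move=> sg sh.
have cdt (u : K) : (forall k, smooth k u) -> tcontinuous T (dt u).
  by move=> sk; apply: (@smooth_tcontinuous 0); exact: smooth_dt.
have [cg pg lg] := log_controlled_quot sg; have [ch ph lh] := log_controlled_quot sh.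
have cH : tcontinuous T (fun p => Num.sqrt (dt g p ^+ 2 + dt h p ^+ 2)
    / (Num.sqrt (g p ^+ 2 + h p ^+ 2) + 1)).
  apply: tcontinuousM; first by apply: tcontinuous_hypot; exact: cdt.
  apply: tcontinuousV; first by move=> p _; rewrite gt_eqF// ltr_wpDl// sqrtr_ge0.
  apply: tcontinuousD; last exact: tcontinuous_cst.
  by apply: tcontinuous_hypot; [exact: smooth_tcontinuous (sg 0%N)|exact: smooth_tcontinuous (sh 0%N)].
have pos p : 0 < Num.sqrt (g p ^+ 2 + h p ^+ 2) + 1 by rewrite ltr_wpDl// sqrtr_ge0.
split; [exact: cH|by move=> p _; rewrite divr_ge0 ?sqrtr_ge0// ltW|].
apply: (log_integrable_le _ _ _ (log_integrableD cg ch pg ph lg lh)) => //.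
  exact: tcontinuousD.
move=> p _; rewrite divr_ge0 ?sqrtr_ge0 ?(ltW (pos p))//=.
apply: (@le_trans _ _ ((`|dt g p| + `|dt h p|) / (Num.sqrt (g p ^+ 2 + h p ^+ 2) + 1))).
  by rewrite ler_wpM2r ?invr_ge0 ?(ltW (pos p))// hypot_le.
rewrite mulrDl lerD// ler_wpM2l// lef_pV2 ?posrE ?ltr_wpDl ?sqrtr_ge0//.
  by rewrite lerD2r hypot_gel.
by rewrite lerD2r hypot_ger.
Qed.

End DerivedClasses.

(** * Real and imaginary parts of the symbols and of the corrected lower order terms *)

Section SymbolCoefficients.
Variables (R : realType) (T : R) (n : nat) (a : coefficients R n).
Hypothesis T_gt0 : 0 < T.

Local Notation K := ((R * 'rV[R]_n)%type -> R).
Implicit Types (g h : K) (p : R * 'rV[R]_n) (xi : 'rV[R]_n).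
Local Notation dom := (@dom R n T).
Local Notation smooth := (smooth T).

Definition symcoef (d : nat) (j : 'I_3) (t : R) xi : R[i] :=
  \sum_(alpha : multiindex n | (j + mdeg alpha == d)%N) a j alpha t * (monom xi alpha)%:C.

Definition partcoef (f : R[i] -> R) (d : nat) (j : 'I_3) : K :=
  fun p => \sum_(alpha : multiindex n | (j + mdeg alpha == d)%N)
     f (a j alpha p.1) * monom p.2 alpha.

Local Notation o0 := (inord 0 : 'I_3).
Local Notation o1 := (inord 1 : 'I_3).
Local Notation o2 := (inord 2 : 'I_3).

Lemma sum_ord3 (V : nmodType) (F : 'I_3 -> V) : \sum_(j < 3) F j = F o0 + F o1 + F o2.
Proof.
rewrite !big_ord_recl big_ord0 addr0 addrA; congr (F _ + F _ + F _);
by apply: val_inj; rewrite /= inordK.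
Qed.

Lemma symbol_partE d t xi : symbol_part a d t xi =
  (symcoef d o0 t xi)%:P + symcoef d o1 t xi *: 'X + symcoef d o2 t xi *: 'X^2.
Proof.
rewrite /symbol_part sum_ord3 -!scaler_suml.
have -> : 'X^o0 = 1 :> {poly R[i]} by rewrite inordK.
have -> : 'X^o1 = 'X :> {poly R[i]} by rewrite inordK.
have -> : 'X^o2 = 'X^2 :> {poly R[i]} by rewrite inordK.
by rewrite alg_polyC.
Qed.

Lemma monom_polygrowth alpha : polygrowth T (fun p => monom p.2 alpha).
Proof.
exists 1, (mdeg alpha) => p dp; rewrite mul1r /monom /mdeg normr_prod expr_sum.
apply: ler_prod => i _; rewrite normr_ge0 normrX/= lerXn2r ?nnegrE//.
  by rewrite (le_trans _ (weight_ge1 dp)).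
apply: (@le_trans _ _ (euclid_norm p.2)); last by rewrite lerDr.
rewrite /euclid_norm -sqrtr_sqr ler_sqrt; last by rewrite sumr_ge0// => k _; exact: sqr_ge0.
by rewrite (bigD1 i)//= lerDl sumr_ge0// => k _; exact: sqr_ge0.
Qed.

(* The two instances are the real and the imaginary part. *)
Variable f : R[i] -> R.
Hypothesis f_add : forall x y, f (x + y) = f x + f y.
Hypothesis f_mulr : forall x (r : R), f (x * r%:C) = f x * r.
Hypothesis f_analytic : forall (j : 'I_3) alpha, (j + mdeg alpha <= 3)%N ->
  analytic_on T (fun t => f (a j alpha t)).
Hypothesis f_derive : forall F t, f (derive1C F t) = derive1 (fun s => f (F s)) t.

Lemma part0 : f 0 = 0.
Proof. by have := f_mulr 0 0; rewrite mul0r mulr0. Qed.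

Lemma part_sub x y : f (x - y) = f x - f y.
Proof.
have -> : - y = y * (-1)%:C by rewrite rmorphN1 mulrN1.
by rewrite f_add f_mulr mulrN1.
Qed.

Lemma part_symcoef d j t xi : f (symcoef d j t xi) = partcoef f d j (t, xi).
Proof.
rewrite /symcoef /partcoef /= (big_morph f f_add part0).
by apply: eq_bigr => alpha _; rewrite f_mulr.
Qed.

Lemma partcoef_smooth d j k : (d <= 3)%N -> smooth k (partcoef f d j).
Proof.
move=> d3; apply: smooth_sum => alpha /eqP jd.
apply: (@smooth_analytic_mul R n T T_gt0 (fun t => f (a j alpha t)) (fun xi => monom xi alpha)).
  by apply: f_analytic; rewrite jd.
exact: monom_polygrowth.
Qed.

Lemma partcoef_tfrac d j : (d <= 3)%N -> tfrac T (partcoef f d j).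
Proof.
move=> d3; rewrite /partcoef; elim: (index_enum _) => [|alpha s IH].
  by apply: tfrac_ext (@tfrac_cst R n T 0) => p _; rewrite big_nil.
have [/eqP jd|jd] := boolP (j + mdeg alpha == d)%N; last first.
  by apply: tfrac_ext IH => p _; rewrite big_cons (negbTE jd).
apply: (tfrac_ext (g := fun p => f (a j alpha p.1) * monom p.2 alpha +
   \sum_(alpha <- s | (j + mdeg alpha == d)%N) f (a j alpha p.1) * monom p.2 alpha)).
  by move=> p _; rewrite big_cons jd eqxx.
apply: tfracD => //; apply: tensor_frac.
apply: (@tensor_prod R n T (fun t => f (a j alpha t)) (fun xi => monom xi alpha)).
by apply: f_analytic; rewrite jd.
Qed.

Lemma part_horner2 (c0 c1 c2 : R[i]) (x : R) :
  f (c0%:P + c1 *: 'X + c2 *: 'X^2).[x%:C] = f c0 + f c1 * x + f c2 * x ^+ 2.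
Proof. by rewrite !hornerD hornerC !hornerZ hornerX hornerXn -rmorphXn !f_add !f_mulr. Qed.

Lemma part_symbol_part d t xi (x : R) : f (symbol_part a d t xi).[x%:C] =
  partcoef f d o0 (t, xi) + partcoef f d o1 (t, xi) * x + partcoef f d o2 (t, xi) * x ^+ 2.
Proof. by rewrite symbol_partE part_horner2 !part_symcoef. Qed.

Lemma part_deriv_symbol_part d t xi (x : R) : f (symbol_part a d t xi)^`().[x%:C] =
  partcoef f d o1 (t, xi) + 2 * partcoef f d o2 (t, xi) * x.
Proof.
rewrite symbol_partE !derivD derivC !derivZ derivX derivXn add0r expr1.
rewrite hornerD !hornerZ hornerMn hornerX -[1]/(1%:P) hornerC mulr1.
have -> : symcoef d o1 t xi + symcoef d o2 t xi * (x%:C *+ 2) =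
   symcoef d o1 t xi + symcoef d o2 t xi * (x *+ 2)%:C by rewrite rmorphMn.
by rewrite f_add f_mulr !part_symcoef -mulr_natl; ring.
Qed.

Lemma symL_deriv t xi (z : R[i]) :
  (symL a t xi)^`().[z] = 3%:R * z ^+ 2 + (symbol_part a 3 t xi)^`().[z].
Proof. by rewrite /symL derivD derivXn hornerD hornerMn hornerXn mulr_natl. Qed.

Lemma symL_deriv2P t xi :
  (symL a t xi)^`(2) = 6%:R *: 'X + (2%:R * symcoef 3 o2 t xi)%:P.
Proof.
apply/polyP => i; rewrite !derivnS derivn0 !coef_deriv /symL symbol_partE.
rewrite !coefD !coefC !coefZ !coefX !coefXn.
by case: i => [|[|i]] /=; ring.
Qed.

Lemma symL_deriv2 t xi (z : R[i]) :
  (symL a t xi)^`(2).[z] = 6%:R * z + 2%:R * symcoef 3 o2 t xi.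
Proof. by rewrite symL_deriv2P hornerD hornerZ hornerX hornerC. Qed.

(** The derivative inside [checkM] is partial in [t]: [tau] is frozen at [x], so the contribution of
    [tau ^ 3] is constant and drops out. *)
Lemma part_checkM t xi (x : R) : dom (t, xi) -> f (checkM a t x%:C xi) =
  partcoef f 2 o0 (t, xi) + partcoef f 2 o1 (t, xi) * x + partcoef f 2 o2 (t, xi) * x ^+ 2
  - 2^-1 * (dt (partcoef f 3 o1) (t, xi) + 2 * x * dt (partcoef f 3 o2) (t, xi)).
Proof.
move=> dp; rewrite /checkM part_sub part_symbol_part; congr (_ - _).
have -> : (2%:R^-1 : R[i]) = (2^-1 : R)%:C by rewrite fmorphV rmorph_nat.
rewrite mulrC f_mulr f_derive mulrC; congr (_ * _).
have -> : (fun s => f (symL a s xi)^`().[x%:C]) = fun s =>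
    f (3%:R * x%:C ^+ 2) + 1 * partcoef f 3 o1 (s, xi) + (2 * x) * partcoef f 3 o2 (s, xi).
  by apply/funext => s; rewrite symL_deriv f_add part_deriv_symbol_part; ring.
have := @dt_affine R n T (f (3%:R * x%:C ^+ 2)) 1 (2 * x) _ _ (t, xi)
  (@partcoef_smooth 3 o1 1 isT) (@partcoef_smooth 3 o2 1 isT) dp.
by rewrite /dt /= mul1r.
Qed.

Lemma part_checkN t xi (x : R) : dom (t, xi) -> f (checkN a t x%:C xi) =
  partcoef f 1 o0 (t, xi) + partcoef f 1 o1 (t, xi) * x + partcoef f 1 o2 (t, xi) * x ^+ 2
  - 2^-1 * (dt (partcoef f 2 o1) (t, xi) + 2 * x * dt (partcoef f 2 o2) (t, xi))
  + 12^-1 * (2 * dt (dt (partcoef f 3 o2)) (t, xi)).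
Proof.
move=> dp; rewrite /checkN f_add part_sub part_symbol_part; congr (_ - _ + _).
  have -> : (2%:R^-1 : R[i]) = (2^-1 : R)%:C by rewrite fmorphV rmorph_nat.
  rewrite mulrC f_mulr f_derive mulrC; congr (_ * _).
  have -> : (fun s => f (symM a s xi)^`().[x%:C]) = fun s =>
      0 + 1 * partcoef f 2 o1 (s, xi) + (2 * x) * partcoef f 2 o2 (s, xi).
    by apply/funext => s; rewrite part_deriv_symbol_part; ring.
  have := @dt_affine R n T 0 1 (2 * x) _ _ (t, xi)
    (@partcoef_smooth 2 o1 1 isT) (@partcoef_smooth 2 o2 1 isT) dp.
  by rewrite /dt /= mul1r.
have -> : (12%:R^-1 : R[i]) = (12^-1 : R)%:C by rewrite fmorphV rmorph_nat.
rewrite mulrC f_mulr f_derive mulrC; congr (_ * _).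
pose g : K := partcoef f 3 o2.
have sg k : smooth k g by exact: partcoef_smooth.
(* The summand [0 * g p] only gives [h] the three-term shape of [dt_affine]. *)
pose h : K := fun p => f (6%:R * x%:C) + 2 * g p + 0 * g p.
have -> : (fun s => f (derive1C (fun s0 => (symL a s0 xi)^`(2).[x%:C]) s)) =
    fun s => dt h (s, xi).
  apply/funext => s; rewrite f_derive /dt /=; congr (derive1 _ s).
  apply/funext => r; rewrite symL_deriv2 f_add /h mul0r addr0; congr (_ + _).
  have -> : (2%:R : R[i]) = (2 : R)%:C by rewrite rmorph_nat.
  by rewrite mulrC f_mulr part_symcoef mulrC.
rewrite -[LHS]/(dt (dt h) (t, xi)).
have dh p : dom p -> dt h p = 0 + 2 * dt g p + 0 * dt g p.
  by move=> dp'; rewrite (dt_affine _ _ _ (sg 1%N) (sg 1%N) dp') add0r.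
rewrite (dt_ext dh dp) (@dt_affine R n T) ?mul0r ?addr0//; exact: smooth_dt.
Qed.

Lemma part_checkM_smooth (l : R -> 'rV[R]_n -> R) k :
  (forall k, smooth k (fun p => l p.1 p.2)) ->
  smooth k (fun p => f (checkM a p.1 (l p.1 p.2)%:C p.2)).
Proof.
move=> sl; apply: (smooth_ext (g := fun p =>
  partcoef f 2 o0 p + partcoef f 2 o1 p * l p.1 p.2 + partcoef f 2 o2 p * (l p.1 p.2) ^+ 2
  + (- 2^-1) * (dt (partcoef f 3 o1) p + 2 * (l p.1 p.2 * dt (partcoef f 3 o2) p)))).
  by move=> [t xi] dp; rewrite part_checkM//=; ring.
have sd j k' : smooth k' (dt (partcoef f 3 j)).
  by apply: smooth_dt => k''; exact: partcoef_smooth.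
apply: smoothD.
  apply: smoothD; [apply: smoothD|]; do ?exact: partcoef_smooth.
    by apply: smoothM => //; exact: partcoef_smooth.
  by apply: smoothM; [exact: partcoef_smooth|exact: (@smoothX R n T k (fun p => l p.1 p.2))].
by apply: smoothZ; apply: smoothD => //; apply: smoothZ; exact: smoothM.
Qed.

Lemma part_checkN_smooth (l : R -> 'rV[R]_n -> R) k :
  (forall k, smooth k (fun p => l p.1 p.2)) ->
  smooth k (fun p => f (checkN a p.1 (l p.1 p.2)%:C p.2)).
Proof.
move=> sl; apply: (smooth_ext (g := fun p =>
  partcoef f 1 o0 p + partcoef f 1 o1 p * l p.1 p.2 + partcoef f 1 o2 p * (l p.1 p.2) ^+ 2
  + (- 2^-1) * (dt (partcoef f 2 o1) p + 2 * (l p.1 p.2 * dt (partcoef f 2 o2) p))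
  + (12^-1 * 2) * dt (dt (partcoef f 3 o2)) p)).
  by move=> [t xi] dp; rewrite part_checkN//=; ring.
have sd d j k' : (d <= 3)%N -> smooth k' (dt (partcoef f d j)).
  by move=> d3; apply: smooth_dt => k''; exact: partcoef_smooth.
apply: smoothD; last by apply: smoothZ; apply: smooth_dt => k'; exact: sd.
apply: smoothD.
  apply: smoothD; [apply: smoothD|]; do ?exact: partcoef_smooth.
    by apply: smoothM => //; exact: partcoef_smooth.
  by apply: smoothM; [exact: partcoef_smooth|exact: (@smoothX R n T k (fun p => l p.1 p.2))].
apply: smoothZ; apply: smoothD; first exact: sd.
by apply: smoothZ; apply: smoothM => //; exact: sd.
Qed.

End SymbolCoefficients.

(** * Factorization of real-rooted polynomials *)

Section RealRootedPolynomials.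
Variable R : realType.
Implicit Types (p : {poly R[i]}).

(** The strict order makes the [m] roots distinct, and a polynomial of degree [m] has no room for
    further factors. *)
Lemma ordered_roots_factor m p (r : 'I_m -> R) (x : R) : size p = m.+1 -> ordered_roots p r ->
  p.[x%:C] = lead_coef p * (\prod_(j < m) (x - r j))%:C.
Proof.
move=> sp [rlt rP].
pose rs := [seq (r j)%:C | j <- enum 'I_m].
have srs : size p = (size rs).+1 by rewrite size_map size_enum_ord.
have rinj : injective (fun j => (r j)%:C : R[i]).
  move=> j k [jk]; apply: val_inj; case: (ltngtP j k) => // h.
    by have := rlt _ _ h; rewrite jk ltxx.
  by have := rlt _ _ h; rewrite jk ltxx.
rewrite {1}(all_roots_prod_XsubC srs).
- rewrite hornerZ big_map big_enum/= horner_prod rmorph_prod; congr (_ * _).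
  by apply: eq_bigr => j _; rewrite hornerXsubC rmorphB.
- by apply/allP => _ /mapP[j _ ->]; apply/rP; exists j.
- by rewrite uniq_rootsE map_inj_uniq// enum_uniq.
Qed.

Lemma real_complex_Re (z : R[i]) : z \is Num.real -> z = (complex.Re z)%:C.
Proof.
case: z => u v zr.
have v0 : v = 0 := congr1 (@complex.Re R) (RIm_real zr).
by rewrite v0.
Qed.

(** [R[i]] is algebraically closed, so the polynomial splits. The roots of [L] may coincide, hence a
    list with repetitions instead of a strictly ordered family. *)
Lemma real_rooted_factor p m : size p = m.+1 ->
  (forall z, root p z -> z \is Num.real) ->
  exists2 s : seq R, size s = m & forall x : R,
    p.[x%:C] = lead_coef p * (\prod_(z <- s) (x - z))%:C.
Proof.
move=> sp rp; have [r pE] := closed_field_poly_normal p.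
have l0 : lead_coef p != 0 by rewrite lead_coef_eq0 -size_poly_eq0 sp.
exists [seq complex.Re z | z <- r].
  by move: sp; rewrite pE size_scale// size_prod_XsubC size_map => -[].
move=> x; rewrite {1}pE hornerZ; congr (_ * _).
rewrite horner_prod big_map rmorph_prod !big_seq; apply: eq_bigr => z zr.
rewrite hornerXsubC rmorphB/=; congr (_ - _); apply: real_complex_Re; apply: rp.
by rewrite pE rootZ// root_prod_XsubC.
Qed.

End RealRootedPolynomials.

Lemma ord3_cases (j : 'I_3) : [\/ j = inord 0, j = inord 1 | j = inord 2].
Proof.
case: j => [[|[|[|//]]] lt]; [constructor 1|constructor 2|constructor 3];
by apply: val_inj; rewrite /= inordK.
Qed.

Lemma ord2_cases (j : 'I_2) : j = inord 0 \/ j = inord 1.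
Proof.
by case: j => [[|[|//]] lt]; [left|right]; apply: val_inj; rewrite /= inordK.
Qed.

(** * [L], [calL] and the derivative of [calL] as real polynomials at real [tau] *)

Section CharacteristicPolynomial.
Variables (R : realType) (T : R) (n : nat) (a : coefficients R n).
Local Notation o0 := (inord 0 : 'I_3).
Local Notation o1 := (inord 1 : 'I_3).
Local Notation o2 := (inord 2 : 'I_3).
Local Notation Re := (@complex.Re R).
Local Notation Im := (@complex.Im R).
Implicit Types (xi : 'rV[R]_n).

Lemma Re_add (x y : R[i]) : Re (x + y) = Re x + Re y.
Proof. by case: x; case: y. Qed.

Lemma Im_add (x y : R[i]) : Im (x + y) = Im x + Im y.
Proof. by case: x; case: y. Qed.

Lemma Re_mulr (x : R[i]) (r : R) : Re (x * r%:C) = Re x * r.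
Proof. by case: x => u v /=; rewrite mulr0 subr0. Qed.

Lemma Im_mulr (x : R[i]) (r : R) : Im (x * r%:C) = Im x * r.
Proof. by case: x => u v /=; rewrite mulr0 add0r. Qed.

Lemma size_symbol_part d t xi : (size (symbol_part a d t xi) <= 3)%N.
Proof.
apply/leq_sizeP => j; rewrite symbol_partE !coefD coefC !coefZ coefX coefXn.
by case: j => [|[|[|j]]]//= _; rewrite !mulr0 !addr0.
Qed.

Lemma symL_size t xi : size (symL a t xi) = 4%N.
Proof. by rewrite /symL size_polyDl size_polyXn// ltnS size_symbol_part. Qed.

Lemma symL_lead t xi : lead_coef (symL a t xi) = 1.
Proof. by rewrite /symL lead_coefDl ?lead_coefXn// size_polyXn ltnS size_symbol_part. Qed.

Lemma calL_tail t xi : (size (symbol_part a 3 t xi - (symL a t xi)^`(2))%R < size ('X^3 : {poly R[i]}))%N.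
Proof.
rewrite size_polyXn ltnS; apply/leq_sizeP => j hj; rewrite coefB.
rewrite (leq_sizeP _ _ (size_symbol_part 3 t xi) j hj) symL_deriv2P coefD coefZ coefX coefC.
by case: j hj => [|[|[|j]]]//= _; rewrite mulr0 addr0 subr0.
Qed.

Lemma calLE t xi : calL a t xi = 'X^3 + (symbol_part a 3 t xi - (symL a t xi)^`(2)).
Proof. by rewrite /calL /symL addrA. Qed.

Lemma calL_size t xi : size (calL a t xi) = 4%N.
Proof. by rewrite calLE size_polyDl ?calL_tail// size_polyXn. Qed.

Lemma calL_lead t xi : lead_coef (calL a t xi) = 1.
Proof. by rewrite calLE lead_coefDl ?calL_tail// lead_coefXn. Qed.

Lemma calL_deriv_coef2 t xi : (calL a t xi)^`()`_2 = 3%:R.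
Proof.
have := calL_lead t xi; rewrite lead_coefE calL_size /= => h.
by rewrite coef_deriv h.
Qed.

Lemma calL_deriv_size t xi : size (calL a t xi)^`() = 3%N.
Proof.
apply/eqP; rewrite eqn_leq; apply/andP; split.
  by rewrite -ltnS (leq_trans (lt_size_deriv _))// ?calL_size// -size_poly_eq0 calL_size.
rewrite ltnNge; apply/negP => /leq_sizeP/(_ 2 isT)/eqP.
by rewrite calL_deriv_coef2 pnatr_eq0.
Qed.

Lemma calL_deriv_lead t xi : lead_coef (calL a t xi)^`() = 3%:R.
Proof. by rewrite lead_coefE calL_deriv_size calL_deriv_coef2. Qed.

(** At a real [tau] the factorization over real roots gives a real value, so comparing real parts is
    enough to identify the cubic with the product of its factors. *)
Lemma Re_symL t xi (x : R) : Re (symL a t xi).[x%:C] =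
  x ^+ 3 + partcoef a Re 3 o2 (t, xi) * x ^+ 2 + partcoef a Re 3 o1 (t, xi) * x
  + partcoef a Re 3 o0 (t, xi).
Proof.
rewrite /symL hornerD hornerXn Re_add (part_symbol_part _ Re_add Re_mulr) -rmorphXn /=; ring.
Qed.

Lemma Re_calL t xi (x : R) : Re (calL a t xi).[x%:C] =
  x ^+ 3 + partcoef a Re 3 o2 (t, xi) * x ^+ 2 + (partcoef a Re 3 o1 (t, xi) - 6) * x
  + (partcoef a Re 3 o0 (t, xi) - 2 * partcoef a Re 3 o2 (t, xi)).
Proof.
rewrite /calL hornerD hornerN (part_sub Re_add Re_mulr) Re_symL symL_deriv2 Re_add.
have -> : (6%:R * x%:C : R[i]) = (6 * x)%:C by rewrite rmorphM rmorph_nat.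
have -> : (2%:R * symcoef a 3 o2 t xi : R[i]) = symcoef a 3 o2 t xi * (2 : R)%:C.
  by rewrite rmorph_nat mulrC.
by rewrite Re_mulr (part_symcoef _ Re_add Re_mulr) /=; ring.
Qed.

Lemma Re_calL_deriv t xi (x : R) : Re (calL a t xi)^`().[x%:C] =
  3 * (x ^+ 2 + 2 / 3 * partcoef a Re 3 o2 (t, xi) * x + (partcoef a Re 3 o1 (t, xi) - 6) / 3).
Proof.
have D6 (z : R[i]) : (6%:R *: 'X + z%:P)^`() = (6%:R)%:P :> {poly R[i]}.
  by rewrite derivD derivZ derivX derivC addr0 alg_polyC.
rewrite /calL derivB symL_deriv2P D6 hornerD hornerN hornerC (part_sub Re_add Re_mulr) symL_deriv Re_add.
rewrite (part_deriv_symbol_part _ Re_add Re_mulr).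
have -> : (3%:R * x%:C ^+ 2 : R[i]) = (3 * x ^+ 2)%:C by rewrite rmorphM rmorph_nat rmorphXn.
have -> : (6%:R : R[i]) = (6 : R)%:C by rewrite rmorph_nat.
by rewrite /=; field.
Qed.

Lemma modCE (z : R[i]) : modC z = Num.sqrt (Re z ^+ 2 + Im z ^+ 2).
Proof. by case: z. Qed.

Lemma euclid_norm_neq0 xi : 1 <= euclid_norm xi -> xi != 0.
Proof.
move=> x1; apply/eqP => x0; move: x1; rewrite x0 /euclid_norm big1 ?sqrtr0 ?ler10//.
by move=> i _; rewrite mxE expr0n.
Qed.

End CharacteristicPolynomial.

(** * The four logarithmic bounds for the roots and the lower order terms *)

Theorem mainTheorem2 (R : realType) (T : R) (n : nat) (a : coefficients R n)
    (T_gt0 : 0 < T) (n_gt0 : (0 < n)%N)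
    (a_analytic : forall (j : 'I_3) (alpha : multiindex n),
       (j + mdeg alpha <= 3)%N -> analytic_near `[0, T] (a j alpha))
    (hyperbolic : forall (t : R) (xi : 'rV[R]_n), 0 <= t <= T ->
       forall z : R[i], root (symL a t xi) z -> z \is Num.real)
    (lam : 'I_3 -> R -> 'rV[R]_n -> R)
    (lam_roots : forall (t : R) (xi : 'rV[R]_n), 0 <= t <= T -> xi != 0 ->
       ordered_roots (calL a t xi) (fun j => lam j t xi))
    (mu : 'I_2 -> R -> 'rV[R]_n -> R)
    (mu_roots : forall (t : R) (xi : 'rV[R]_n), 0 <= t <= T -> xi != 0 ->
       ordered_roots (calL a t xi)^`() (fun j => mu j t xi)) :
  [/\ int_log_bound T (fun t xi => \sum_(jk <- S2)
        `|derive1 (lam jk.1 ^~ xi) t - derive1 (lam jk.2 ^~ xi) t|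
        / `|lam jk.1 t xi - lam jk.2 t xi|),
      int_log_bound T (fun t xi => \sum_(jk <- S2)
        `|derive1n 2 (lam jk.1 ^~ xi) t - derive1n 2 (lam jk.2 ^~ xi) t|
        / (`|derive1 (lam jk.1 ^~ xi) t - derive1 (lam jk.2 ^~ xi) t| + 1)),
      int_log_bound T (fun t xi => \sum_(j < 3)
        modC (derive1C (fun s => checkM a s (lam j s xi)%:C xi) t)
        / (modC (checkM a t (lam j t xi)%:C xi) + 1)) &
      int_log_bound T (fun t xi => \sum_(j < 2)
        modC (derive1C (fun s => checkN a s (mu j s xi)%:C xi) t)
        / (modC (checkN a t (mu j t xi)%:C xi) + 1))].
Proof.
have anR (j : 'I_3) alpha : (j + mdeg alpha <= 3)%N ->
    analytic_on T (fun t => complex.Re (a j alpha t)).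
  move=> /a_analytic[U [_ UT H]] t tT.
  by have [] := H t (UT t _); rewrite //= in_itv.
have anI (j : 'I_3) alpha : (j + mdeg alpha <= 3)%N ->
    analytic_on T (fun t => complex.Im (a j alpha t)).
  move=> /a_analytic[U [_ UT H]] t tT.
  by have [] := H t (UT t _); rewrite //= in_itv.
pose c (j : nat) : (R * 'rV[R]_n)%type -> R := partcoef a (@complex.Re R) 3 (inord j).
have sc j k : smooth T k (c j) by exact: partcoef_smooth.
have fc j : tfrac T (c j) by exact: partcoef_tfrac.
(* [L'' = 6 * tau + 2 * c2], so subtracting it lowers the linear coefficient by 6 and the constant
   one by [2 * c2]. *)
pose c1 p := c 1%N p - 6; pose c0 p := c 0%N p - 2 * c 2%N p.
have s1 k : smooth T k c1 by apply: smoothB => //; exact: smooth_cst.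
have s0 k : smooth T k c0 by apply: smoothB => //; exact: smoothZ.
have f1 : tfrac T c1.
  by apply: (tfracD (g := c 1%N) (h := cst (-6))) => //; exact: tfrac_cst.
have f0 : tfrac T c0.
  apply: (tfrac_ext (g := fun p => c 0%N p + cst (-2) p * c 2%N p)) => [p _|].
    by rewrite /c0 /cst; ring.
  by apply: tfracD => //; apply: tfracM => //; exact: tfrac_cst.
have tle t : 0 < t < T -> 0 <= t <= T by move=> /andP[? ?]; rewrite !ltW.
pose l j p := lam j p.1 p.2; pose m j p := mu j p.1 p.2.
have lroots p : dom T p -> [/\ l (inord 0) p < l (inord 1) p, l (inord 1) p < l (inord 2) p &
    forall x, x ^+ 3 + c 2%N p * x ^+ 2 + c1 p * x + c0 p =
      (x - l (inord 0) p) * (x - l (inord 1) p) * (x - l (inord 2) p)].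
  case: p => t xi [/= tT x1].
  have H := lam_roots _ _ (tle _ tT) (euclid_norm_neq0 x1); have [Hlt _] := H.
  split; [by apply: Hlt; rewrite !inordK|by apply: Hlt; rewrite !inordK|] => x.
  rewrite -[LHS](Re_calL a t xi x) (ordered_roots_factor x (calL_size a t xi) H) calL_lead mul1r.
  rewrite !big_ord_recl big_ord0 mulr1 /= mulrA.
  by congr ((_ - lam _ _ _) * (_ - lam _ _ _) * (_ - lam _ _ _));
    apply: val_inj; rewrite /= inordK.
(* The hyperbolicity of [L] is used at this point only; the real, possibly multiple, roots feed both
   discriminant bounds. *)
have symroots p : dom T p -> exists u v w, [/\ c 2%N p = - (u + v + w),
    c 1%N p = u * v + v * w + w * u & c 0%N p = - (u * v * w)].
  case: p => t xi [/= tT x1].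
  have [[|u [|v [|w [|//]]]]//= _ H] :=
    real_rooted_factor (symL_size a t xi) (hyperbolic t xi (tle _ tT)).
  exists u, v, w; apply: cubic_coefs => x.
  rewrite -[LHS](Re_symL a t xi x) H symL_lead mul1r !big_cons big_nil mulr1 /=.
  by rewrite mulrA.
have D3 p : dom T p -> 1 <= c 2%N p ^+ 2 * c1 p ^+ 2 - 4 * c1 p ^+ 3 - 4 * c 2%N p ^+ 3 * c0 p
    + 18 * c 2%N p * c1 p * c0 p - 27 * c0 p ^+ 2.
  by move=> /symroots[u [v [w [A B C]]]]; exact: disc_sub_deriv2 A B C.
have sl j k : smooth T k (l j).
  have [S0 S1 S2] := cubic_roots_smooth (fc 2%N) f1 f0 (sc 2%N) s1 s0 lroots D3 k.
  by case: (ord3_cases j) => ->.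
have sdl j k : smooth T k (dt (l j)) by apply: smooth_dt => k'; exact: sl.
have [g01 g12 g20] := cubic_gap_inv_polygrowth (fc 2%N) f1 f0 (sc 2%N) s1 s0 lroots D3.
(* The derivative of [calL] divided by its leading coefficient 3. *)
pose d1 p := 2 / 3 * c 2%N p; pose d0 p := 3^-1 * c1 p.
have mroots p : dom T p -> m (inord 0) p < m (inord 1) p /\
    forall x, x ^+ 2 + d1 p * x + d0 p = (x - m (inord 0) p) * (x - m (inord 1) p).
  case: p => t xi [/= tT x1].
  have H := mu_roots _ _ (tle _ tT) (euclid_norm_neq0 x1); have [Hlt _] := H.
  split; [by apply: Hlt; rewrite !inordK|] => x.
  have n3 : (3 : R) != 0 by rewrite pnatr_eq0.
  apply: (mulfI n3).
  have -> : 3 * (x ^+ 2 + d1 (t, xi) * x + d0 (t, xi)) = complex.Re (calL a t xi)^`().[x%:C].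
    by rewrite Re_calL_deriv /d1 /d0 /c1 [_^-1 * _]mulrC.
  rewrite (ordered_roots_factor x (calL_deriv_size a t xi) H) calL_deriv_lead.
  have -> : (3%:R : R[i]) = (3 : R)%:C by rewrite rmorph_nat.
  rewrite -rmorphM /= !big_ord_recl big_ord0 mulr1; congr (_ * _).
  by congr ((_ - mu _ _ _) * (_ - mu _ _ _)); apply: val_inj; rewrite /= inordK.
have D2 p : dom T p -> 1 <= d1 p ^+ 2 - 4 * d0 p.
  move=> /symroots[u [v [w [A B _]]]]; rewrite /d0 /c1 [_^-1 * _]mulrC.
  exact: disc_deriv A B.
have fd1 : tfrac T d1 by apply: tfracM => //; exact: tfrac_cst.
have fd0 : tfrac T d0 by apply: tfracM => //; exact: tfrac_cst.
have sd1 k : smooth T k d1 by exact: smoothZ.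
have sd0 k : smooth T k d0 by exact: smoothZ.
have sm j k : smooth T k (m j).
  have [S0 S1] := quad_roots_smooth fd1 fd0 sd1 sd0 mroots D2 k.
  by case: (ord2_cases j) => ->.
split.
- apply: (log_controlled_int (H := fun p => \sum_(jk <- S2)
    (`|dt (l jk.1) p - dt (l jk.2) p| / `|l jk.1 p - l jk.2 p|))) => //.
  apply: log_controlled_sum => jk; rewrite !inE => /or3P[]/eqP -> /=.
  + by apply: log_controlled_gap_ratio => // p /lroots[].
  + by apply: log_controlled_gap_ratio => // p /lroots[].
  (* The pair [(3, 1)] comes in decreasing order and is swapped under the absolute values. *)
  + have -> : (fun p => `|dt (l (inord 2)) p - dt (l (inord 0)) p| / `|l (inord 2) p - l (inord 0) p|)
      = fun p => `|dt (l (inord 0)) p - dt (l (inord 2)) p| / `|l (inord 0) p - l (inord 2) p|.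
      by apply/funext => p; rewrite distrC [X in _ / X]distrC.
    apply: log_controlled_gap_ratio => // [p /lroots[A B _]|]; first exact: lt_trans A B.
    by apply: polygrowth_le g20 => p _; rewrite -opprB invrN normrN.
(* Here [u] is the derivative of a gap; it is as regular as wanted because the roots are smooth to
   every order. *)
- apply: (log_controlled_int (H := fun p => \sum_(jk <- S2)
    (`|dt (fun q => dt (l jk.1) q - dt (l jk.2) q) p|
      / (`|dt (l jk.1) p - dt (l jk.2) p| + 1)))).
    apply: log_controlled_sum => jk _; apply: log_controlled_quot => // k.
    by apply: smoothB; exact: sdl.
  by move=> p dp; apply: eq_bigr => jk _; rewrite (dt_sub (sdl _ _) (sdl _ _) dp).
(* [dt] is applied after inserting the root, so it is the total derivative of the composed
   function. *)
- apply: (log_controlled_int (H := fun p => \sum_(j <- index_enum 'I_3)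
    (Num.sqrt (dt (fun q => complex.Re (checkM a q.1 (l j q)%:C q.2)) p ^+ 2
       + dt (fun q => complex.Im (checkM a q.1 (l j q)%:C q.2)) p ^+ 2)
     / (Num.sqrt (complex.Re (checkM a p.1 (l j p)%:C p.2) ^+ 2
       + complex.Im (checkM a p.1 (l j p)%:C p.2) ^+ 2) + 1)))).
    apply: log_controlled_sum => j _; apply: log_controlled_complex => // k.
      exact: (@part_checkM_smooth R T n a T_gt0 (@complex.Re R) (@Re_add R) (@Re_mulr R) anR (fun _ _ => erefl) (lam j) k (sl j)).
    exact: (@part_checkM_smooth R T n a T_gt0 (@complex.Im R) (@Im_add R) (@Im_mulr R) anI (fun _ _ => erefl) (lam j) k (sl j)).
  by move=> p _; apply: eq_bigr => j _; rewrite !modCE.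
- apply: (log_controlled_int (H := fun p => \sum_(j <- index_enum 'I_2)
    (Num.sqrt (dt (fun q => complex.Re (checkN a q.1 (m j q)%:C q.2)) p ^+ 2
       + dt (fun q => complex.Im (checkN a q.1 (m j q)%:C q.2)) p ^+ 2)
     / (Num.sqrt (complex.Re (checkN a p.1 (m j p)%:C p.2) ^+ 2
       + complex.Im (checkN a p.1 (m j p)%:C p.2) ^+ 2) + 1)))).
    apply: log_controlled_sum => j _; apply: log_controlled_complex => // k.
      exact: (@part_checkN_smooth R T n a T_gt0 (@complex.Re R) (@Re_add R) (@Re_mulr R) anR (fun _ _ => erefl) (mu j) k (sm j)).
    exact: (@part_checkN_smooth R T n a T_gt0 (@complex.Im R) (@Im_add R) (@Im_mulr R) anI (fun _ _ => erefl) (mu j) k (sm j)).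
  by move=> p _; apply: eq_bigr => j _; rewrite !modCE.
Qed.
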